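(* Let $V(x,y)=q_{\rm av}(x)+q(x,y)=q_{\rm av}(x)+\sum_{j\ne0}q_j(x)e^{2\pi i\lambda_jy}$ satisfy Hypotheses (V'). Set $q_\epsilon(x)=q(x,x/\epsilon)$, $\Lambda_{\rm eff}(x)=\frac1{4\pi^2}\sum_{j\ne0}\frac{|q_j(x)|^2}{\lambda_j^2}$ and $\sigma^\epsilon_{\rm eff}=-\epsilon^2\Lambda_{\rm eff}$. Then: (1) There exist $\epsilon_0>0$ and a constant $C=C(N_{\rm alg}(V))$, independent of $\epsilon$ and $k$, such that for all $0<\epsilon<\epsilon_0$ $$\sup_{k\in\mathbb{R},\,|k|\le1}\left|\frac{k}{t^{q_{\rm av}+\sigma^\epsilon_{\rm eff}}(k)}-\frac{k}{t^{q_{\rm av}+q_\epsilon}(k)}\right|\le\epsilon^3\,C\,\max\Big(1,\sup_{k\in\mathbb{R},|k|\le1}|t^{q_{\rm av}}(k)|\Big)\le\epsilon^3\,C.$$ (2) If $q_{\rm av}\equiv0$, then, for $k\in\mathbb{R}$, $|k|\le1$, and $\epsilon>0$ sufficiently small, $$t^{q_\epsilon}(k)=\frac{k}{k-\frac i2\epsilon^2\int_{\mathbb{R}}\Lambda_{\rm eff}+\mathcal{O}(\epsilon^3)},$$ with the $\mathcal{O}(\epsilon^3)$ uniform in $k$.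
   Context: Function spaces: $|g|_{\mathcal{L}^1_\gamma}=\int_{\mathbb{R}}|g(x)|(1+|x|)^\gamma\,dx$, $|g|_{\mathcal{W}^{n,1}_\gamma}=\sum_{l=0}^n|\partial_x^lg|_{\mathcal{L}^1_\gamma}$. Hypotheses (V'): $V(x,y)=q_{\rm av}(x)+\sum_{j\in\mathbb{Z}\setminus\{0\}}q_j(x)e^{2\pi i\lambda_jy}$ is real-valued with $q_{\rm av}$ real-valued, $\overline{q_j}=q_{-j}$, $\lambda_{-j}=-\lambda_j$; there is $\theta>0$ with $\inf_{j\ne k}|\lambda_j-\lambda_k|\ge\theta$ and $\inf_{j\ne0}|\lambda_j|\ge\theta$ ($\lambda_j$ real); and $N_{\rm alg}(V):=|q_{\rm av}|_{\mathcal{W}^{1,1}_2}+\sum_{j\ne0}|q_j|_{\mathcal{W}^{3,1}_3}<\infty$. Jost solutions and transmission coefficient: for real-valued $U\in\mathcal{L}^1_2$ and $k\in\mathbb{R}$, $f^U_\pm(x;k)$ are the unique solutions of $(-\partial_x^2+U-k^2)u=0$ with $f^U_\pm(x;k)\sim e^{\pm ikx}$ as $x\to\pm\infty$ (equivalently, of the Volterra equations $f^U_+(x;k)=e^{ikx}+\int_x^\infty\frac{\sin(k(y-x))}{k}U(y)f^U_+(y;k)\,dy$, $f^U_-(x;k)=e^{-ikx}-\int_{-\infty}^x\frac{\sin(k(y-x))}{k}U(y)f^U_-(y;k)\,dy$, with $\sin(kz)/k=z$ at $k=0$). With $\mathcal{W}[h_1,h_2]=h_1h_2'-h_2h_1'$,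 $t^U$ is defined by $\mathcal{W}[f^U_+,f^U_-](k)=-2ik/t^U(k)$ (by continuity at $k=0$), and $k/t^U(k)$ denotes $-\mathcal{W}[f^U_+,f^U_-](k)/(2i)$. Constants may also depend on the fixed parameter $\theta$. *)

(* Defs.v *)
From HB Require Import structures.
From mathcomp Require Import all_boot all_order all_algebra.
From mathcomp Require Import all_classical all_reals all_analysis.
From mathcomp Require Import complex.

Set Implicit Arguments.
Unset Strict Implicit.
Unset Printing Implicit Defensive.

Import Order.TTheory GRing.Theory Num.Theory.
Import numFieldNormedType.Exports.

Local Open Scope classical_set_scope.
Local Open Scope ring_scope.

(* Calculus for complex-valued functions.  Integrals, derivatives and limits
   are taken componentwise, so that only the topology and the Lebesgue
   measure of R are involved. *)
Section ComplexValued.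
Context {R : realType}.
Local Notation mu := (@lebesgue_measure R).
Implicit Types (f g : R -> R[i]) (D : set R).

(* real-valued modulus; the generic norm `|z| lives in R[i] *)
Definition cmod (z : R[i]) : R := complex.Re `|z|.

Definition cexpi (x : R) : R[i] := Complex (cos x) (sin x).

Definition cintegrable D f :=
  mu.-integrable D (fun x => (complex.Re (f x))%:E) /\
  mu.-integrable D (fun x => (complex.Im (f x))%:E).

Definition cint D f : R[i] :=
  Complex (\int[mu]_(x in D) complex.Re (f x))
          (\int[mu]_(x in D) complex.Im (f x)).

Definition cderive f (x : R) : R[i] :=
  Complex (derive1 (fun y => complex.Re (f y)) x)
          (derive1 (fun y => complex.Im (f y)) x).

Definition clim (T : Type) (F : set_system T) (f : T -> R[i]) : R[i] :=
  Complex (lim ((fun x => complex.Re (f x)) @ F))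
          (lim ((fun x => complex.Im (f x)) @ F)).

Definition clocally_integrable f :=
  locally_integrable setT (fun x => complex.Re (f x)) /\
  locally_integrable setT (fun x => complex.Im (f x)).

End ComplexValued.

Section FunctionSpaces.
Context {R : realType}.
Local Notation mu := (@lebesgue_measure R).

Definition C1_compact_support (phi : R -> R) :=
  [/\ forall x, derivable phi x 1,
      continuous (derive1 phi) &
      exists M : R, forall x, M < `|x| -> phi x = 0].

Definition weak_derivative (g h : R -> R[i]) :=
  [/\ clocally_integrable g, clocally_integrable h &
      forall phi, C1_compact_support phi ->
        cint setT (fun x => g x * (derive1 phi x)%:C%C) =
        - cint setT (fun x => h x * (phi x)%:C%C)].

Definition L1_norm (gamma : nat) (g : R -> R[i]) : \bar R :=
  (\int[mu]_x (cmod (g x) * (1 + `|x|) ^+ gamma)%:E)%E.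

(* h 0 = g, h 1, ..., h n are successive weak derivatives of g; they are
   unique up to null sets, so the set below has at most one element.  Its
   infimum is +oo when g is not n times weakly differentiable. *)
Definition W1_norm (n gamma : nat) (g : R -> R[i]) : \bar R :=
  ereal_inf [set (\sum_(l < n.+1) L1_norm gamma (h l))%E
            | h in [set h : nat -> R -> R[i] | h 0%N = g /\
                forall l, (l < n)%N -> weak_derivative (h l) (h l.+1)]].

End FunctionSpaces.

Section Scattering.
Context {R : realType}.

(* sin (k z) / k, extended by continuity at k = 0 *)
Definition sinck (k z : R) : R := if k == 0 then z else sin (k * z) / k.

Definition is_jostp (U : R -> R) (k : R) (f : R -> R[i]) := forall x,
  cintegrable `[x, +oo[ (fun y => (sinck k (y - x) * U y)%:C%C * f y) /\
  f x = cexpi (k * x)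
      + cint `[x, +oo[ (fun y => (sinck k (y - x) * U y)%:C%C * f y).

Definition is_jostm (U : R -> R) (k : R) (f : R -> R[i]) := forall x,
  cintegrable `]-oo, x] (fun y => (sinck k (y - x) * U y)%:C%C * f y) /\
  f x = cexpi (- (k * x))
      - cint `]-oo, x] (fun y => (sinck k (y - x) * U y)%:C%C * f y).

Definition jostp (U : R -> R) (k : R) : R -> R[i] :=
  xget (fun=> 0) [set f | is_jostp U k f].

Definition jostm (U : R -> R) (k : R) : R -> R[i] :=
  xget (fun=> 0) [set f | is_jostm U k f].

Definition wronskian (h1 h2 : R -> R[i]) (x : R) : R[i] :=
  h1 x * cderive h2 x - h2 x * cderive h1 x.

(* k / t^U(k).  The Wronskian of two solutions of the same equation does not
   depend on x; it is evaluated at x = 0. *)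
Definition k_over_t (U : R -> R) (k : R) : R[i] :=
  - wronskian (jostp U k) (jostm U k) 0 / (2 * Complex 0 1).

Definition transmission (U : R -> R) (k : R) : R[i] :=
  if k == 0 then clim (0 : R)^' (fun k' : R => k'%:C%C / k_over_t U k')
  else k%:C%C / k_over_t U k.

(* k / D k, where only the indeterminate 0 / 0 at k = 0 is read as a limit *)
Definition k_quotient (D : R -> R[i]) (k : R) : R[i] :=
  if (k == 0) && (D k == 0) then clim (0 : R)^' (fun k' : R => k'%:C%C / D k')
  else k%:C%C / D k.

Definition sup_low (F : R -> R) : \bar R :=
  ereal_sup [set (F k)%:E | k in [set k : R | `|k| <= 1]].

End Scattering.

Section Potentials.
Context {R : realType}.
Local Notation mu := (@lebesgue_measure R).
Implicit Types (qav : R -> R) (q : int -> R -> R[i]) (lam : int -> R).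

(* Coefficients are indexed by int; the values q 0 and lam 0 are never used. *)
Definition nonzero_int : set int := [set j | j != 0].

(* Sum over j != 0 as the limit of the symmetric partial sums.  It is applied
   to terms that are absolutely summable for almost every x. *)
Definition sum_nonzero (a : int -> R[i]) : R[i] :=
  clim \oo (fun n : nat => \sum_(1 <= j < n) (a j%:Z + a (- j%:Z))).

Definition osc q lam (x y : R) : R[i] :=
  sum_nonzero (fun j => q j x * cexpi (2 * pi * lam j * y)).

Definition Nalg qav q : \bar R :=
  (W1_norm 1 2 (fun x => (qav x)%:C%C)
   + \esum_(j in nonzero_int) W1_norm 3 3 (q j))%E.

Record hypV (theta : R) qav q lam : Prop := HypV {
  hypV_real : forall x y, complex.Im ((qav x)%:C%C + osc q lam x y) = 0 ;
  hypV_conj : forall j, j != 0 -> forall x, conjc (q j x) = q (- j) x ;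
  hypV_odd : forall j, j != 0 -> lam (- j) = - lam j ;
  hypV_gap : forall j k, j != 0 -> k != 0 -> j != k ->
    theta <= `|lam j - lam k| ;
  hypV_gap0 : forall j, j != 0 -> theta <= `|lam j| ;
  hypV_fin : (Nalg qav q < +oo)%E }.

(* osc is real-valued under hypV, so taking the real part loses nothing. *)
Definition q_eps q lam (eps x : R) : R := complex.Re (osc q lam x (x / eps)).

Definition Lambda_eff q lam (x : R) : R :=
  (4 * pi ^+ 2)^-1 *
  fine (\esum_(j in nonzero_int) (cmod (q j x) ^+ 2 / lam j ^+ 2)%:E).

Definition sigma_eff q lam (eps x : R) : R := - eps ^+ 2 * Lambda_eff q lam x.

Definition int_Lambda_eff q lam : R := \int[mu]_x Lambda_eff q lam x.

End Potentials.

(* Main.v *)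
Require Import Defs.
From HB Require Import structures.
From mathcomp Require Import all_boot all_order all_algebra.
From mathcomp Require Import all_classical all_reals all_analysis.
From mathcomp Require Import complex measurable_realfun.
From mathcomp Require Import ring lra.
Import Order.TTheory GRing.Theory Num.Theory.
Import numFieldNormedType.Exports.
Local Open Scope classical_set_scope.
Local Open Scope ring_scope.

Set Implicit Arguments.
Unset Strict Implicit.
Unset Printing Implicit Defensive.

(* The Wronskian of the Jost solution f = f_+ for U1 and g = f_- for U2 shows
   that k/t^{U1} - k/t^{U2} is, up to sign, (i/2) times the integral of
   (U2 - U1) f g.  Take U1 = q_av + sigma and U2 = q_av + q_eps, truncated to
   finitely many frequencies om_j = 2 pi lam_j / eps.  Two integrations by parts
   turn each integral of q_j f g e^{i om_j x} into - om_j^-2 times that of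
   (q_j f g)'' e^{i om_j x}.  The term U2 f g of (f g)'' produces q_j q_l with
   phase om_j + om_l; the resonant pairs l = -j sum up to exactly the integral of
   sigma f g, which is why sigma is the effective potential.  All remaining terms
   still oscillate, at frequencies at least theta / eps, and one more integration
   by parts makes them O(eps^3), uniformly in the truncation.  The truncation is
   removed by the Lipschitz dependence of k/t on the potential in the norm with
   weight (1 + |x|)^2.  The sup of |t| is at most 1 by flux conservation.  For
   q_av = 0 it remains to expand k/t^sigma to first order in sigma = O(eps^2). *)

(** * Lebesgue integrals of real functions *)

(** The difficulty is uniformity down to k = 0. There sin(kz)/k is bounded only by |z|, so Jost
    solutions may grow linearly, f g grows like (1 + |x|)^2, and coefficients have to be integrable
    against this weight. Taking f for U1 and g for U2 makes the Wronskian identity exact: there is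
    no remainder quadratic in U2 - U1, which matters because q_eps is not small. In exchange (f g)''
    contains both U1 and U2, and also 2 f' g', which has to be integrated by parts as an amplitude
    of its own. The scheme dictates the derivative count: all three integrations by parts may fall
    on q_j, whereas q_av appears after the second one, inside q_j q_av f g, and is differentiated
    once. The frequency gap enters through om_j + om_l = om_j - om_{-l}, of size at least theta /
    eps off resonance. Coefficients are given through weak derivatives and potentials are only
    integrable, so derivatives are treated as densities of absolutely continuous functions, and
    potentials are changed on null sets when needed. With finitely many modes sums and integrals
    commute freely, while the bounds see only the sum of the norms of the modes. *)

Notation intg D f := ((@lebesgue_measure _).-integrable D (EFin \o f)).

Lemma eq_ler (R : realType) (a b : R) : a = b -> a <= b.
Proof. by move=> ->. Qed.

Section RealIntegrals.
Context {R : realType}.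
Local Notation mu := (@lebesgue_measure R).
Implicit Types (f g h a b : R -> R) (D : set R).

Lemma ae_mono (P Q : R -> Prop) : (forall x, P x -> Q x) ->
  {ae mu, forall x, P x} -> {ae mu, forall x, Q x}.
Proof. by move=> PQ; apply: filterS; first exact: (ae_filter_ringOfSetsType mu). Qed.

Lemma ae_and (P Q S : R -> Prop) : (forall x, P x -> Q x -> S x) ->
  {ae mu, forall x, P x} -> {ae mu, forall x, Q x} -> {ae mu, forall x, S x}.
Proof. by move=> PQ; apply: filterS2; first exact: (ae_filter_ringOfSetsType mu). Qed.

Lemma intg_meas D f : measurable D -> intg D f -> measurable_fun D f.
Proof. by move=> mD /(measurable_int mu)/measurable_EFinP. Qed.

Lemma intg_le D f g : measurable D -> measurable_fun D f ->
  (forall x, D x -> `|f x| <= g x) -> intg D g -> intg D f.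
Proof.
move=> mD mf fg; apply: le_integrable => //; first exact/measurable_EFinP.
by move=> x Dx; rewrite /= lee_fin (le_trans (fg x Dx)) // ler_norm.
Qed.

Lemma eq_intg D f g : measurable D -> (forall x, D x -> f x = g x) ->
  intg D f -> intg D g.
Proof.
move=> mD fg; apply: eq_integrable => // x /set_mem Dx.
by rewrite /= fg.
Qed.

Lemma intgD D f g : measurable D -> intg D f -> intg D g ->
  intg D (fun x => f x + g x).
Proof. by move=> mD /integrableD H /H; apply. Qed.

Lemma intgN D f : measurable D -> intg D f -> intg D (fun x => - f x).
Proof. by move=> mD /integrableN; apply. Qed.

Lemma intgB D f g : measurable D -> intg D f -> intg D g ->
  intg D (fun x => f x - g x).
Proof. by move=> mD If Ig; apply: intgD => //; apply: intgN. Qed.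

Lemma intgZ D k f : measurable D -> intg D f -> intg D (fun x => k * f x).
Proof. by move=> mD /integrableZl; apply. Qed.

Lemma intg0 D : measurable D -> intg D (fun=> 0 : R).
Proof. by move=> mD; apply: integrable0. Qed.

Lemma intgS D E f : measurable D -> measurable E -> D `<=` E -> intg E f -> intg D f.
Proof. by move=> mD mE DE; apply: integrableS. Qed.

Lemma intg_norm D f : measurable D -> intg D f -> intg D (fun x => `|f x|).
Proof. by move=> mD; apply: integrable_norm. Qed.

Lemma intg_bdd D f g M : measurable D -> measurable_fun D g ->
  (forall x, D x -> `|g x| <= M) -> intg D f -> intg D (fun x => g x * f x).
Proof.
move=> mD mg gM If.
apply: (@intg_le _ _ (fun x => M * `|f x|)) => //.
- by apply: measurable_funM => //; apply: intg_meas.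
- by move=> x Dx; rewrite normrM ler_wpM2r // gM.
- by apply: intgZ => //; apply: intg_norm.
Qed.

Lemma intg_sum (I : Type) (s : seq I) (P : pred I) D (F : I -> R -> R) : measurable D ->
  (forall i, intg D (F i)) -> intg D (fun x => \sum_(i <- s | P i) F i x).
Proof.
move=> mD H.
apply: (@eq_integrable _ _ _ mu D mD (fun x => \sum_(i <- s | P i) (F i x)%:E)%E).
  by move=> x _ /=; rewrite sumEFin.
by apply: integrable_sum => // i _; apply: H.
Qed.

Lemma Rint_sum (I : Type) (s : seq I) (P : pred I) D (F : I -> R -> R) : measurable D ->
  (forall i, intg D (F i)) ->
  \int[mu]_(x in D) (\sum_(i <- s | P i) F i x) = \sum_(i <- s | P i) \int[mu]_(x in D) F i x.
Proof.
move=> mD H; elim: s => [|i s IH].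
  by under eq_Rintegral do rewrite big_nil; rewrite big_nil Rintegral_cst // mul0r.
under eq_Rintegral do rewrite big_cons.
rewrite big_cons; case: (P i) => //.
by rewrite RintegralD // ?IH //; apply: intg_sum.
Qed.

Lemma Rint_le0 D f g : measurable D -> measurable_fun D f ->
  (forall x, D x -> `|f x| <= g x) -> intg D g ->
  `|\int[mu]_(x in D) f x| <= \int[mu]_(x in D) g x.
Proof.
move=> mD mf fg Ig; have If : intg D f by apply: intg_le Ig.
apply: (le_trans (le_normr_Rintegral _ _)) => //.
by apply: le_Rintegral => //; apply: intg_norm.
Qed.

Lemma Rint_ae D f g : measurable D -> measurable_fun D f -> measurable_fun D g ->
  {ae mu, forall x, D x -> f x = g x} ->
  \int[mu]_(x in D) f x = \int[mu]_(x in D) g x.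
Proof.
move=> mD mf mg fg; congr fine; apply: ae_eq_integral => //.
- exact/measurable_EFinP.
- exact/measurable_EFinP.
- by apply: ae_mono fg => x fgx Dx; rewrite fgx.
Qed.

Lemma intg_ae D f g : measurable D -> measurable_fun D g ->
  {ae mu, forall x, D x -> f x = g x} -> intg D f -> intg D g.
Proof.
move=> mD mg fg If.
have mf : measurable_fun D f by apply: intg_meas.
move: If => /integrableP [_ If]; apply/integrableP; split.
  exact/measurable_EFinP.
rewrite (le_lt_trans _ If) // le_eqVlt; apply/orP; left; apply/eqP.
apply: ae_eq_integral => //.
- by apply: measurableT_comp => //; apply/measurable_EFinP.
- by apply: measurableT_comp => //; apply/measurable_EFinP.
- by apply: ae_mono fg => x fgx Dx /=; rewrite fgx.
Qed.

Lemma Rint_itv_split f (a b c : R) : a <= b -> b <= c -> intg `[a, c] f ->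
  \int[mu]_(x in `[a, c]) f x =
  \int[mu]_(x in `[a, b]) f x + \int[mu]_(x in `[b, c]) f x.
Proof.
move=> ab bc If.
have := @Rintegral_itvB R f (BLeft a) (BRight c) b If.
rewrite !bnd_simp => /(_ ab bc) /(canRL (subrK _)) ->.
rewrite addrC Rintegral_itv_obnd_cbnd //.
apply: intgS If => //.
by apply: subset_itvr; rewrite bnd_simp.
Qed.

Lemma Rint_itvy_split f (a b : R) : a <= b -> intg `[a, +oo[ f ->
  \int[mu]_(x in `[a, +oo[) f x =
  \int[mu]_(x in `[a, b]) f x + \int[mu]_(x in `[b, +oo[) f x.
Proof.
move=> ab If.
have := @Rintegral_itvB R f (BLeft a) (BInfty _ false) b If.
rewrite !bnd_simp => /(_ ab isT) /(canRL (subrK _)) ->.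
rewrite addrC Rintegral_itv_obnd_cbnd //.
apply: intgS If => //.
by apply: subset_itvr; rewrite bnd_simp.
Qed.

Lemma measurable_fun_cont f D : measurable D -> continuous f -> measurable_fun D f.
Proof.
move=> mD cf; apply: (@measurable_funS _ _ _ _ setT) => //.
exact: continuous_measurable_fun.
Qed.

(** Product domination makes [h] integrable on the plane, so Fubini applies. It also makes every
    slice integrable, which turns the extended-real inner integrals into finite ones. *)
Lemma Rfubini (h : R * R -> R) a b : measurable_fun setT h -> intg setT a -> intg setT b ->
  (forall x y, `|h (x, y)| <= `|a x| * `|b y|) ->
  \int[mu]_x (\int[mu]_y h (x, y)) = \int[mu]_y (\int[mu]_x h (x, y)).
Proof.
move=> mh Ia Ib hab.
have mhE : measurable_fun setT (EFin \o h) by apply/measurable_EFinP.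
have mhx x : measurable_fun setT (fun y => h (x, y)) by apply: measurableT_comp mh _.
have mhy y : measurable_fun setT (fun x => h (x, y)) by apply: measurableT_comp mh _.
have Ihx x : intg setT (fun y => h (x, y)).
  apply: (@intg_le _ _ (fun y => `|a x| * `|b y|)) => //.
  by apply: intgZ => //; apply: intg_norm.
have Ihy y : intg setT (fun x => h (x, y)).
  apply: (@intg_le _ _ (fun x => `|b y| * `|a x|)) => //.
    by move=> x _; rewrite mulrC hab.
  by apply: intgZ => //; apply: intg_norm.
have Ihh : (mu \x mu)%E.-integrable setT (EFin \o h).
  apply/integrable12ltyP => //.
  apply: (@le_lt_trans _ _ (\int[mu]_x (`|a x|%:E * \int[mu]_y `|b y|%:E))%E).
    apply: ge0_le_integral => //.
    - by move=> x _; apply: integral_ge0.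
    - apply: (@measurable_fun_fubini_tonelli_F _ _ _ _ _ mu (fun z => `|(h z)%:E|%E)) => //.
      by apply: measurableT_comp.
    - apply: emeasurable_funM => //.
      apply/measurable_EFinP; apply: measurableT_comp => //.
      by apply: intg_meas.
    - move=> x _; rewrite -ge0_integralZl //.
      + apply: ge0_le_integral => //.
        * apply: (@measurableT_comp _ _ _ _ _ _ abse) => //.
          by have /measurable_EFinP := mhx x.
        * apply: measurable_funeM; apply/measurable_EFinP; apply: measurableT_comp => //.
          by apply: intg_meas.
        * by move=> y _ /=; rewrite -EFinM lee_fin hab.
      + apply/measurable_EFinP; apply: measurableT_comp => //.
        by apply: intg_meas.
  rewrite ge0_integralZr //.
  - apply: lte_mul_pinfty.
    + exact: integral_ge0.
    + by apply/integrable_fin_num => //; apply: intg_norm.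
    + by case/integrableP : Ib.
  - apply/measurable_EFinP; apply: measurableT_comp => //.
    by apply: intg_meas.
  - exact: integral_ge0.
have Ex x : (\int[mu]_y (h (x, y))%:E)%E = (\int[mu]_y h (x, y))%:E.
  by rewrite /Rintegral fineK //; exact: (integrable_fin_num measurableT (Ihx x)).
have Ey y : (\int[mu]_x (h (x, y))%:E)%E = (\int[mu]_x h (x, y))%:E.
  by rewrite /Rintegral fineK //; exact: (integrable_fin_num measurableT (Ihy y)).
have := Fubini Ihh => /=.
under eq_integral do rewrite Ex.
under [in RHS]eq_integral do rewrite Ey.
by rewrite {1 3}/Rintegral => ->.
Qed.

End RealIntegrals.

(** * Absolutely continuous functions and integration by parts *)

Section Primitive.
Context {R : realType}.
Local Notation mu := (@lebesgue_measure R).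
Implicit Types (f g h F G : R -> R).

(** Local absolute continuity with density [f]. Second derivatives of Jost solutions exist only in
    this integrated sense, so the calculus is done on such pairs instead of pointwise
    derivatives. *)
Definition prim F f := (forall a b, intg `[a, b] f) /\
  forall a b, a <= b -> F b - F a = \int[mu]_(x in `[a, b]) f x.

Lemma prim_cont F f : prim F f -> continuous F.
Proof.
move=> [If FE] x.
have xx : x - 1 <= x + 1 by lra.
have := parameterized_integral_continuous xx (If _ _).
move=> /(continuous_within_itvP _ _)[]; first by lra.
move=> /(_ x) H _ _.
have {}H := H ltac:(by rewrite in_itv /=; apply/andP; split; lra).
have E : \forall y \near x, parameterized_integral mu (x - 1) y f + F (x - 1) = F y.
  near=> y; rewrite /parameterized_integral -FE ?subrK //.
  near: y; exists 1 => //= y; rewrite /ball_ /= ltr_norml; lra.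
have {}H : parameterized_integral mu (x - 1) y f + F (x - 1) @[y --> x] --> F x.
  rewrite -(nbhs_singleton E); apply: cvgD => //; exact: cvg_cst.
by apply: cvg_trans H; exact: near_eq_cvg.
Unshelve. all: by end_near. Qed.

Lemma eq_prim F f F' f' : F =1 F' -> f =1 f' -> prim F f -> prim F' f'.
Proof. by move=> /funext <- /funext <-. Qed.

Lemma primD F f G g : prim F f -> prim G g ->
  prim (fun x => F x + G x) (fun x => f x + g x).
Proof.
move=> [If FE] [Ig GE]; split=> [a b|a b ab]; first exact: intgD.
rewrite RintegralD // -FE // -GE //; ring.
Qed.

Lemma primZ c F f : prim F f -> prim (fun x => c * F x) (fun x => c * f x).
Proof.
move=> [If FE]; split=> [a b|a b ab]; first exact: intgZ.
by rewrite RintegralZl // -FE // mulrBr.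
Qed.

Lemma primN F f : prim F f -> prim (fun x => - F x) (fun x => - f x).
Proof. by move=> /(primZ (-1)); apply: eq_prim => x; rewrite mulN1r. Qed.

Lemma primB F f G g : prim F f -> prim G g ->
  prim (fun x => F x - G x) (fun x => f x - g x).
Proof. by move=> HF /primN; apply: primD. Qed.

Lemma prim_cst c : prim (fun=> c) (fun=> 0).
Proof.
split=> [a b|a b ab]; first exact: intg0.
by rewrite Rintegral_cst // subrr mul0r.
Qed.

Lemma prim_meas F f : prim F f -> measurable_fun setT f.
Proof.
move=> [If _].
have -> : [set: R] = \bigcup_(n : nat) `[- n%:R, (n%:R : R)]%classic.
  apply/seteqP; split=> x // _.
  have [n xn] : exists n : nat, `|x| <= n%:R.
    exists (Num.truncn `|x|).+1; exact/ltW/truncnS_gt.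
  exists n => //=; rewrite in_itv /=; by rewrite -ler_norml.
apply/measurable_fun_bigcup => // n.
by apply: intg_meas.
Qed.

(** Fubini for f(x) g(y) on the triangle y <= x of [a, b]^2: integrating in y first leaves f(x) (G x
    - G a), integrating in x first leaves g(y) (F b - F y). Equating the two is integration by
    parts. *)
Lemma primM F f G g : prim F f -> prim G g ->
  prim (fun x => F x * G x) (fun x => f x * G x + F x * g x).
Proof.
move=> pF pG; have cF := prim_cont pF; have cG := prim_cont pG.
have mF := prim_meas pF; have mG := prim_meas pG.
case: pF pG => [If FE] [Ig GE].
have Ib (H h : R -> R) a b : continuous H -> intg `[a, b] h -> intg `[a, b] (fun x => H x * h x).
  move=> cH Ih.
  have : compact [set H x | x in `[a, b]%classic].
    apply: continuous_compact; last exact: segment_compact.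
    exact: continuous_subspaceT.
  move=> /compact_bounded [M [_ HM]].
  apply: (@intg_bdd _ _ _ _ (M + 1)) => //; first exact: measurable_fun_cont.
  by move=> x xab; apply: HM; [rewrite ltrDl|exists x].
split=> [a b|a b ab].
  apply: intgD => //; last exact: Ib.
  by apply: eq_intg (Ib G f a b cG (If a b)) => // x _; rewrite mulrC.
pose fa := f \_ `[a, b]; pose ga := g \_ `[a, b].
pose A := [set z : R * R | z.2 <= z.1].
pose h (z : R * R) := fa z.1 * ga z.2 * \1_A z.
have Ifa : intg setT fa.
  rewrite /fa -restrict_EFin; apply/integrable_restrict => //; by rewrite setTI.
have Iga : intg setT ga.
  rewrite /ga -restrict_EFin; apply/integrable_restrict => //; by rewrite setTI.
have mA : measurable A.
  have -> : A = setT `&` (fun z : R * R => z.2 <= z.1) @^-1` [set true].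
    by rewrite setTI; apply/seteqP; split=> z.
  by apply: measurable_fun_ler.
have mh : measurable_fun setT h.
  apply: measurable_funM; last exact: measurable_indic.
  apply: measurable_funM.
    by apply: (measurableT_comp (f := fa)) => //; apply: intg_meas.
  by apply: (measurableT_comp (f := ga)) => //; apply: intg_meas.
have hab x y : `|h (x, y)| <= `|fa x| * `|ga y|.
  rewrite /h /= !normrM ler_piMr ?mulr_ge0 // indicE.
  by case: (_ \in _); rewrite ?normr1 ?normr0.
have hE x y : h (x, y) = fa x * ga y * \1_A (x, y) by [].
have := Rfubini mh Ifa Iga hab.
have E1 x : \int[mu]_y h (x, y) = ((fun x => f x * (G x - G a)) \_ `[a, b]) x.
  under eq_Rintegral do rewrite hE.
  rewrite {1}/fa !patchE; case: ifPn => [xab|_]; last first.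
    under eq_Rintegral do rewrite !mul0r.
    by rewrite Rintegral_cst // mul0r.
  move: xab; rewrite inE /= in_itv /= => /andP [ax xb].
  under eq_Rintegral do rewrite -mulrA.
  rewrite RintegralZl //; last first.
    apply: (@intg_le _ _ _ (fun y => `|ga y|)) => //; last exact: intg_norm.
      apply: measurable_funM; first by apply: intg_meas.
      by apply: (@measurableT_comp _ _ _ _ _ _ (\1_A : R * R -> R)) => //.
    move=> y _; rewrite normrM ler_piMr // indicE.
    by case: (_ \in _); rewrite ?normr1 ?normr0.
  congr (_ * _); rewrite GE // [RHS]Rintegral_mkcond; apply: eq_Rintegral => y _.
  rewrite /ga !patchE !mem_setE !in_itv /= indicE.
  have -> : ((x, y) \in A) = (y <= x) by apply/idP/idP; rewrite inE.
  case: (leP a y) => ay; case: (leP y x) => yx; rewrite /= ?mulr0 ?mul0r ?mulr1 ?if_same //.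
  by rewrite (le_trans yx xb).
have E2 y : \int[mu]_x h (x, y) = ((fun y => g y * (F b - F y)) \_ `[a, b]) y.
  under eq_Rintegral do rewrite hE.
  rewrite {1}/ga !patchE; case: ifPn => [yab|_]; last first.
    under eq_Rintegral do rewrite mulr0 !mul0r.
    by rewrite Rintegral_cst // mul0r.
  move: yab; rewrite inE /= in_itv /= => /andP [ay yb].
  under eq_Rintegral do rewrite (mulrC (fa _)) -mulrA.
  rewrite RintegralZl //; last first.
    apply: (@intg_le _ _ _ (fun y => `|fa y|)) => //; last exact: intg_norm.
      apply: measurable_funM; first by apply: intg_meas.
      by apply: (@measurableT_comp _ _ _ _ _ _ (\1_A : R * R -> R)) => //.
    move=> x _; rewrite normrM ler_piMr // indicE.
    by case: (_ \in _); rewrite ?normr1 ?normr0.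
  congr (_ * _); rewrite FE // [RHS]Rintegral_mkcond; apply: eq_Rintegral => x _.
  rewrite /fa !patchE !mem_setE !in_itv /= indicE.
  have -> : ((x, y) \in A) = (y <= x) by apply/idP/idP; rewrite inE.
  case: (leP x b) => xb; case: (leP y x) => yx; rewrite /=
      ?andbT ?andbF ?mulr0 ?mul0r ?mulr1 ?if_same //.
  by rewrite (le_trans ay yx).
under eq_Rintegral do rewrite E1.
under [in X in _ = X -> _]eq_Rintegral do rewrite E2.
rewrite -!Rintegral_mkcond => E.
have IfG : intg `[a, b] (fun x => f x * G x).
  by apply: eq_intg (Ib G f a b cG (If a b)) => // x _; rewrite mulrC.
have IgF : intg `[a, b] (fun x => F x * g x) by apply: Ib.
rewrite RintegralD //.
have -> : \int[mu]_(x in `[a, b]) (f x * G x) =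
    \int[mu]_(x in `[a, b]) (f x * (G x - G a)) + G a * \int[mu]_(x in `[a, b]) f x.
  rewrite -RintegralZl // -RintegralD //; last first.
  - exact: intgZ.
  - apply: eq_intg (intgB _ IfG (intgZ (G a) _ (If a b))) => // x _; ring.
  by apply: eq_Rintegral => x _; ring.
rewrite E.
have -> : \int[mu]_(x in `[a, b]) (F x * g x) =
    F b * \int[mu]_(x in `[a, b]) g x - \int[mu]_(x in `[a, b]) (g x * (F b - F x)).
  rewrite -RintegralZl // -RintegralB //.
  - by apply: eq_Rintegral => x _; ring.
  - exact: intgZ.
  - apply: eq_intg (intgB _ (intgZ (F b) _ (Ig a b)) IgF) => // x _; ring.
rewrite -FE // -GE //; ring.
Qed.

End Primitive.

Section PrimitiveMore.
Context {R : realType}.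
Local Notation mu := (@lebesgue_measure R).
Implicit Types (f g h F G : R -> R).

Lemma intg_patch D h : measurable D -> intg setT h -> intg setT (h \_ D).
Proof.
move=> mD Ih; rewrite -restrict_EFin; apply/integrable_restrict => //.
by rewrite setTI; apply: intgS Ih.
Qed.

Lemma Rint_cvg_sets h (D : nat -> set R) (E : set R) : intg setT h ->
  (forall n, measurable (D n)) -> measurable E ->
  (forall x, \forall n \near \oo, (x \in D n) = (x \in E)) ->
  (fun n => \int[mu]_(x in D n) h x) @ \oo --> \int[mu]_(x in E) h x.
Proof.
move=> Ih mD mE DE.
pose hn n x := ((h \_ (D n)) x)%:E.
have mh := intg_meas measurableT Ih.
have [|||||_ _] := @dominated_convergence _ _ _ mu _ measurableT hn
  (EFin \o (h \_ E)) (EFin \o (fun x => `|h x|)).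
- by move=> n; apply/measurable_EFinP; apply: intg_meas => //; exact: intg_patch.
- by apply/measurable_EFinP; apply: intg_meas => //; exact: intg_patch.
- apply: aeW => x _; apply: cvg_near_cst.
  by apply: filterS (DE x) => n e; rewrite /hn /= !patchE e.
- exact: (intg_norm _ Ih).
- apply: aeW => x n _; rewrite /hn /= patchE lee_fin.
  by case: ifP; rewrite ?normr0.
have fin A : measurable A -> (\int[mu]_x ((h \_ A) x)%:E)%E \is a fin_num.
  move=> mA; apply: (@integrable_fin_num _ _ _ mu _ measurableT (EFin \o (h \_ A))).
  exact: intg_patch.
rewrite /hn /= => H; rewrite Rintegral_mkcond.
have -> : (fun n => \int[mu]_(x in D n) h x) =
    (fun n => fine (\int[mu]_x ((h \_ (D n)) x)%:E)).
  by apply/funext => n; rewrite Rintegral_mkcond.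
by apply: fine_cvg; rewrite fineK ?fin.
Qed.

Lemma Rint_tail_cvg0 h : intg setT h ->
  (fun n : nat => \int[mu]_(x in `[n%:R, +oo[) h x) @ \oo --> 0.
Proof.
move=> Ih; rewrite -(Rintegral_set0 mu h); apply: Rint_cvg_sets => // x.
near=> n; rewrite in_set0; apply/negP; rewrite inE /= in_itv /= andbT.
apply/negP; rewrite -ltNge.
have : (Num.truncn `|x|).+1%:R <= n%:R :> R by rewrite ler_nat; near: n; exact: nbhs_infty_ge.
by apply: lt_le_trans; rewrite (le_lt_trans (ler_norm x)) // truncnS_gt.
Unshelve. all: by end_near. Qed.

Lemma Rint_sym_cvg h : intg setT h ->
  (fun n : nat => \int[mu]_(x in `[- n%:R, n%:R]) h x) @ \oo --> \int[mu]_x h x.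
Proof.
move=> Ih; apply: Rint_cvg_sets => // x.
near=> n; rewrite in_setT mem_setE in_itv /= -ler_norml.
have : (Num.truncn `|x|).+1%:R <= n%:R :> R by rewrite ler_nat; near: n; exact: nbhs_infty_ge.
by apply: le_trans; apply/ltW; rewrite truncnS_gt.
Unshelve. all: by end_near. Qed.

Lemma prim_tail h : (forall x, intg `[x, +oo[ h) ->
  prim (fun x => \int[mu]_(y in `[x, +oo[) h y) (fun x => - h x).
Proof.
move=> Ih.
have Ib a b : intg `[a, b] h.
  apply: (intgS _ _ _ (Ih a)) => //.
  by move=> x /=; rewrite !in_itv /= andbT => /andP[].
split=> [a b|a b ab]; first exact: intgN.
rewrite (Rint_itvy_split ab) //.
have -> : \int[mu]_(x in `[a, b]) (- h x) = - \int[mu]_(x in `[a, b]) h x.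
  under eq_Rintegral do rewrite -mulN1r.
  by rewrite RintegralZl ?mulN1r.
ring.
Qed.

Lemma Rint_opp D h : measurable D -> measurable_fun setT h -> intg D h ->
  intg ((-%R) @^-1` D) (fun x => h (- x)) /\
  \int[mu]_(x in (-%R) @^-1` D) h (- x) = \int[mu]_(x in D) h x.
Proof.
move=> mD mh Ih.
have mo : measurable_fun [set: measurableTypeR R] (-%R : R -> measurableTypeR R).
  exact: oppr_measurable.
have mD' : measurable ((-%R : R -> R) @^-1` D) by rewrite -[X in measurable X]setTI; exact: mo.
have E A : measurable A -> A `<=` D ->
    pushforward mu (-%R : _ -> measurableTypeR R) A = mu A.
  by move=> mA _; exact: lebesgue_measureN.
have mh' : measurable_fun setT (EFin \o h) by apply/measurable_EFinP.
have Ih' : intg ((-%R) @^-1` D) (fun x => h (- x)).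
  apply/integrableP; split.
    apply/measurable_EFinP; apply: measurable_funTS.
    exact: (measurableT_comp mh).
  case/integrableP : Ih => _; apply: le_lt_trans.
  rewrite -(eq_measure_integral _ E) ge0_integral_pushforward //.
  by apply: measurableT_comp => //; exact: measurable_funTS.
split=> //; congr fine.
by rewrite -[RHS](eq_measure_integral _ E) (integral_pushforward mo mh' Ih').
Qed.

Lemma prim_opp F f : prim F f -> prim (fun x => F (- x)) (fun x => - f (- x)).
Proof.
move=> pF; have mf := prim_meas pF; case: pF => If FE.
have E a b : (-%R : R -> R) @^-1` `[- b, - a] = `[a, b]%classic.
  apply/seteqP; split=> x /=; rewrite !in_itv /= !lerN2 andbC //.
have I' a b : intg `[a, b] (fun x => f (- x)) /\
    \int[mu]_(x in `[a, b]) f (- x) = \int[mu]_(x in `[- b, - a]) f x.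
  by rewrite -E; exact: Rint_opp.
split=> [a b|a b ab]; first by apply: intgN => //; case: (I' a b).
under eq_Rintegral do rewrite -mulN1r.
rewrite RintegralZl //; last by case: (I' a b).
by rewrite (I' a b).2 -FE ?lerN2 // mulN1r opprB.
Qed.

Lemma prim_C1 F f : (forall x : R, is_derive x 1 F (f x)) -> continuous f -> prim F f.
Proof.
move=> dF cf.
have If a b : intg `[a, b] f.
  apply: continuous_compact_integrable; first exact: segment_compact.
  exact: continuous_subspaceT.
have cF : continuous F.
  move=> x; apply: differentiable_continuous; apply/derivable1_diffP.
  by have [] := dF x.
split => // a b; rewrite le_eqVlt => /predU1P[->|ab].
  by rewrite set_itv1 Rintegral_set1 subrr.
rewrite /Rintegral (@continuous_FTC2 _ f F) //.
- exact: continuous_subspaceT.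
- split.
  + by move=> x _; have [] := dF x.
  + by apply: cvg_at_right_filter; exact: cF.
  + by apply: cvg_at_left_filter; exact: cF.
- by move=> x _; rewrite derive1E; apply: derive_val.
Qed.

Lemma prim_derive F f (x : R) : prim F f -> continuous f -> is_derive x 1 F (f x).
Proof.
move=> [If FE] cf.
have xu : x < x + 1 by lra.
have := @continuous_FTC1 R f (BLeft (x - 1)) x (x + 1) xu (If _ _).
set G := fun y => _; move=> /(_ ltac:(by rewrite (@lte_fin R); lra) (cf x)) [dG GE].
have GF : \forall y \near x, G y + F (x - 1) = F y.
  near=> y; rewrite /G -FE ?subrK //.
  near: y; exists 1 => //= y; rewrite /ball_ /= ltr_norml; lra.
apply: (near_eq_is_derive GF).
have : is_derive x 1 G (f x) by rewrite -GE derive1E; exact: DeriveDef.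
move=> dG'; have := is_deriveD dG' (is_derive_cst (F (x - 1)) x 1).
by rewrite addr0.
Unshelve. all: by end_near. Qed.

(** A density matters only up to null sets. This is how a potential is exchanged for a regular
    representative inside the equation of a Jost solution. *)
Lemma prim_ae F f g : prim F f -> measurable_fun setT g ->
  {ae mu, forall x, f x = g x} -> prim F g.
Proof.
move=> pF mg fg; have mf := prim_meas pF; case: pF => If FE.
have fg' D : {ae mu, forall x, D x -> f x = g x} by apply: ae_mono fg.
split=> [a b|a b ab].
  by apply: (@intg_ae _ _ f) => //; exact: measurable_funTS.
by rewrite FE //; apply: Rint_ae => //; exact: measurable_funTS.
Qed.

(** Integrability of [f] gives [F] a limit L at +oo, and integrability of [F] forces L = 0: the
    averages of [F] over [n, n + 1] tend both to L and to 0. *)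
Lemma prim_intgE F f x : prim F f -> intg setT F -> intg setT f ->
  F x = - \int[mu]_(y in `[x, +oo[) f y.
Proof.
move=> pF IF If; have [_ FE] := pF.
pose L := F x + \int[mu]_(y in `[x, +oo[) f y.
suff : L = 0 by move=> /eqP; rewrite addr_eq0 => /eqP.
have FL y : x <= y -> F y = L - \int[mu]_(z in `[y, +oo[) f z.
  move=> xy; rewrite /L (Rint_itvy_split xy); last by apply: intgS If.
  by rewrite -FE //; ring.
have c1 := Rint_tail_cvg0 IF.
have c2 : (fun n : nat => \int[mu]_(x in `[n.+1%:R, +oo[) F x) @ \oo --> 0.
  by rewrite (cvg_shiftS (fun n : nat => \int[mu]_(x in `[n%:R, +oo[) F x)).
have c3 := Rint_tail_cvg0 (intg_norm measurableT If).
have c4 : (fun n : nat => \int[mu]_(y in `[n%:R, n.+1%:R]) F y) @ \oo --> 0.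
  have -> : (fun n : nat => \int[mu]_(y in `[n%:R, n.+1%:R]) F y) =
      (fun n => \int[mu]_(x in `[n%:R, +oo[) F x - \int[mu]_(x in `[n.+1%:R, +oo[) F x).
    apply/funext => n; rewrite [X in _ = X - _](@Rint_itvy_split _ _ n%:R n.+1%:R) ?ler_nat //.
      by rewrite addrK.
    by apply: intgS IF.
  by have := cvgB c1 c2; rewrite subr0; apply.
have c5 : (fun n : nat => \int[mu]_(y in `[n%:R, n.+1%:R]) F y) @ \oo --> L.
  apply/cvgrPdist_le => e e0.
  move/cvgrPdist_le : c3 => /(_ e e0) c3.
  near=> n.
  have xn : x <= n%:R.
    have : (Num.truncn `|x|).+1%:R <= n%:R :> R by rewrite ler_nat; near: n; exact: nbhs_infty_ge.
    by apply: le_trans; rewrite (le_trans (ler_norm x)) // ltW // truncnS_gt.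
  have one c : \int[mu]_(y in `[n%:R, n.+1%:R]) c = c.
    rewrite Rintegral_cst //= lebesgue_measure_itv /= lte_fin ltr_nat ltnS leqnn /=.
    by rewrite -natrB // subSnn mulr1.
  have -> : L - \int[mu]_(y in `[n%:R, n.+1%:R]) F y = \int[mu]_(y in `[n%:R, n.+1%:R]) (L - F y).
    rewrite RintegralB ?one //; last by apply: intgS IF.
    exact: (continuous_compact_integrable (@segment_compact _ _ _) (continuous_subspaceT (@cst_continuous _ _ _))).
  have ne : \int[mu]_(x0 in `[n%:R, +oo[) `|f x0| <= e.
    near: n; apply: filterS c3 => n; rewrite sub0r normrN ger0_norm //.
    by apply: Rintegral_ge0.
  apply: le_trans ne; rewrite -[leRHS]one.
  apply: Rint_le0 => //.
  - apply: measurable_funTS; apply: measurable_funB => //.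
    exact: continuous_measurable_fun (prim_cont pF).
  - move=> y /=; rewrite in_itv /= => /andP[ny _].
    rewrite FL ?(le_trans xn) // opprB addrCA subrr addr0.
    apply: (le_trans (le_normr_Rintegral _ _)) => //; first by apply: intgS If.
    rewrite (Rint_itvy_split ny); last by apply: intgS (intg_norm _ If).
    by rewrite lerDr; apply: Rintegral_ge0.
  - exact: (continuous_compact_integrable (@segment_compact _ _ _) (continuous_subspaceT (@cst_continuous _ _ _))).
exact: cvg_unique c5 c4.
Unshelve. all: by end_near. Qed.

Lemma prim_sup F f x : prim F f -> intg setT F -> intg setT f ->
  `|F x| <= \int[mu]_y `|f y|.
Proof.
move=> pF IF If; rewrite (prim_intgE x pF IF If) normrN.
apply: (le_trans (le_normr_Rintegral _ _)) => //; first by apply: intgS If.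
rewrite Rintegral_mkcond; apply: le_Rintegral => //.
- exact: (intg_patch _ (intg_norm _ If)).
- exact: (intg_norm _ If).
- by move=> y _; rewrite patchE; case: ifP => _; [exact: lexx|exact: normr_ge0].
Qed.

(** [F 0] equals minus the integral of [f] over the right half-line and, by reflection, the integral
    over the left one. Boundary terms of oscillatory integrals vanish through this lemma. *)
Lemma prim_int0 F f : prim F f -> intg setT F -> intg setT f -> \int[mu]_x f x = 0.
Proof.
move=> pF IF If.
have mf := prim_meas pF; have mF : measurable_fun setT F by apply: intg_meas.
have pF' := prim_opp pF.
have If' : intg setT (fun x => f (- x)) := (Rint_opp measurableT mf If).1.
have := prim_intgE 0 pF' (Rint_opp measurableT mF IF).1 (intgN measurableT If').
rewrite oppr0 (prim_intgE 0 pF IF If).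
under [in X in _ = - X -> _]eq_Rintegral do rewrite -mulN1r.
rewrite RintegralZl //; last by apply: (intgS _ _ _ If').
have E : (-%R : R -> R) @^-1` `]-oo, 0] = `[0, +oo[%classic.
  by apply/seteqP; split=> x /=; rewrite !in_itv /= oppr_le0 ?andbT.
have := (@Rint_opp `]-oo, 0]%classic f _ mf _).2.
rewrite E => -> //; last by apply: intgS If.
rewrite mulN1r opprK => H.
have U : [set: R] = `]-oo, 0]%classic `|` `]0, +oo[%classic.
  by rewrite -itv_bndbnd_setU // set_itvE.
rewrite U Rintegral_setU //=.
- rewrite Rintegral_itv_obnd_cbnd -?H ?addNr //; by apply: intgS If.
- by rewrite -U.
- by apply/disj_setPS => x [] /=; rewrite !in_itv /= andbT => x0; rewrite ltNge x0.
Qed.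

End PrimitiveMore.

(** * Jost solutions: Volterra equations *)

Section GronwallWeight.
Context {R : realType}.
Local Notation mu := (@lebesgue_measure R).
Implicit Types (m h : R -> R).

Lemma Rint_tail_le h x c : intg setT h ->
  (forall b, x <= b -> \int[mu]_(y in `[x, b]) h y <= c) ->
  \int[mu]_(y in `[x, +oo[) h y <= c.
Proof.
move=> Ih hc; have c1 := Rint_tail_cvg0 Ih.
apply/ler_addgt0Pr => e e0.
move/cvgrPdist_le : c1 => /(_ e e0) [n _ /(_ (maxn n (Num.truncn `|x|).+1))].
set k := maxn _ _; rewrite /= leq_maxl sub0r normrN => /(_ isT) he.
have xk : x <= k%:R.
  have : (Num.truncn `|x|).+1%:R <= k%:R :> R by rewrite ler_nat leq_maxr.
  by apply: le_trans; rewrite (le_trans (ler_norm x)) // ltW // truncnS_gt.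
rewrite (Rint_itvy_split xk); last by apply: intgS Ih.
by apply: lerD; [exact: hc|exact: le_trans (ler_norm _) he].
Qed.

Lemma expR_partial_le (t : R) n : 0 <= t ->
  \sum_(0 <= i < n) t ^+ i / i`!%:R <= expR t.
Proof.
move=> t0; apply: (@nondecreasing_cvgn_le _ (series (exp_coeff t))).
  by apply: nondecreasing_series => i _; rewrite exp_coeff_ge0.
exact: is_cvg_series_exp_coeff.
Qed.

(* Phi is the truncated exponential of 2 M with M x the integral of m over
   [x, +oo[: its derivative is - 2 m times a shorter truncation. *)
Lemma gronwall_weight m (N : R) : (forall x, 0 <= m x) -> intg setT m ->
  \int[mu]_x m x <= N ->
  exists Phi : R -> R, [/\ continuous Phi, forall x, 1 <= Phi x <= expR (2 * N) &
    forall x, \int[mu]_(y in `[x, +oo[) (m y * Phi y) <= Phi x / 2].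
Proof.
move=> m0 Im mN; pose M x := \int[mu]_(y in `[x, +oo[) m y.
have M0 x : 0 <= M x by apply: Rintegral_ge0.
have MN x : M x <= N.
  apply: le_trans mN; rewrite /M Rintegral_mkcond; apply: le_Rintegral => //.
    exact: intg_patch.
  by move=> y _; rewrite patchE; case: ifP => _; [exact: lexx|exact: m0].
have N0 : 0 <= N := le_trans (M0 0) (MN 0).
have pM : prim M (fun x => - m x) by apply: prim_tail => x; apply: intgS Im.
pose T i x := (2 * M x) ^+ i / i`!%:R.
pose P n x := \sum_(0 <= i < n) T i x.
have pT i : prim (T i.+1) (fun x => - 2 * (m x * T i x)).
  elim: i => [|i IH].
    apply: eq_prim (primZ 2 pM) => x; rewrite /T ?fact0 ?expr1 ?expr0 /=;
        first by rewrite (_ : 1`! = 1%N) // divr1.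
    by rewrite divr1 mulr1 mulrN mulNr.
  apply: eq_prim (primZ (i.+2%:R^-1) (primM (primZ 2 pM) IH)) => x.
    rewrite /T (factS i.+1) natrM invfM (exprS _ i.+1); ring.
  rewrite /T (factS i) natrM.
  have i1 : i.+1%:R != 0 :> R by rewrite pnatr_eq0.
  have i2 : i.+2%:R != 0 :> R by rewrite pnatr_eq0.
  have i3 : (i`!)%:R != 0 :> R by rewrite pnatr_eq0 -lt0n fact_gt0.
  rewrite exprS; field.
  by rewrite i3 -(natrD _ 1 i) -(natrD _ 2 i) !pnatr_eq0.
have cM := prim_cont pM.
have cT i : continuous (T i).
  case: i => [|j]; last exact: prim_cont (pT j).
  rewrite (_ : T 0%N = fun=> 1); first exact: cst_continuous.
  by apply/funext => x; rewrite /T expr0 fact0 divr1.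
have cP n : continuous (P n).
  elim: n => [|n IH].
    rewrite (_ : P 0%N = fun=> 0); first exact: cst_continuous.
    by apply/funext => x; rewrite /P big_geq.
  rewrite (_ : P n.+1 = fun x => P n x + T n x).
    by move=> x; apply: cvgD; [exact: IH|exact: cT].
  by apply/funext => x; rewrite /P big_nat_recr.
have T0 i x : 0 <= T i x by rewrite /T divr_ge0 // exprn_ge0 // mulr_ge0.
have P1 n x : 1 <= P n.+1 x.
  rewrite /P big_nat_recl // {1}/T expr0 fact0 divr1 lerDl.
  exact: sumr_ge0.
have Pe n x : P n x <= expR (2 * N).
  apply: (le_trans (expR_partial_le n (mulr_ge0 (ler0n _ 2) (M0 x)))).
  by rewrite ler_expR ler_wpM2l.
have pP n : prim (P n.+1) (fun x => - 2 * (m x * P n x)).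
  elim: n => [|n IH].
    apply: eq_prim (prim_cst 1) => x; rewrite /P; first by rewrite big_nat1 /T expr0 fact0 divr1.
    by rewrite big_geq // !mulr0.
  apply: eq_prim (primD IH (pT n)) => x.
    by rewrite [RHS]big_nat_recr.
  by rewrite -mulrDr -mulrDr -[X in _ * (_ * X)](big_nat_recr n 0 (fun i => T i x)).
(* For this n the term of order n + 1 is at most 1, so the longer truncation [P n.+2], whose
   derivative is - 2 m [P n.+1], exceeds [P n.+1] by at most 1 at x. Its value at b, at least 1,
   absorbs this excess. *)
have [n _ /(_ n.+1)] : \forall n \near \oo, `|0 - exp_coeff (2 * N) n| <= 1.
  by have /cvgrPdist_le /(_ _ ltr01) := @cvg_exp_coeff R (2 * N).
rewrite /= leqnSn => /(_ isT) en.
exists (P n.+1); split=> //.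
  by move=> x; rewrite P1 Pe.
have ImP : intg setT (fun y => m y * P n.+1 y).
  apply: (@intg_le _ _ _ (fun x => expR (2 * N) * m x)) => //.
  - by apply: measurable_funM; [by apply: intg_meas|exact: continuous_measurable_fun].
  - move=> y _; rewrite ger0_norm; last by rewrite mulr_ge0 // (le_trans ler01).
    by rewrite mulrC ler_wpM2r.
  - exact: intgZ.
move=> x; apply: Rint_tail_le => // b xb; have [_ E2] := pP n.+1.
have := E2 x b xb; rewrite RintegralZl //; last by apply: intgS ImP.
have := P1 n.+1 b; have : P n.+2 x <= P n.+1 x + 1.
  rewrite /P big_nat_recr //= lerD2l.
  move: en; rewrite sub0r normrN => /(le_trans (ler_norm _)); apply: le_trans.
  rewrite /T /exp_coeff /= ler_wpM2r //.
  by rewrite lerXn2r ?nnegrE ?mulr_ge0 ?ler_wpM2l.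
lra.
Qed.

End GronwallWeight.

(** * The kernel sin(kz)/k and the weight 1 + |x| *)

Section Sinck.
Context {R : realType}.
Local Notation mu := (@lebesgue_measure R).
Implicit Types (k x y z : R).

Lemma is_derive_mulk k x : is_derive x 1 ( *%R k) k.
Proof.
have := @is_deriveZ _ _ _ id k x 1 1 (is_derive_id _ _).
by rewrite /GRing.scale /= mulr1.
Qed.

Lemma prim_sink k : prim (fun x => sin (k * x)) (fun x => k * cos (k * x)).
Proof.
apply: prim_C1 => x.
  have dk := is_derive_mulk k x.
  by rewrite mulrC; exact: (is_derive1_comp (is_derive_sin (k * x)) dk).
apply: cvgM; first exact: cvg_cst.
apply: (@continuous_comp _ _ _ ( *%R k) cos); last exact: continuous_cos.
exact: mulrl_continuous.
Qed.

Lemma prim_cosk k : prim (fun x => cos (k * x)) (fun x => - (k * sin (k * x))).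
Proof.
apply: prim_C1 => x.
  have dk := is_derive_mulk k x.
  rewrite mulrC -mulNr; exact: (is_derive1_comp (is_derive_cos (k * x)) dk).
apply: cvgN; apply: cvgM; first exact: cvg_cst.
apply: (@continuous_comp _ _ _ ( *%R k) sin); last exact: continuous_sin.
exact: mulrl_continuous.
Qed.

Lemma prim_id : prim (@id R) (fun=> 1).
Proof. by apply: prim_C1; exact: cst_continuous. Qed.

Lemma mul_sinck k x : k * sinck k x = sin (k * x).
Proof.
rewrite /sinck; case: eqVneq => [->|k0]; first by rewrite !mul0r sin0.
by rewrite mulrC divfK.
Qed.

Lemma prim_sinck k : prim (sinck k) (fun x => cos (k * x)).
Proof.
have [->|k0] := eqVneq k 0.
  apply: eq_prim prim_id => x; first by rewrite /sinck eqxx.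
  by rewrite mul0r cos0.
apply: eq_prim (primZ k^-1 (prim_sink k)) => x.
  by rewrite /sinck (negbTE k0) mulrC.
by rewrite mulKf.
Qed.

(** Addition theorem: it separates the variables of the Volterra kernel, so that the integral
    equation can be differentiated in x. *)
Lemma sinckB k x y :
  sinck k (y - x) = sinck k y * cos (k * x) - cos (k * y) * sinck k x.
Proof.
have [->|k0] := eqVneq k 0; first by rewrite /sinck eqxx !mul0r cos0 mulr1 mul1r.
rewrite /sinck (negbTE k0) mulrBr sinB; ring.
Qed.

Lemma cosk_sinck k x : cos (k * x) ^+ 2 + k ^+ 2 * sinck k x ^+ 2 = 1.
Proof. by rewrite -exprMn mul_sinck cos2Dsin2. Qed.

Lemma sinck0 k : sinck k 0 = 0.
Proof. by rewrite /sinck mulr0 sin0 mul0r if_same. Qed.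

Lemma sinckN k x : sinck k (- x) = - sinck k x.
Proof. by rewrite /sinck mulrN sinN mulNr; case: ifP. Qed.

(** [sinck k] is a primitive of cos (k z), which is bounded by 1. The bound is uniform down to k =
    0, at the cost of linear growth. *)
Lemma sinck_le k z : `|sinck k z| <= `|z|.
Proof.
have P t : 0 <= t -> `|sinck k t| <= t.
  move=> t0; have [Ic E] := prim_sinck k.
  rewrite -[sinck k t](subr0) -{1}(sinck0 k) E //.
  apply: (@le_trans _ _ (\int[mu]_(x in `[0, t]) 1)).
    apply: Rint_le0 => //.
    + by apply: intg_meas.
    + by move=> x _; exact: cos_max.
    + by have [] := prim_id.
  rewrite Rintegral_cst //= lebesgue_measure_itv /= lte_fin.
  by case: ltgtP t0 => // [_|<-] _ /=; rewrite ?subr0 mul1r.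
have [z0|/ltW z0] := leP 0 z; first by rewrite (ger0_norm z0) P.
by rewrite -normrN -sinckN (ler0_norm z0) P // oppr_ge0.
Qed.

Lemma sinck_neq0 k : exists2 d, 0 < d & sinck k d != 0.
Proof.
have [->|k0] := eqVneq k 0; first by exists 1 => //; rewrite /sinck eqxx oner_eq0.
exists (pi / 2 / `|k|).
  by rewrite divr_gt0 ?normr_gt0 // divr_gt0 // pi_gt0.
rewrite /sinck (negbTE k0) mulf_neq0 ?invr_eq0 //.
have [k1|k1] := leP 0 k.
  by rewrite ger0_norm // mulrC divfK // sin_pihalf oner_eq0.
by rewrite ltr0_norm // mulrC invrN mulrN mulNr divfK // sinN sin_pihalf oppr_eq0 oner_eq0.
Qed.

Lemma continuous_sinck k : continuous (sinck k).
Proof. exact: prim_cont (prim_sinck k). Qed.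

Lemma continuous_cosk k : continuous (fun x => cos (k * x)).
Proof. exact: prim_cont (prim_cosk k). Qed.

Definition wt x : R := 1 + `|x|.

Lemma wt_ge1 x : 1 <= wt x. Proof. by rewrite lerDl. Qed.

Lemma wt_gt0 x : 0 < wt x. Proof. exact: lt_le_trans (wt_ge1 x). Qed.

Lemma wt_ge0 x : 0 <= wt x. Proof. exact/ltW/wt_gt0. Qed.

Lemma wtN x : wt (- x) = wt x. Proof. by rewrite /wt normrN. Qed.

Lemma continuous_wt : continuous wt.
Proof. by move=> x; apply: cvgD; [exact: cvg_cst|exact: norm_continuous]. Qed.

(** This factorization fixes the weights: solutions are allowed to grow like [wt], and the potential
    has to be integrable against [wt] squared. *)
Lemma sinckB_le k x y : `|sinck k (y - x)| <= wt x * wt y.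
Proof.
apply: (le_trans (sinck_le _ _)); apply: (le_trans (ler_normB _ _)).
rewrite /wt; have := normr_ge0 x; have := normr_ge0 y; nra.
Qed.

End Sinck.
#[global] Hint Extern 0 (is_true (0 <= wt _)) => exact: wt_ge0 : core.
#[global] Hint Extern 0 (is_true (0 < wt _)) => exact: wt_gt0 : core.
#[global] Hint Extern 0 (is_true (1 <= wt _)) => exact: wt_ge1 : core.

Lemma geometric_le0 {R : realType} (a c : R) :
  (forall n, a <= c * 2^-1 ^+ n) -> a <= 0.
Proof.
move=> H; apply/ler_addgt0Pr => e e0; rewrite add0r.
have h1 : `|2^-1 : R| < 1 by rewrite ger0_norm ?invr_ge0 // invf_lt1 // ltr1n.
have /cvgrPdist_le /(_ _ e0) [n _ /(_ n (leqnn n))] := cvg_geometric c h1.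
rewrite sub0r normrN => /(le_trans (ler_norm _)); apply: le_trans; exact: H.
Qed.

(** * Volterra equations in a norm where the operator is a contraction *)

Section Volterra.
Context {R : realType} (U : R -> R) (k : R) (Phi : R -> R).
Local Notation mu := (@lebesgue_measure R).
Local Notation m := (fun y => wt y ^+ 2 * `|U y|).
Context (mU : measurable_fun setT U) (Im : intg setT m) (cPhi : continuous Phi)
  (Phi1 : forall x, 1 <= Phi x)
  (PhiG : forall x, \int[mu]_(y in `[x, +oo[) (m y * Phi y) <= Phi x / 2)
  (ImPhi : intg setT (fun y => m y * Phi y)).
Implicit Types (phi h : R -> R).

Local Notation ker x y := (sinck k (y - x) * U y).

Let wPhi_ge1 x : 1 <= wt x * Phi x.
Proof. by rewrite -[leLHS]mulr1 ler_pM. Qed.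

Lemma measurable_ker (x : R) : measurable_fun setT (fun y : R => ker x y).
Proof.
apply: measurable_funM => //.
apply: continuous_measurable_fun => y.
apply: (@continuous_comp _ _ _ (fun y => y - x) (sinck k)); last exact: continuous_sinck.
by apply: cvgB; [exact: cvg_id|exact: cvg_cst].
Qed.

(** In the norm sup |phi| / (wt Phi) the Volterra operator has norm at most 1/2, for every k: the
    kernel supplies wt x wt y, the bound on phi one more wt y, and [PhiG] the factor 1/2. *)
Lemma volterra_op phi C x : measurable_fun setT phi -> 0 <= C ->
  (forall y, x <= y -> `|phi y| <= C * (wt y * Phi y)) ->
  intg `[x, +oo[ (fun y => ker x y * phi y) /\
  `|\int[mu]_(y in `[x, +oo[) (ker x y * phi y)| <= C / 2 * (wt x * Phi x).
Proof.
move=> mphi C0 phiC.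
have le y : `[x, +oo[%classic y -> `|ker x y * phi y| <= C * wt x * (m y * Phi y).
  rewrite /= in_itv /= andbT => xy; rewrite !normrM.
  apply: (@le_trans _ _ (wt x * wt y * `|U y| * (C * (wt y * Phi y)))).
    by rewrite ler_pM ?phiC // ler_wpM2r // sinckB_le.
  by apply: eq_ler; ring.
have mf : measurable_fun `[x, +oo[ (fun y => ker x y * phi y).
  by apply: measurable_funTS; apply: measurable_funM => //; exact: measurable_ker.
have Ig : intg `[x, +oo[ (fun y => C * wt x * (m y * Phi y)).
  by apply: intgZ => //; apply: intgS ImPhi.
split; first exact: intg_le Ig.
apply: (le_trans (Rint_le0 _ mf le Ig)) => //.
rewrite RintegralZl //; last by apply: intgS ImPhi.
apply: (le_trans (ler_wpM2l _ (PhiG x))); first by rewrite mulr_ge0.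
by apply: eq_ler; field.
Qed.

(* A real number is recovered from the products with sinck k (y - x) and
   cos (k y) since cos^2 + k^2 sinck^2 = 1. *)
Lemma volterra_intg phi :
  (forall x, intg `[x, +oo[ (fun y => ker x y * phi y)) -> forall x,
  [/\ intg `[x, +oo[ (fun y => sinck k y * (U y * phi y)),
      intg `[x, +oo[ (fun y => cos (k * y) * (U y * phi y)) &
      intg `[x, +oo[ (fun y => U y * phi y)].
Proof.
move=> Ik x; have [d d0 sd] := sinck_neq0 k.
pose G y := U y * phi y.
have Is : intg `[x, +oo[ (fun y => sinck k (y - x) * G y).
  by apply: eq_intg (Ik x) => // y _; rewrite /G; ring.
(* Integrability is known only against the sine kernel. The equation at the shifted point x - d,
   with [sinck k d] nonzero, supplies the cosine. *)
have Ic : intg `[x, +oo[ (fun y => cos (k * (y - x)) * G y).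
  have Id : intg `[x, +oo[ (fun y => ker (x - d) y * phi y).
    apply: (intgS _ _ _ (Ik (x - d))) => //.
    by apply: subset_itvr; rewrite bnd_simp lerBlDr lerDl ltW.
  apply: eq_intg (intgZ (sinck k d)^-1 _ (intgB _ Id (intgZ (cos (k * d)) _ Is))) => // y _.
  have -> : y - (x - d) = (y - x) - (- d) by ring.
  rewrite sinckB sinckN mulrN cosN /G; field => //.
have mc : measurable_fun `[x, +oo[ (fun y : R => cos (k * y)).
  by apply: measurable_fun_cont => //; exact: continuous_cosk.
have Is0 : intg `[x, +oo[ (fun y => sinck k y * G y).
  apply: eq_intg (intgD _ (intgZ (cos (k * x)) _ Is) (intgZ (sinck k x) _ Ic)) => // y _.
  rewrite sinckB (_ : k * (y - x) = k * y - k * x); last ring.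
  rewrite cosB -!mul_sinck -[in RHS](mul1r (sinck k y)) -(cosk_sinck k x); ring.
have Ic0 : intg `[x, +oo[ (fun y => cos (k * y) * G y).
  apply: eq_intg (intgB _ (intgZ (cos (k * x)) _ Ic) (intgZ (k ^+ 2 * sinck k x) _ Is)) => // y _.
  rewrite sinckB (_ : k * (y - x) = k * y - k * x); last ring.
  rewrite cosB -!mul_sinck -[in RHS](mul1r (cos (k * y))) -(cosk_sinck k x); ring.
split=> //.
have b1 : intg `[x, +oo[ (fun y => cos (k * y) * (cos (k * y) * G y)).
  apply: (@intg_bdd _ _ _ _ 1) => // y _; exact: cos_max.
have b2 : intg `[x, +oo[ (fun y => k * sin (k * y) * (sinck k y * G y)).
  apply: (@intg_bdd _ _ _ _ `|k|) => //.
    apply: measurable_fun_cont => // y; apply: cvgM; first exact: cvg_cst.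
    exact: prim_cont (prim_sink k) y.
  by move=> y _; rewrite normrM ler_piMr // sin_max.
apply: eq_intg (intgD _ b1 b2) => // y _.
rewrite -mul_sinck -[in RHS](mul1r (_ * _)) -(cosk_sinck k y) /G; ring.
Qed.

Lemma volterra_split phi h :
  (forall x, intg `[x, +oo[ (fun y => ker x y * phi y)) -> forall x,
  \int[mu]_(y in `[x, +oo[) (ker x y * phi y) =
    cos (k * x) * \int[mu]_(y in `[x, +oo[) (sinck k y * (U y * phi y))
    - sinck k x * \int[mu]_(y in `[x, +oo[) (cos (k * y) * (U y * phi y)).
Proof.
move=> Ik x; have [Is Ic _] := volterra_intg Ik x.
rewrite -!RintegralZl // -RintegralB //; try exact: intgZ.
apply: eq_Rintegral => y _; rewrite sinckB; ring.
Qed.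

Lemma volterra_cont phi :
  (forall x, intg `[x, +oo[ (fun y => ker x y * phi y)) ->
  continuous (fun x => \int[mu]_(y in `[x, +oo[) (ker x y * phi y)).
Proof.
move=> Ik.
have -> : (fun x => \int[mu]_(y in `[x, +oo[) (ker x y * phi y)) = (fun x =>
    cos (k * x) * \int[mu]_(y in `[x, +oo[) (sinck k y * (U y * phi y))
    - sinck k x * \int[mu]_(y in `[x, +oo[) (cos (k * y) * (U y * phi y))).
  by apply/funext => x; exact: volterra_split.
have Ia x : intg `[x, +oo[ (fun y => sinck k y * (U y * phi y)).
  by have [] := volterra_intg Ik x.
have Ib x : intg `[x, +oo[ (fun y => cos (k * y) * (U y * phi y)).
  by have [] := volterra_intg Ik x.
move=> x; apply: cvgB; apply: cvgM.
- exact: continuous_cosk.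
- exact: prim_cont (prim_tail Ia) x.
- exact: continuous_sinck.
- exact: prim_cont (prim_tail Ib) x.
Qed.

(** No growth of [phi] is assumed beforehand, since [jostp] and [jostm] are arbitrary solutions.
    Convergence of the integrals alone bounds [phi] on [x0, +oo[, so the supremum S of |phi| / (wt
    Phi) there is finite, and the contraction yields S <= 1 + S / 2. *)
Lemma volterra_bound phi h : continuous h -> (forall x, `|h x| <= 1) ->
  (forall x, intg `[x, +oo[ (fun y => ker x y * phi y)) ->
  (forall x, phi x = h x + \int[mu]_(y in `[x, +oo[) (ker x y * phi y)) ->
  forall x, `|phi x| <= 2 * (wt x * Phi x).
Proof.
move=> ch h1 Ik phiE x0.
have cphi : continuous phi.
  have -> : phi = fun x => h x + \int[mu]_(y in `[x, +oo[) (ker x y * phi y).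
    exact/funext.
  by move=> x; apply: cvgD; [exact: ch|exact: volterra_cont].
have mphi : measurable_fun setT phi by exact: continuous_measurable_fun.
have [_ _ IG] := volterra_intg Ik x0.
(* One integrable majorant for all x >= x0: at k = 0 the kernel y - x decreases in x, otherwise it
   is at most 1 / |k|. Its dependence on k is harmless, as it only serves to show finiteness. *)
have [J [IJ J0 kJ]] : exists J : R -> R, [/\ intg `[x0, +oo[ J, forall y, 0 <= J y &
    forall x y, x0 <= x -> x <= y -> `|ker x y * phi y| <= J y].
  have [k0|k0] := eqVneq k 0.
    exists (fun y => `|ker x0 y * phi y|); split=> //; first by apply: intg_norm.
    move=> x y x0x xy; rewrite /sinck k0 eqxx -!mulrA !normrM ler_wpM2r ?mulr_ge0 //.
    rewrite !ger0_norm ?subr_ge0 ?(le_trans x0x) //; lra.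
  exists (fun y => `|k|^-1 * `|U y * phi y|); split=> //.
    by apply: intgZ => //; apply: intg_norm.
  move=> x y _ _; rewrite -mulrA normrM ler_wpM2r // /sinck (negbTE k0) normrM normfV.
  by rewrite ler_piMl ?sin_max // invr_ge0.
pose M0 := 1 + \int[mu]_(y in `[x0, +oo[) J y.
pose S := [set `|phi x| / (wt x * Phi x) | x in `[x0, +oo[%classic].
have wP x : 0 < wt x * Phi x by exact: lt_le_trans (wPhi_ge1 x).
have phiM x : x0 <= x -> `|phi x| <= M0.
  move=> x0x; rewrite phiE (le_trans (ler_normD _ _)) // lerD //.
  have sub : `[x, +oo[%classic `<=` `[x0, +oo[%classic by apply: subset_itvr; rewrite bnd_simp.
  have IJx : intg `[x, +oo[ J by apply: intgS IJ.
  apply: (@le_trans _ _ (\int[mu]_(y in `[x, +oo[) J y)).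
    apply: Rint_le0 => //; first by apply: intg_meas.
    by move=> y /=; rewrite in_itv /= andbT => xy; exact: kJ.
  rewrite (Rint_itvy_split x0x) // lerDr; exact: Rintegral_ge0.
have M00 : 0 <= M0 by rewrite addr_ge0 // Rintegral_ge0.
have hS : has_sup S.
  split; first by exists (`|phi x0| / (wt x0 * Phi x0)); exists x0 => //=; rewrite in_itv /= lexx.
  exists M0 => _ [x /= + <-]; rewrite in_itv /= andbT => x0x.
  rewrite ler_pdivrMr // (le_trans (phiM x x0x)) // ler_peMr //.
have Sle x : x0 <= x -> `|phi x| <= sup S * (wt x * Phi x).
  move=> x0x; rewrite -ler_pdivrMr //; apply: sup_upper_bound => //.
  by exists x => //=; rewrite in_itv /= x0x.
have S0 : 0 <= sup S.
  have := Sle x0 (lexx _); rewrite -(pmulr_lge0 _ (wP x0)).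
  by apply: le_trans.
have : sup S <= 1 + sup S / 2.
  apply: sup_le_ub; first by case: hS.
  move=> _ [x /= + <-]; rewrite in_itv /= andbT => x0x.
  rewrite ler_pdivrMr // phiE (le_trans (ler_normD _ _)) //.
  rewrite mulrDl mul1r lerD // ?(le_trans (h1 x)) //.
  apply: (volterra_op mphi S0 _).2 => y xy; apply: Sle; exact: le_trans xy.
move=> S2; apply: (le_trans (Sle x0 (lexx _))); rewrite ler_wpM2r ?(ltW (wP x0)) //; lra.
Qed.

(** Picard iteration: consecutive iterates differ by at most 2^-n wt Phi. The limit is the pointwise
    supremum of the increasing lower bounds [lo]; the decreasing upper bounds [up] complete the rate
    of convergence. *)
Lemma volterra_ex h : continuous h -> (forall x, `|h x| <= 1) ->
  exists phi, forall x, intg `[x, +oo[ (fun y => ker x y * phi y) /\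
    phi x = h x + \int[mu]_(y in `[x, +oo[) (ker x y * phi y).
Proof.
move=> ch h1.
pose V phi x := h x + \int[mu]_(y in `[x, +oo[) (ker x y * phi y).
pose it n := iter n V (fun=> 0).
have wP x : 0 < wt x * Phi x by exact: lt_le_trans (wPhi_ge1 x).
have inv n : continuous (it n) /\ forall x, `|it n x| <= 2 * (wt x * Phi x).
  elim: n => [|n [cn bn]].
    split; first exact: cst_continuous.
    by move=> x; rewrite normr0 mulr_ge0 // ltW.
  have mn : measurable_fun setT (it n) by exact: continuous_measurable_fun.
  have op x := @volterra_op (it n) 2 x mn (ler0n _ 2) (fun y _ => bn y).
  split=> [x|x].
    by apply: cvgD; [exact: ch|apply: volterra_cont => y; case: (op y)].
  rewrite (le_trans (ler_normD _ _)) // (_ : 2 * _ = wt x * Phi x + 2 / 2 * (wt x * Phi x)).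
    by rewrite lerD ?(op x).2 // (le_trans (h1 x)).
  by rewrite divff // mul1r -mulr2n mulr_natl.
have mit n : measurable_fun setT (it n).
  by apply: continuous_measurable_fun; case: (inv n).
have Iit n x : intg `[x, +oo[ (fun y => ker x y * it n y).
  by have [] := @volterra_op (it n) 2 x (mit n) (ler0n _ 2) (fun y _ => (inv n).2 y).
have dif n x : `|it n.+1 x - it n x| <= 2^-1 ^+ n * (wt x * Phi x).
  elim: n x => [|n IH] x.
    rewrite /it /= /V subr0 expr0 mul1r; under eq_Rintegral do rewrite mulr0.
    by rewrite Rintegral_cst // mul0r addr0 (le_trans (h1 x)).
  rewrite /it [iter n.+2 _ _]iterS [in X in _ - X]iterS -!/(it _) /V opprD addrACA subrr add0r.
  rewrite -RintegralB //.
  under eq_Rintegral do rewrite -mulrBr.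
  rewrite exprSr; apply: (volterra_op _ _ _).2.
  - exact: measurable_funB.
  - by rewrite exprn_ge0.
  - by move=> y _; exact: IH.
pose lo n x := it n x - 2 * 2^-1 ^+ n * (wt x * Phi x).
pose up n x := it n x + 2 * 2^-1 ^+ n * (wt x * Phi x).
have loS n x : lo n x <= lo n.+1 x.
  rewrite /lo exprS; have := dif n x; rewrite ler_norml => /andP[+ _].
  set a := _ ^+ n; set b := wt x * Phi x; lra.
have upS n x : up n.+1 x <= up n x.
  rewrite /up exprS; have := dif n x; rewrite ler_norml => /andP[_].
  set a := _ ^+ n; set b := wt x * Phi x; lra.
have ndlo x : nondecreasing_seq (lo^~ x) by apply/nondecreasing_seqP => n; exact: loS.
have niup x : nonincreasing_seq (up^~ x) by apply/nonincreasing_seqP => n; exact: upS.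
have h0 n : 0 <= 2^-1 ^+ n :> R by rewrite exprn_ge0.
have loup n p x : lo n x <= up p x.
  apply: (@le_trans _ _ (lo (maxn n p) x)); first exact: (ndlo x _ _ (leq_maxl _ _)).
  apply: (@le_trans _ _ (up (maxn n p) x)); last exact: (niup x _ _ (leq_maxr _ _)).
  rewrite /lo /up; have := h0 (maxn n p); have := wP x; nra.
pose phi x := sup (range (lo^~ x)).
have hs x : has_sup (range (lo^~ x)).
  split; first by exists (lo 0%N x); exists 0%N.
  by exists (up 0%N x) => _ [n _ <-]; exact: loup.
have d n x : `|phi x - it n x| <= 2 * 2^-1 ^+ n * (wt x * Phi x).
  have H1 : lo n x <= phi x by apply: sup_upper_bound => //; exists n.
  have H2 : phi x <= up n x.
    by apply: sup_le_ub; [case: (hs x)|move=> _ [p _ <-]; exact: loup].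
  by rewrite ler_norml; move: H1 H2; rewrite /lo /up; lra.
have mphi : measurable_fun setT phi.
  apply: (measurable_fun_cvg mit) => x _; apply/cvgrPdist_le => e e0.
  have h1' : `|2^-1 : R| < 1 by rewrite ger0_norm ?invr_ge0 // invf_lt1 // ltr1n.
  have /cvgrPdist_le /(_ _ e0) := cvg_geometric (2 * (wt x * Phi x)) h1'.
  apply: filterS => n; rewrite sub0r normrN => /(le_trans (ler_norm _)).
  by apply: le_trans; rewrite (le_trans (d n x)) // mulrAC.
have phi2 x : `|phi x| <= 2 * (wt x * Phi x).
  by have := d 0%N x; rewrite subr0 expr0 mulr1.
have op x := @volterra_op phi 2 x mphi (ler0n _ 2) (fun y _ => phi2 y).
exists phi => x; split; first by case: (op x).
apply/eqP; rewrite -subr_eq0 -normr_eq0 eq_le normr_ge0 andbT.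
apply: (@geometric_le0 _ _ (2 * (wt x * Phi x))) => n.
have -> : phi x - (h x + \int[mu]_(y in `[x, +oo[) (ker x y * phi y)) =
   (phi x - it n.+1 x) - (\int[mu]_(y in `[x, +oo[) (ker x y * (phi y - it n y))).
  under [in RHS]eq_Rintegral do rewrite mulrBr.
  rewrite RintegralB //; last by case: (op x).
  rewrite /it /= -/(it n) /V; ring.
rewrite (le_trans (ler_normB _ _)) //.
have C0 : 0 <= 2 * 2^-1 ^+ n :> R by rewrite mulr_ge0.
have := (@volterra_op _ _ x (measurable_funB mphi (mit n)) C0 (fun y _ => d n y)).2.
have := d n.+1 x; rewrite exprS.
set a := `|_|; set b := `|_|; set c := _ ^+ n; set e := wt x * _; lra.
Qed.

End Volterra.

(** * Complex-valued functions *)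

Section ComplexCalculus.
Context {R : realType}.
Local Notation mu := (@lebesgue_measure R).
Local Notation C := R[i].
Implicit Types (z : C) (F G f g : R -> C).
Local Notation Re := complex.Re.
Local Notation Im := complex.Im.

Lemma cReD z1 z2 : Re (z1 + z2) = Re z1 + Re z2. Proof. by case: z1 z2 => ? ? []. Qed.
Lemma cImD z1 z2 : Im (z1 + z2) = Im z1 + Im z2. Proof. by case: z1 z2 => ? ? []. Qed.
Lemma cReN z : Re (- z) = - Re z. Proof. by case: z. Qed.
Lemma cImN z : Im (- z) = - Im z. Proof. by case: z. Qed.
Lemma cReB z1 z2 : Re (z1 - z2) = Re z1 - Re z2. Proof. by rewrite cReD cReN. Qed.
Lemma cImB z1 z2 : Im (z1 - z2) = Im z1 - Im z2. Proof. by rewrite cImD cImN. Qed.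
Lemma cReM z1 z2 : Re (z1 * z2) = Re z1 * Re z2 - Im z1 * Im z2.
Proof. by case: z1 z2 => ? ? []. Qed.
Lemma cImM z1 z2 : Im (z1 * z2) = Re z1 * Im z2 + Im z1 * Re z2.
Proof. by case: z1 z2 => ? ? []. Qed.
Lemma cRe_conj z : Re (conjc z) = Re z. Proof. by case: z. Qed.
Lemma cIm_conj z : Im (conjc z) = - Im z. Proof. by case: z. Qed.
Lemma cReMr (a : R) z : Re (a%:C%C * z) = a * Re z. Proof. by rewrite cReM mul0r subr0. Qed.
Lemma cImMr (a : R) z : Im (a%:C%C * z) = a * Im z. Proof. by rewrite cImM mul0r addr0. Qed.

Lemma cRe_sum (I : Type) (s : seq I) (P : pred I) (a : I -> C) :
  Re (\sum_(i <- s | P i) a i) = \sum_(i <- s | P i) Re (a i).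
Proof. by elim/big_rec2: _ => // i x y _ <-; rewrite cReD. Qed.
Lemma cIm_sum (I : Type) (s : seq I) (P : pred I) (a : I -> C) :
  Im (\sum_(i <- s | P i) a i) = \sum_(i <- s | P i) Im (a i).
Proof. by elim/big_rec2: _ => // i x y _ <-; rewrite cImD. Qed.

Lemma complex_ext z1 z2 : Re z1 = Re z2 -> Im z1 = Im z2 -> z1 = z2.
Proof. by case: z1 z2 => ? ? [? ?] /= -> ->. Qed.

(* the l1 norm is equivalent to the modulus and also submultiplicative *)
Definition n1 z : R := `|Re z| + `|Im z|.

Lemma n1_ge0 z : 0 <= n1 z. Proof. by rewrite addr_ge0. Qed.
Lemma n1D z1 z2 : n1 (z1 + z2) <= n1 z1 + n1 z2.
Proof.
rewrite /n1 cReD cImD; have := ler_normD (Re z1) (Re z2); have := ler_normD (Im z1) (Im z2).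
lra.
Qed.
Lemma n1N z : n1 (- z) = n1 z. Proof. by rewrite /n1 cReN cImN !normrN. Qed.
Lemma n1B z1 z2 : n1 (z1 - z2) <= n1 z1 + n1 z2. Proof. by rewrite -(n1N z2) n1D. Qed.
Lemma n1_0 : n1 0 = 0. Proof. by rewrite /n1 normr0 addr0. Qed.
Lemma n1M z1 z2 : n1 (z1 * z2) <= n1 z1 * n1 z2.
Proof.
rewrite /n1 cReM cImM mulrDl !mulrDr -!normrM.
have := ler_normB (Re z1 * Re z2) (Im z1 * Im z2).
have := ler_normD (Re z1 * Im z2) (Im z1 * Re z2); lra.
Qed.
Lemma n1Mr (a : R) z : n1 (a%:C%C * z) = `|a| * n1 z.
Proof. by rewrite /n1 cReMr cImMr !normrM mulrDr. Qed.
Lemma n1_conj z : n1 (conjc z) = n1 z. Proof. by rewrite /n1 cRe_conj cIm_conj normrN. Qed.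
Lemma n1_real (a : R) : n1 a%:C%C = `|a|. Proof. by rewrite /n1 /= normr0 addr0. Qed.
Lemma n1_sum (I : Type) (s : seq I) (P : pred I) (a : I -> C) :
  n1 (\sum_(i <- s | P i) a i) <= \sum_(i <- s | P i) n1 (a i).
Proof.
elim/big_ind2: _ => [|x1 x2 y1 y2 h1 h2|//]; first by rewrite n1_0.
by rewrite (le_trans (n1D _ _)) // lerD.
Qed.
Lemma n1_cexpi (x : R) : n1 (cexpi x) <= 2.
Proof. by rewrite /n1 /= (le_trans (lerD (cos_max _) (sin_max _))). Qed.

Lemma cmodE z : cmod z = Num.sqrt (Re z ^+ 2 + Im z ^+ 2).
Proof. by case: z. Qed.
Lemma cmod_ge0 z : 0 <= cmod z. Proof. by rewrite cmodE sqrtr_ge0. Qed.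
Lemma cmod_sqr z : cmod z ^+ 2 = Re z ^+ 2 + Im z ^+ 2.
Proof. by rewrite cmodE sqr_sqrtr // addr_ge0 // sqr_ge0. Qed.
Lemma cmod_le_n1 z : cmod z <= n1 z.
Proof.
rewrite -(ler_sqr (cmod_ge0 z) (n1_ge0 z)) cmod_sqr /n1.
rewrite -(real_normK (num_real (Re z))) -(real_normK (num_real (Im z))).
have := normr_ge0 (Re z); have := normr_ge0 (Im z); nra.
Qed.
Lemma n1_le_cmod z : n1 z <= 2 * cmod z.
Proof.
have c0 := cmod_ge0 z.
have a : `|Re z| <= cmod z.
  by rewrite -(ler_sqr (normr_ge0 _) c0) cmod_sqr real_normK ?num_real // lerDl sqr_ge0.
have b : `|Im z| <= cmod z.
  by rewrite -(ler_sqr (normr_ge0 _) c0) cmod_sqr real_normK ?num_real // lerDr sqr_ge0.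
rewrite /n1; lra.
Qed.

Definition cprim F f :=
  prim (fun x => Re (F x)) (fun x => Re (f x)) /\ prim (fun x => Im (F x)) (fun x => Im (f x)).

Lemma eq_cprim F f F' f' : F =1 F' -> f =1 f' -> cprim F f -> cprim F' f'.
Proof. by move=> /funext <- /funext <-. Qed.
Lemma cprimD F f G g : cprim F f -> cprim G g ->
  cprim (fun x => F x + G x) (fun x => f x + g x).
Proof.
move=> [a b] [c d]; split.
  by apply: eq_prim (primD a c) => x; rewrite cReD.
by apply: eq_prim (primD b d) => x; rewrite cImD.
Qed.
Lemma cprimN F f : cprim F f -> cprim (fun x => - F x) (fun x => - f x).
Proof.
move=> [a b]; split.
  by apply: eq_prim (primN a) => x; rewrite cReN.
by apply: eq_prim (primN b) => x; rewrite cImN.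
Qed.
Lemma cprimB F f G g : cprim F f -> cprim G g ->
  cprim (fun x => F x - G x) (fun x => f x - g x).
Proof. by move=> pF /cprimN; exact: cprimD. Qed.
Lemma cprimM F f G g : cprim F f -> cprim G g ->
  cprim (fun x => F x * G x) (fun x => f x * G x + F x * g x).
Proof.
move=> [a b] [c d]; split.
  apply: eq_prim (primB (primM a c) (primM b d)) => x; first by rewrite cReM.
  by rewrite cReD !cReM; ring.
apply: eq_prim (primD (primM a d) (primM b c)) => x; first by rewrite cImM.
by rewrite cImD !cImM; ring.
Qed.
Lemma cprim_cst z : cprim (fun=> z) (fun=> 0).
Proof. by split; exact: prim_cst. Qed.
Lemma cprimZ z F f : cprim F f -> cprim (fun x => z * F x) (fun x => z * f x).
Proof.
move=> pF; apply: eq_cprim (cprimM (cprim_cst z) pF) => // x.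
by rewrite mul0r add0r.
Qed.
Lemma cprim_conj F f : cprim F f -> cprim (fun x => conjc (F x)) (fun x => conjc (f x)).
Proof.
move=> [a b]; split; first by apply: eq_prim a => x; rewrite cRe_conj.
by apply: eq_prim (primN b) => x; rewrite cIm_conj.
Qed.
Lemma cprim_opp F f : cprim F f -> cprim (fun x => F (- x)) (fun x => - f (- x)).
Proof.
move=> [a b]; split.
  by apply: eq_prim (prim_opp a) => x //; rewrite cReN.
by apply: eq_prim (prim_opp b) => x //; rewrite cImN.
Qed.
Lemma cprim_cexpi (k : R) :
  cprim (fun x => cexpi (k * x)) (fun x => Complex 0 k * cexpi (k * x)).
Proof.
split.
  by apply: eq_prim (prim_cosk k) => x //; rewrite cReM /= mul0r sub0r.
by apply: eq_prim (prim_sink k) => x //; rewrite cImM /= mul0r add0r.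
Qed.

Lemma cprim_derive F f : cprim F f -> continuous (fun x => Re (f x)) ->
  continuous (fun x => Im (f x)) -> forall x, cderive F x = f x.
Proof.
move=> [a b] cr ci x; apply: complex_ext; rewrite /cderive /= derive1E.
  by have := prim_derive x a cr => H; rewrite derive_val.
by have := prim_derive x b ci => H; rewrite derive_val.
Qed.

Definition cmeas f := measurable_fun setT (fun x => Re (f x)) /\
  measurable_fun setT (fun x => Im (f x)).

Lemma cprim_meas F f : cprim F f -> cmeas F /\ cmeas f.
Proof.
move=> [a b]; split; split; try exact: prim_meas a; try exact: prim_meas b.
  exact: continuous_measurable_fun (prim_cont a).
exact: continuous_measurable_fun (prim_cont b).
Qed.

Lemma cmeasM f g : cmeas f -> cmeas g -> cmeas (fun x => f x * g x).
Proof.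
move=> [a b] [c d]; split.
  rewrite (_ : (fun x => Re _) = fun x => Re (f x) * Re (g x) - Im (f x) * Im (g x)).
    by apply: measurable_funB; apply: measurable_funM.
  by apply/funext => x; rewrite cReM.
rewrite (_ : (fun x => Im _) = fun x => Re (f x) * Im (g x) + Im (f x) * Re (g x)).
  by apply: measurable_funD; apply: measurable_funM.
by apply/funext => x; rewrite cImM.
Qed.
Lemma cmeasD f g : cmeas f -> cmeas g -> cmeas (fun x => f x + g x).
Proof.
move=> [a b] [c d]; split.
  rewrite (_ : (fun x => Re _) = fun x => Re (f x) + Re (g x)).
    by apply: measurable_funD.
  by apply/funext => x; rewrite cReD.
rewrite (_ : (fun x => Im _) = fun x => Im (f x) + Im (g x)).
  by apply: measurable_funD.
by apply/funext => x; rewrite cImD.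
Qed.
Lemma cmeas_cst z : cmeas (fun=> z).
Proof. by split; exact: measurable_cst. Qed.
Lemma cmeasZ z f : cmeas f -> cmeas (fun x => z * f x).
Proof. by move=> mf; apply: cmeasM => //; exact: cmeas_cst. Qed.
Lemma cmeasN f : cmeas f -> cmeas (fun x => - f x).
Proof.
move=> /(cmeasZ (-1)); congr cmeas; apply/funext => x; by rewrite mulN1r.
Qed.
Lemma cmeasB f g : cmeas f -> cmeas g -> cmeas (fun x => f x - g x).
Proof. by move=> mf /cmeasN; exact: cmeasD. Qed.
Lemma cmeas_real (U : R -> R) : measurable_fun setT U -> cmeas (fun x => (U x)%:C%C).
Proof. by move=> mU; split => //; exact: measurable_cst. Qed.
Lemma cmeas_cexpi (k : R) : cmeas (fun x => cexpi (k * x)).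
Proof. by have [] := cprim_meas (cprim_cexpi k). Qed.
Lemma cmeas_n1 f : cmeas f -> measurable_fun setT (fun x => n1 (f x)).
Proof.
by move=> [a b]; apply: measurable_funD; apply: measurableT_comp => //; exact: measurable_normr.
Qed.
Lemma cmeas_sum (I : Type) (s : seq I) (P : pred I) (f : I -> R -> C) :
  (forall i, cmeas (f i)) -> cmeas (fun x => \sum_(i <- s | P i) f i x).
Proof.
move=> H; elim: s => [|i s IH].
  by rewrite (_ : (fun _ => _) = fun=> 0); [exact: cmeas_cst|apply/funext => x; rewrite big_nil].
rewrite (_ : (fun _ => _) = fun x => if P i then f i x + \sum_(j <- s | P j) f j x
  else \sum_(j <- s | P j) f j x); last by apply/funext => x; rewrite big_cons.
by case: (P i) => //; apply: cmeasD.
Qed.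

End ComplexCalculus.
#[global] Hint Extern 0 (is_true (0 <= n1 _)) => exact: n1_ge0 : core.

(** * Existence and uniqueness of Jost solutions *)

Section Jost.
Context {R : realType}.
Local Notation mu := (@lebesgue_measure R).
Local Notation C := R[i].
Local Notation Re := complex.Re.
Local Notation Im := complex.Im.
Implicit Types (U : R -> R) (f g : R -> C).

Definition wmass U x : R := \int[mu]_(y in `[x, +oo[) (wt y ^+ 2 * `|U y|).

(** The bound N is kept explicit because all constants for Jost solutions are functions of N
    alone. *)
Definition wL1 U (N : R) := [/\ measurable_fun setT U,
  intg setT (fun y => wt y ^+ 2 * `|U y|) & \int[mu]_y (wt y ^+ 2 * `|U y|) <= N].

Lemma wL1_ge0 U N : wL1 U N -> 0 <= N.
Proof.
case=> _ _; apply: le_trans; apply: Rintegral_ge0 => x _.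
by rewrite mulr_ge0 // sqr_ge0.
Qed.

Lemma wmass_ge0 U x : 0 <= wmass U x.
Proof. by apply: Rintegral_ge0 => y _; rewrite mulr_ge0 // sqr_ge0. Qed.

Lemma wmass_le U N x : wL1 U N -> wmass U x <= N.
Proof.
move=> [mU Im mN]; apply: le_trans mN.
rewrite /wmass Rintegral_mkcond; apply: le_Rintegral => //.
  exact: intg_patch.
move=> y _; rewrite patchE; case: ifP => _; first exact: lexx.
by rewrite mulr_ge0 // sqr_ge0.
Qed.

Lemma wmass_cvg U N : wL1 U N -> (fun n : nat => wmass U n%:R) @ \oo --> 0.
Proof. by move=> [_ Im _]; exact: Rint_tail_cvg0. Qed.

Lemma wL1_weight U N : wL1 U N -> exists Phi : R -> R,
  [/\ continuous Phi, forall x, 1 <= Phi x, forall x, Phi x <= expR (2 * N),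
    forall x, \int[mu]_(y in `[x, +oo[) (wt y ^+ 2 * `|U y| * Phi y) <= Phi x / 2 &
    intg setT (fun y => wt y ^+ 2 * `|U y| * Phi y)].
Proof.
move=> [mU Im mN].
have m0 x : 0 <= wt x ^+ 2 * `|U x| by rewrite mulr_ge0 // sqr_ge0.
have [Phi [cP P1 PG]] := gronwall_weight m0 Im mN.
exists Phi; split=> //; try by move=> x; case/andP: (P1 x).
apply: (@intg_le _ _ _ (fun x => expR (2 * N) * (wt x ^+ 2 * `|U x|))) => //.
- by apply: measurable_funM; [by apply: intg_meas|exact: continuous_measurable_fun].
- move=> y _; case/andP: (P1 y) => p1 p2; rewrite ger0_norm.
    by rewrite mulrC ler_wpM2r.
  by rewrite mulr_ge0 // (le_trans ler01).
- exact: intgZ.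
Qed.

(** As [U] is real, the real and imaginary parts of the Jost equation decouple, with free solutions
    cos and sin. In the last clause y - x <= wt y saves a factor wt x on the half-line x >= 0; this
    gain is needed for Wronskians at +oo with a linearly growing partner. *)
Lemma real_jost U N (k : R) (phi h h1 : R -> R) : wL1 U N ->
  prim h h1 -> prim h1 (fun x => - (k ^+ 2 * h x)) -> (forall x, `|h x| <= 1) ->
  (forall x, intg `[x, +oo[ (fun y => sinck k (y - x) * U y * phi y)) ->
  (forall x, phi x = h x + \int[mu]_(y in `[x, +oo[) (sinck k (y - x) * U y * phi y)) ->
  exists phi1 : R -> R, [/\ prim phi phi1,
    prim phi1 (fun x => (U x - k ^+ 2) * phi x),
    forall x, `|phi x| <= 2 * expR (2 * N) * wt x,
    forall x, `|phi x - h x| <= 2 * expR (2 * N) * wt x * wmass U x /\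
      `|phi1 x - h1 x| <= 2 * expR (2 * N) * wmass U x &
    forall x, 0 <= x -> `|phi x - h x| <= 2 * expR (2 * N) * wmass U x /\
      wt x * `|phi1 x - h1 x| <= 2 * expR (2 * N) * wmass U x].
Proof.
move=> UN ph ph1 hle Ik phiE; have [mU Im mN] := UN.
have [Phi [cP P1 PK PG ImP]] := wL1_weight UN.
have ch : continuous h := prim_cont ph.
have b1 x : `|phi x| <= 2 * (wt x * Phi x).
  exact: (volterra_bound mU P1 PG ImP ch hle Ik phiE).
set K := 2 * expR (2 * N).
have K0 : 0 <= K by rewrite mulr_ge0 // expR_ge0.
have b2 x : `|phi x| <= K * wt x.
  rewrite (le_trans (b1 x)) // /K -mulrA ler_wpM2l // mulrC ler_wpM2r //.
have I3 x := volterra_intg Ik x.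
pose A x := \int[mu]_(y in `[x, +oo[) (sinck k y * (U y * phi y)).
pose B x := \int[mu]_(y in `[x, +oo[) (cos (k * y) * (U y * phi y)).
have pA : prim A (fun x => - (sinck k x * (U x * phi x))).
  by apply: prim_tail => x; case: (I3 x).
have pB : prim B (fun x => - (cos (k * x) * (U x * phi x))).
  by apply: prim_tail => x; case: (I3 x).
have IU x : intg `[x, +oo[ (fun y => U y * phi y) by case: (I3 x).
have pc : prim (fun x => cos (k * x)) (fun x => - (k ^+ 2 * sinck k x)).
  by apply: eq_prim (prim_cosk k) => // x; rewrite -mul_sinck expr2 mulrA.
have ps := prim_sinck k.
(* The derivative of cos A - sinck B: the contributions of A' and B' cancel each other. *)
pose phi1 x := h1 x - (k ^+ 2 * (sinck k x * A x) + cos (k * x) * B x).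
have phiS x : phi x = h x + (cos (k * x) * A x - sinck k x * B x).
  by rewrite phiE; congr (_ + _); exact: volterra_split.
have p1 : prim phi phi1.
  apply: eq_prim (primD ph (primB (primM pc pA) (primM ps pB))) => x.
    by rewrite phiS.
  rewrite /phi1; ring.
have p2 : prim phi1 (fun x => (U x - k ^+ 2) * phi x).
  apply: eq_prim (primB ph1 (primD (primZ (k ^+ 2) (primM ps pA)) (primM pc pB))) => x //.
  rewrite mulrBl; set u := U x * phi x.
  transitivity ((cos (k * x) ^+ 2 + k ^+ 2 * sinck k x ^+ 2) * u
    - k ^+ 2 * (h x + (cos (k * x) * A x - sinck k x * B x))); first by ring.
  by rewrite cosk_sinck mul1r -phiS.
have dE x : phi1 x - h1 x = - \int[mu]_(y in `[x, +oo[) (cos (k * (y - x)) * (U y * phi y)).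
  have [Is Ic _] := I3 x.
  rewrite /phi1 addrAC subrr add0r; congr (- _).
  transitivity (\int[mu]_(y in `[x, +oo[) (k ^+ 2 * sinck k x * (sinck k y * (U y * phi y))
      + cos (k * x) * (cos (k * y) * (U y * phi y)))).
    by rewrite RintegralD ?RintegralZl ?mulrA //; apply: intgZ.
  apply: eq_Rintegral => y _.
  rewrite (_ : k * (y - x) = k * y - k * x); last ring.
  by rewrite cosB -!mul_sinck; ring.
have mker (x : R) : measurable_fun `[x, +oo[ (fun y : R => cos (k * (y - x)) * (U y * phi y)).
  apply: measurable_funM; last by apply: intg_meas.
  apply: measurable_fun_cont => // y.
  apply: (@continuous_comp _ _ _ (fun y => y - x) (fun y => cos (k * y))); last exact: continuous_cosk.
  by apply: cvgB; [exact: cvg_id|exact: cvg_cst].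
have Imx x : intg `[x, +oo[ (fun y => wt y ^+ 2 * `|U y|) by apply: intgS Im.
have IKm c x : intg `[x, +oo[ (fun y => c * (wt y ^+ 2 * `|U y|)) by apply: intgZ.
have bc x y : `|cos (k * (y - x)) * (U y * phi y)| <= `|U y| * (K * wt y).
  rewrite !normrM mulrA ler_pM ?mulr_ge0 //.
  by rewrite ler_piMl // cos_max.
have bT (x : R) c (H : R -> R) : 0 <= c -> measurable_fun `[x, +oo[ H ->
    (forall y, x <= y -> c * `|H y| <= K * (wt y ^+ 2 * `|U y|)) ->
    intg `[x, +oo[ H ->
    c * `|\int[mu]_(y in `[x, +oo[) H y| <= K * wmass U x.
  move=> c0 mH Hle IH; rewrite -RintegralZl // -[X in X * _](ger0_norm c0) -normrM -RintegralZl //.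
  apply: Rint_le0 => //; first by apply: measurable_funM.
  by move=> y /=; rewrite in_itv /= andbT normrM (ger0_norm c0) => /Hle.
have IC (x : R) : intg `[x, +oo[ (fun y => cos (k * (y - x)) * (U y * phi y)).
  by apply: (@intg_bdd _ _ _ _ 1) => // [|y _]; [|exact: cos_max];
   apply: measurable_fun_cont => // y; 
   apply: (@continuous_comp _ _ _ (fun y => y - x) (fun y => cos (k * y))); [apply: cvgB;
       [exact: cvg_id|exact: cvg_cst]| exact: continuous_cosk].
have mk (x : R) : measurable_fun `[x, +oo[ (fun y => sinck k (y - x) * U y * phi y).
  by apply: intg_meas.
have wle y x : 0 <= x -> x <= y -> wt x <= wt y.
  by move=> x0 xy; rewrite /wt !ger0_norm ?(le_trans x0) // lerD2l.
exists phi1; split=> // [x|x x0]; split.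
- have -> : phi x - h x = \int[mu]_(y in `[x, +oo[) (sinck k (y - x) * U y * phi y).
    by rewrite phiE addrC addKr.
  rewrite mulrAC -[leLHS]mulr1 -ler_pdivrMr // mulrAC mulr1 [leLHS]mulrC.
  apply: bT => // [|y xy]; first by rewrite invr_ge0.
  rewrite mulrC ler_pdivrMr // !normrM.
  apply: (@le_trans _ _ (wt x * wt y * `|U y| * (K * wt y))).
    by rewrite ler_pM ?b2 ?mulr_ge0 // ler_wpM2r // sinckB_le.
  by apply: eq_ler; ring.
- rewrite dE normrN -[leLHS]mul1r; apply: bT => // y xy.
  rewrite mul1r (le_trans (bc x y)) // mulrCA -/K ler_wpM2l //.
  rewrite mulrC ler_wpM2r // expr2 ler_peMr //.
- have -> : phi x - h x = \int[mu]_(y in `[x, +oo[) (sinck k (y - x) * U y * phi y).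
    by rewrite phiE addrC addKr.
  rewrite -[leLHS]mul1r; apply: bT => // y xy.
  rewrite mul1r !normrM.
  apply: (@le_trans _ _ (wt y * `|U y| * (K * wt y))).
    rewrite ler_pM ?b2 ?mulr_ge0 // ler_wpM2r // (le_trans (sinck_le _ _)) //.
    rewrite /wt !ger0_norm ?subr_ge0 ?(le_trans x0) //; lra.
  by apply: eq_ler; ring.
- rewrite dE normrN; apply: bT => // y xy.
  apply: (@le_trans _ _ (wt y * (`|U y| * (K * wt y)))).
    by rewrite ler_pM // ?bc // wle.
  by apply: eq_ler; ring.
Qed.

End Jost.

Section JostSolutions.
Context {R : realType}.
Local Notation mu := (@lebesgue_measure R).
Local Notation C := R[i].
Local Notation Re := complex.Re.
Local Notation Im := complex.Im.
Implicit Types (U : R -> R) (f g : R -> C).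

(** Real and imaginary parts contribute 2 exp(2N) each. The factor 1 + N serves f': the deviation
    from the plane wave brings the mass N, and the derivative of the plane wave itself brings at
    most 2 when |k| <= 1. *)
Definition jost_const (N : R) : R := 4 * expR (2 * N) * (1 + N).

(** The fourth clause serves the first-order expansion, where x runs over the whole line. The fifth,
    sharper but restricted to x >= 0, serves limits of Wronskians at +oo. *)
Definition jost_right U k N f f1 :=
  [/\ cprim f f1, cprim f1 (fun x => (U x - k ^+ 2)%:C%C * f x),
    forall x, n1 (f x) <= jost_const N * wt x /\ n1 (f1 x) <= jost_const N,
    forall x, n1 (f x - cexpi (k * x)) <= jost_const N * wt x * wmass U x &
    forall x, 0 <= x -> n1 (f x - cexpi (k * x)) <= jost_const N * wmass U x /\
      wt x * n1 (f1 x - Complex 0 k * cexpi (k * x)) <= jost_const N * wmass U x].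

Lemma jost_const_ge N : 0 <= N -> 4 <= jost_const N.
Proof.
move=> N0; rewrite /jost_const -mulrA ler_peMr // mulr_ege1 //; last by rewrite lerDl.
by rewrite -expR0 ler_expR mulr_ge0.
Qed.

Lemma jostp_right U k N f : wL1 U N -> `|k| <= 1 -> is_jostp U k f ->
  exists f1, jost_right U k N f f1.
Proof.
move=> UN k1 Hf; have N0 := wL1_ge0 UN.
have pc1 : prim (fun x => - (k * sin (k * x))) (fun x => - (k ^+ 2 * cos (k * x))).
  by apply: eq_prim (primN (primZ k (prim_sink k))) => x //; rewrite expr2 mulrA.
have ps1 : prim (fun x => k * cos (k * x)) (fun x => - (k ^+ 2 * sin (k * x))).
  by apply: eq_prim (primZ k (prim_cosk k)) => x //; rewrite mulrN expr2 mulrA.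
have Ir x : intg `[x, +oo[ (fun y => sinck k (y - x) * U y * Re (f y)).
  by have [[H _] _] := Hf x; apply: eq_intg H => // y _; rewrite cReMr.
have Ii x : intg `[x, +oo[ (fun y => sinck k (y - x) * U y * Im (f y)).
  by have [[_ H] _] := Hf x; apply: eq_intg H => // y _; rewrite cImMr.
have Er x : Re (f x) = cos (k * x) + \int[mu]_(y in `[x, +oo[) (sinck k (y - x) * U y * Re (f y)).
  have [_ ->] := Hf x; rewrite cReD /=; congr (_ + _).
  by apply: eq_Rintegral => y _; rewrite cReMr (Hf y).2.
have Ei x : Im (f x) = sin (k * x) + \int[mu]_(y in `[x, +oo[) (sinck k (y - x) * U y * Im (f y)).
  have [_ ->] := Hf x; rewrite cImD /=; congr (_ + _).
  by apply: eq_Rintegral => y _; rewrite cImMr (Hf y).2.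
have [r1 [pr pr1 br dr er]] := real_jost UN (prim_cosk k) pc1 (fun x => cos_max _) Ir Er.
have [i1 [pi pi1 bi di ei]] := real_jost UN (prim_sink k) ps1 (fun x => sin_max _) Ii Ei.
have e0 : 1 <= expR (2 * N) by rewrite -expR0 ler_expR mulr_ge0.
have KE : 4 * expR (2 * N) <= jost_const N by rewrite /jost_const ler_peMr ?lerDl // mulr_ge0 ?expR_ge0.
exists (fun x => Complex (r1 x) (i1 x)); split.
- by split.
- by split; [apply: eq_prim pr1|apply: eq_prim pi1] => x //; rewrite ?cReMr ?cImMr.
- move=> x; split.
    apply: (@le_trans _ _ (4 * expR (2 * N) * wt x)); last by rewrite ler_wpM2r.
    by have := br x; have := bi x; rewrite /n1; lra.
  rewrite /n1 /=.
  have := wmass_le x UN; have := (dr x).2; have := (di x).2.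
  have ks (s : R) : `|s| <= 1 -> `|k * s| <= 1.
    by move=> s1; rewrite normrM mulr_ile1.
  have := ks _ (sin_max (k * x)); have := ks _ (cos_max (k * x)).
  have := ler_normD (r1 x - - (k * sin (k * x))) (- (k * sin (k * x))).
  have := ler_normD (i1 x - k * cos (k * x)) (k * cos (k * x)).
  rewrite !subrK normrN /jost_const.
  set E := expR _; set w := wmass U x => h1 h2 h3 h4 h5 h6 h7.
  have : E * w <= E * N by rewrite ler_wpM2l // (le_trans ler01).
  move: e0; rewrite -/E; nra.
- move=> x; rewrite /n1 cReB cImB /=.
  apply: (@le_trans _ _ (4 * expR (2 * N) * wt x * wmass U x)).
    have := (dr x).1; have := (di x).1; rewrite -!mulrA.
    set a := _ * (_ * wmass U x); lra.
  by rewrite !ler_wpM2r // wmass_ge0.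
- move=> x x0; rewrite /n1 !cReB !cImB cReM cImM /= !mul0r sub0r add0r.
  have [h1 h2] := er x x0; have [h3 h4] := ei x x0.
  have : 4 * expR (2 * N) * wmass U x <= jost_const N * wmass U x.
    by rewrite ler_wpM2r // wmass_ge0.
  by rewrite mulrDr; lra.
Qed.

Lemma jostp_ex U k N : wL1 U N -> exists f, is_jostp U k f.
Proof.
move=> UN; have [mU Im_ mN] := UN.
have [Phi [cP P1 PK PG ImP]] := wL1_weight UN.
have [a Ha] := volterra_ex k mU P1 PG ImP (@continuous_cosk _ k) (fun x => cos_max _).
have cs : continuous (fun x => sin (k * x)) by exact: prim_cont (prim_sink k).
have [b Hb] := volterra_ex k mU P1 PG ImP cs (fun x => sin_max _).
exists (fun x => Complex (a x) (b x)) => x; split.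
  split; [apply: eq_intg (Ha x).1|apply: eq_intg (Hb x).1] => // y _.
    by rewrite cReMr.
  by rewrite cImMr.
apply: complex_ext; rewrite ?cReD ?cImD /=.
  by rewrite (Ha x).2; congr (_ + _); apply: eq_Rintegral => y _; rewrite mul0r subr0.
by rewrite (Hb x).2; congr (_ + _); apply: eq_Rintegral => y _; rewrite mul0r addr0.
Qed.

Lemma jostpP U k N : wL1 U N -> `|k| <= 1 ->
  exists f1, jost_right U k N (jostp U k) f1.
Proof.
move=> UN k1; apply: jostp_right => //.
have [f Hf] := jostp_ex k UN.
by rewrite /jostp; have := xgetPex (fun=> 0) (ex_intro _ f Hf).
Qed.

(** An integrand known to be measurable only on [D] is first extended by 0, so that [Rint_opp]
    applies. *)
Lemma intg_opp D (h : R -> R) : measurable D -> intg D h ->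
  intg ((-%R) @^-1` D) (fun x => h (- x)) /\
  \int[mu]_(x in (-%R) @^-1` D) h (- x) = \int[mu]_(x in D) h x.
Proof.
move=> mD Ih.
have mh : measurable_fun setT (h \_ D).
  apply: (measurable_restrictT h mD).1.
  by apply: intg_meas.
have IhD : intg D (h \_ D).
  by apply: eq_intg Ih => // x Dx; rewrite patchE mem_set.
have mD' : measurable ((-%R : R -> R) @^-1` D).
  by rewrite -[X in measurable X]setTI; exact: oppr_measurable.
have [I E] := Rint_opp mD mh IhD; split.
  by apply: eq_intg I => // x Dx; rewrite patchE mem_set.
have -> : \int[mu]_(x in (-%R) @^-1` D) h (- x) = \int[mu]_(x in (-%R) @^-1` D) (h \_ D) (- x).
  by apply: eq_Rintegral => x /set_mem Dx; rewrite patchE mem_set.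
by rewrite E; apply: eq_Rintegral => x Dx; rewrite patchE Dx.
Qed.

Lemma wL1_opp U N : wL1 U N -> wL1 (fun x => U (- x)) N.
Proof.
move=> [mU Im_ mN].
have [I E] : intg setT (fun x => wt (- x) ^+ 2 * `|U (- x)|) /\
    \int[mu]_x (wt (- x) ^+ 2 * `|U (- x)|) = \int[mu]_x (wt x ^+ 2 * `|U x|).
  exact: intg_opp measurableT Im_.
have e x : wt (- x) ^+ 2 * `|U (- x)| = wt x ^+ 2 * `|U (- x)| by rewrite wtN.
split.
- by apply: measurableT_comp => //; exact: oppr_measurable.
- by apply: eq_intg I => // x _; rewrite e.
- by rewrite -E in mN; move: mN; under eq_Rintegral do rewrite e.
Qed.

Lemma preimage_oppNy (x : R) :
  (-%R : R -> R) @^-1` `]-oo, (- x)] = `[x, +oo[%classic.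
Proof. by apply/seteqP; split=> y /=; rewrite !in_itv /= lerN2 ?andbT. Qed.

Lemma preimage_oppy (x : R) :
  (-%R : R -> R) @^-1` `[- x, +oo[ = `]-oo, x]%classic.
Proof. by apply/seteqP; split=> y /=; rewrite !in_itv /= lerN2 ?andbT. Qed.

(** Reflection turns f_- for [U] into f_+ for the reflected potential: [sinck] is odd, which
    accounts for the opposite sign in front of the integral. Everything at -oo is obtained from +oo
    in this way. *)
Lemma jostm_opp U k f : is_jostm U k f ->
  is_jostp (fun x => U (- x)) k (fun x => f (- x)).
Proof.
move=> Hf x; have [[I1 I2] E] := Hf (- x).
have := intg_opp _ I1; have := intg_opp _ I2.
rewrite preimage_oppNy => /(_ (measurable_itv _)) [J2 E2] /(_ (measurable_itv _)) [J1 E1].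
have s y : sinck k (- y - - x) = - sinck k (y - x) by rewrite -opprD sinckN.
split.
  split.
    by apply: eq_intg (intgN _ J1) => // y _; rewrite !cReMr s !mulNr opprK.
  by apply: eq_intg (intgN _ J2) => // y _; rewrite !cImMr s !mulNr opprK.
rewrite {1}E mulrN opprK; apply: complex_ext; rewrite ?cReB ?cReD ?cImB ?cImD /=; congr (_ + _).
  rewrite -E1 -[LHS]mulN1r -RintegralZl //.
  by apply: eq_Rintegral => y _; rewrite !cReMr s !mulNr mul1r opprK.
rewrite -E2 -[LHS]mulN1r -RintegralZl //.
by apply: eq_Rintegral => y _; rewrite !cImMr s !mulNr mul1r opprK.
Qed.

Lemma jostp_opp U k f : is_jostp (fun x => U (- x)) k f ->
  is_jostm U k (fun x => f (- x)).
Proof.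
move=> Hf x; have [[I1 I2] E] := Hf (- x).
have := intg_opp _ I1; have := intg_opp _ I2.
rewrite preimage_oppy => /(_ (measurable_itv _)) [J2 E2] /(_ (measurable_itv _)) [J1 E1].
have s y : sinck k (- y - - x) = - sinck k (y - x) by rewrite -opprD sinckN.
split.
  split.
    by apply: eq_intg (intgN _ J1) => // y _; rewrite !cReMr s !mulNr !opprK.
  by apply: eq_intg (intgN _ J2) => // y _; rewrite !cImMr s !mulNr !opprK.
rewrite {1}E mulrN; apply: complex_ext; rewrite ?cReB ?cReD ?cImB ?cImD /=; congr (_ + _).
  rewrite -E1 -[RHS]mulN1r -RintegralZl //.
    by apply: eq_Rintegral => y _; rewrite !cReMr s !mulNr mul1r !opprK.
  by apply: eq_intg (intgN _ J1) => // y _; rewrite !cReMr s !mulNr !opprK.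
rewrite -E2 -[RHS]mulN1r -RintegralZl //.
  by apply: eq_Rintegral => y _; rewrite !cImMr s !mulNr mul1r !opprK.
by apply: eq_intg (intgN _ J2) => // y _; rewrite !cImMr s !mulNr !opprK.
Qed.

Definition jost_left U k N g g1 :=
  jost_right (fun x => U (- x)) k N (fun x => g (- x)) (fun x => - g1 (- x)).

Lemma jostmP U k N : wL1 U N -> `|k| <= 1 ->
  exists g1, jost_left U k N (jostm U k) g1.
Proof.
move=> UN k1; have UN' := wL1_opp UN.
have Hm : is_jostm U k (jostm U k).
  have [f /jostp_opp Hf] := jostp_ex k UN'.
  by rewrite /jostm; have := xgetPex (fun=> 0) (ex_intro _ _ Hf).
have [f1 Hf1] := jostp_right UN' k1 (jostm_opp Hm).
exists (fun x => - f1 (- x)); rewrite /jost_left.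
rewrite (_ : (fun x => - - f1 (- - x)) = f1) //.
by apply/funext => x; rewrite !opprK.
Qed.

Lemma jost_left_cprim U k N g g1 : jost_left U k N g g1 ->
  [/\ cprim g g1, cprim g1 (fun x => (U x - k ^+ 2)%:C%C * g x) &
    forall x, n1 (g x) <= jost_const N * wt x /\ n1 (g1 x) <= jost_const N].
Proof.
move=> [p1 p2 b _ _]; split.
- by apply: eq_cprim (cprim_opp p1) => x; rewrite ?opprK.
- by apply: eq_cprim (cprimN (cprim_opp p2)) => x; rewrite ?opprK.
- by move=> x; have := b (- x); rewrite !opprK wtN n1N.
Qed.

Lemma jost_right0 k N : 0 <= N -> `|k| <= 1 ->
  jost_right (fun=> 0) k N (fun x => cexpi (k * x)) (fun x => Complex 0 k * cexpi (k * x)).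
Proof.
move=> N0 k1; have K4 := jost_const_ge N0.
have m0 x : wmass (fun=> 0) x = 0 :> R.
  rewrite /wmass; under eq_Rintegral do rewrite normr0 mulr0.
  by rewrite Rintegral_cst // mul0r.
split.
- exact: cprim_cexpi.
- apply: eq_cprim (cprimZ (Complex 0 k) (cprim_cexpi k)) => x //.
  rewrite mulrA sub0r; congr (_ * _).
  by apply: complex_ext; rewrite ?cReM ?cImM /= ?mul0r ?mulr0 ?addr0 // sub0r expr2.
- move=> x; split.
    rewrite (le_trans (n1_cexpi _)) // -[2]mulr1 ler_pM //; lra.
  rewrite (le_trans (n1M _ _)) // /n1 /= normr0 add0r.
  apply: (@le_trans _ _ (1 * 2)); last by lra.
  by rewrite ler_pM // ?addr_ge0 //; exact: n1_cexpi.
- by move=> x; rewrite subrr n1_0 m0 mulr0.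
- by move=> x _; rewrite !subrr n1_0 m0 !mulr0.
Qed.

End JostSolutions.

(** * The Wronskian as an integral *)

Section ComplexIntegrals.
Context {R : realType}.
Local Notation mu := (@lebesgue_measure R).
Local Notation C := R[i].
Local Notation Re := complex.Re.
Local Notation Im := complex.Im.
Implicit Types (a b : R -> C) (D : set R).

Lemma cint_bound D a (h : R -> R) : measurable D -> cmeas a -> intg D h ->
  (forall x, D x -> n1 (a x) <= h x) ->
  cintegrable D a /\ n1 (cint D a) <= 2 * \int[mu]_(x in D) h x.
Proof.
move=> mD [mr mi] Ih ah.
have r x : D x -> `|Re (a x)| <= h x.
  by move=> Dx; apply: le_trans (ah x Dx); rewrite lerDl.
have i x : D x -> `|Im (a x)| <= h x.
  by move=> Dx; apply: le_trans (ah x Dx); rewrite lerDr.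
have mr' : measurable_fun D (fun x => Re (a x)) by exact: measurable_funTS.
have mi' : measurable_fun D (fun x => Im (a x)) by exact: measurable_funTS.
split; first by split; [exact: intg_le Ih|exact: intg_le Ih].
by rewrite /n1 mulrDl mul1r lerD //; apply: Rint_le0.
Qed.

Lemma cintD D a b : measurable D -> cintegrable D a -> cintegrable D b ->
  cintegrable D (fun x => a x + b x) /\ cint D (fun x => a x + b x) = cint D a + cint D b.
Proof.
move=> mD [ar ai] [br bi]; split.
  split; first by apply: eq_intg (intgD _ ar br) => // x _; rewrite cReD.
  by apply: eq_intg (intgD _ ai bi) => // x _; rewrite cImD.
apply: complex_ext; rewrite ?cReD ?cImD /= -RintegralD //; apply: eq_Rintegral => x _.
  by rewrite cReD.
by rewrite cImD.
Qed.

Lemma cintZ D (z : C) a : measurable D -> cintegrable D a ->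
  cintegrable D (fun x => z * a x) /\ cint D (fun x => z * a x) = z * cint D a.
Proof.
move=> mD [ar ai]; split.
  split.
    by apply: eq_intg (intgB _ (intgZ (Re z) _ ar) (intgZ (Im z) _ ai)) => // x _; rewrite cReM.
  by apply: eq_intg (intgD _ (intgZ (Re z) _ ai) (intgZ (Im z) _ ar)) => // x _; rewrite cImM.
apply: complex_ext; rewrite ?cReM ?cImM /= -!RintegralZl //.
  rewrite -RintegralB //; try exact: intgZ.
  by apply: eq_Rintegral => x _; rewrite cReM.
rewrite -RintegralD //; try exact: intgZ.
by apply: eq_Rintegral => x _; rewrite cImM.
Qed.

Lemma cintN D a : measurable D -> cintegrable D a ->
  cintegrable D (fun x => - a x) /\ cint D (fun x => - a x) = - cint D a.
Proof.
move=> mD Ia; have [] := cintZ (-1) mD Ia.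
by rewrite mulN1r; under eq_fun do rewrite mulN1r.
Qed.

Lemma cintB D a b : measurable D -> cintegrable D a -> cintegrable D b ->
  cintegrable D (fun x => a x - b x) /\ cint D (fun x => a x - b x) = cint D a - cint D b.
Proof.
by move=> mD Ia /(cintN mD) [Ib <-]; exact: cintD.
Qed.

Lemma cint_sum (I : Type) (s : seq I) (P : pred I) D (a : I -> R -> C) : measurable D ->
  (forall i, cintegrable D (a i)) ->
  cintegrable D (fun x => \sum_(i <- s | P i) a i x) /\
  cint D (fun x => \sum_(i <- s | P i) a i x) = \sum_(i <- s | P i) cint D (a i).
Proof.
move=> mD H; elim: s => [|i s [IH1 IH2]].
  rewrite big_nil; under eq_fun do rewrite big_nil.
  split; first by split; exact: intg0.
  by rewrite /cint; apply: complex_ext => /=; rewrite Rintegral_cst // mul0r.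
rewrite big_cons; under eq_fun do rewrite big_cons.
by case: (P i) => //; rewrite -IH2; exact: cintD.
Qed.

Lemma cint_ae a b : cmeas a -> cmeas b -> {ae mu, forall x, a x = b x} ->
  cint setT a = cint setT b.
Proof.
move=> [ar ai] [br bi] ab; rewrite /cint; congr Complex; apply: Rint_ae => //.
  by apply: ae_mono ab => x ->.
by apply: ae_mono ab => x ->.
Qed.

Lemma cint_sym_cvg a : cintegrable setT a ->
  (fun n : nat => n1 (cint `[- n%:R, n%:R] a - cint setT a)) @ \oo --> 0.
Proof.
move=> [ar ai].
have P (h : R -> R) : intg setT h ->
    (fun n : nat => `|\int[mu]_(x in `[- n%:R, n%:R]) h x - \int[mu]_x h x|) @ \oo --> 0.
  move=> Ih; rewrite -[X in _ --> X](normr0 R) -(subrr (\int[mu]_x h x)).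
  by apply: cvg_norm; apply: cvgB; [exact: Rint_sym_cvg|exact: cvg_cst].
rewrite -[X in _ --> X](addr0 0).
rewrite [X in X @ \oo --> _](_ : _ = fun n : nat =>
  `|\int[mu]_(x in `[- n%:R, n%:R]) Re (a x) - \int[mu]_x Re (a x)| +
  `|\int[mu]_(x in `[- n%:R, n%:R]) Im (a x) - \int[mu]_x Im (a x)|).
  by apply: cvgD; exact: P.
by apply/funext => n; rewrite /n1 cReB cImB.
Qed.

Lemma n1_eq0_cvg (z : C) (e : nat -> R) : (forall n, n1 z <= e n) -> e @ \oo --> 0 -> z = 0.
Proof.
move=> ze e0; have : n1 z <= 0.
  apply: (ler_cvg_to (cvg_cst (n1 z)) e0); exact: nearW.
rewrite /n1 => h; have := normr_ge0 (Re z); have := normr_ge0 (Im z) => h1 h2.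
by apply: complex_ext; apply: normr0_eq0; lra.
Qed.

End ComplexIntegrals.

Section Wronskian.
Context {R : realType}.
Local Notation mu := (@lebesgue_measure R).
Local Notation C := R[i].
Local Notation Re := complex.Re.
Local Notation Im := complex.Im.
Implicit Types (U : R -> R) (f g : R -> C).

Definition Wr f f1 g g1 x : C := f x * g1 x - g x * f1 x.

Lemma Wr_cprim f f1 g g1 (a b : R -> C) : cprim f f1 -> cprim f1 (fun x => a x * f x) ->
  cprim g g1 -> cprim g1 (fun x => b x * g x) ->
  cprim (Wr f f1 g g1) (fun x => (b x - a x) * (f x * g x)).
Proof.
move=> pf pf1 pg pg1.
by apply: eq_cprim (cprimB (cprimM pf pg1) (cprimM pg pf1)) => x //; ring.
Qed.

Lemma cprim0_cst f : cprim f (fun=> 0) -> forall x y, f x = f y.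
Proof.
have P (h : R -> R) : prim h (fun=> 0) -> forall x y, h x = h y.
  move=> [_ H] x y; wlog xy : x y / x <= y => [W|].
    by have [/W|/ltW /W] := leP x y.
  apply/eqP; rewrite eq_sym -subr_eq0 H // Rintegral_cst //.
  by rewrite mul0r.
by move=> [/P a /P b] x y; apply: complex_ext; [exact: a|exact: b].
Qed.

Lemma Wr_cst f f1 g g1 (a : R -> C) : cprim f f1 -> cprim f1 (fun x => a x * f x) ->
  cprim g g1 -> cprim g1 (fun x => a x * g x) -> forall x y, Wr f f1 g g1 x = Wr f f1 g g1 y.
Proof.
move=> pf pf1 pg pg1; apply: cprim0_cst.
by apply: eq_cprim (Wr_cprim pf pf1 pg pg1) => x //; rewrite subrr mul0r.
Qed.

(** Both solutions approach the same plane wave at +oo, faster than [h] grows: the deviation of f is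
    o(1) against h' = O(1), that of f' is o(1 / wt) against h = O(wt). *)
Lemma Wr_lim U1 U2 k N f f1 g g1 h h1 (K : R) : wL1 U1 N -> wL1 U2 N ->
  jost_right U1 k N f f1 -> jost_right U2 k N g g1 ->
  (forall x, n1 (h x) <= K * wt x /\ n1 (h1 x) <= K) ->
  exists2 e : nat -> R, e @ \oo --> 0 &
    forall n : nat, n1 (Wr f f1 h h1 n%:R - Wr g g1 h h1 n%:R) <= e n.
Proof.
move=> N1 N2 [_ _ _ _ df] [_ _ _ _ dg] bh.
have K0 : 0 <= K by apply: le_trans (bh 0).2.
exists (fun n : nat => 2 * (K * (jost_const N * (wmass U1 n%:R + wmass U2 n%:R)))).
  rewrite -(mulr0 2) -(mulr0 K) -(mulr0 (jost_const N)) -[X in jost_const N * X](addr0 0).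
  do 3 (apply: cvgM; first exact: cvg_cst).
  by apply: cvgD; [exact: wmass_cvg N1|exact: wmass_cvg N2].
move=> n; have n0 : 0 <= n%:R :> R by [].
have [a1 a2] := df _ n0; have [b1 b2] := dg _ n0; have [c1 c2] := bh n%:R.
set x : R := n%:R in a1 a2 b1 b2 c1 c2 *.
set e := cexpi (k * x) in a1 a2 b1 b2; set e1 := Complex 0 k * e in a2 b2.
have -> : Wr f f1 h h1 x - Wr g g1 h h1 x =
    ((f x - e) - (g x - e)) * h1 x - h x * ((f1 x - e1) - (g1 x - e1)).
  by rewrite /Wr; ring.
rewrite (le_trans (n1B _ _)) // mulr_natl mulr2n lerD //.
  rewrite (le_trans (n1M _ _)) // mulrC ler_pM // (mulrDr (jost_const N)) (le_trans (n1B _ _)) //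
      lerD //.
rewrite (le_trans (n1M _ _)) // (le_trans (ler_wpM2r (n1_ge0 _) c1)) // -mulrA ler_wpM2l //.
rewrite (le_trans (ler_wpM2l _ (n1B _ _))) //. by rewrite (mulrDr (wt x)) (mulrDr (jost_const N)) lerD.
Qed.

End Wronskian.

(** * Differences of Wronskians and flux conservation *)

Section Transmission.
Context {R : realType}.
Local Notation mu := (@lebesgue_measure R).
Local Notation C := R[i].
Local Notation Re := complex.Re.
Local Notation Im := complex.Im.
Implicit Types (U : R -> R) (f g : R -> C).

Lemma jost_right_bound_opp U k N f f1 : jost_right U k N f f1 ->
  forall x, n1 (f (- x)) <= jost_const N * wt x /\ n1 (- f1 (- x)) <= jost_const N.
Proof. by move=> [_ _ b _ _] x; have := b (- x); rewrite wtN n1N. Qed.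

Lemma Wr_opp f f1 g g1 (x : R) :
  Wr (fun x => g (- x)) (fun x => - g1 (- x)) (fun x => f (- x)) (fun x => - f1 (- x)) x
  = Wr f f1 g g1 (- x).
Proof. by rewrite /Wr; ring. Qed.

(** The mixed Wronskian [M] of f for [U1] and G for [U2] has density (U2 - U1) f G. At +oo f may be
    replaced by F, which gives the Wronskian for [U2]; at -oo G may be replaced by g, which gives
    the one for [U1]. *)
Lemma Wr_diff U1 U2 k N f f1 g g1 F F1 G G1 : wL1 U1 N -> wL1 U2 N ->
  jost_right U1 k N f f1 -> jost_left U1 k N g g1 -> jost_right U2 k N F F1 -> jost_left U2 k N G G1 ->
  let D := fun x => (U2 x - U1 x)%:C%C * (f x * G x) in
  [/\ cintegrable setT D, Wr F F1 G G1 0 - Wr f f1 g g1 0 = cint setT D &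
    n1 (cint setT D) <= 2 * jost_const N ^+ 2 * \int[mu]_x (wt x ^+ 2 * `|U2 x - U1 x|)].
Proof.
move=> N1 N2 rf lg rF lG D.
have [pf pf1 bf _ _] := rf; have [pF pF1 bF _ _] := rF.
have [pg pg1 bg] := jost_left_cprim lg; have [pG pG1 bG] := jost_left_cprim lG.
have [mU1 I1 _] := N1; have [mU2 I2 _] := N2.
have mD : cmeas D.
  apply: cmeasM; first by apply: cmeas_real; exact: measurable_funB.
  by apply: cmeasM; [exact: (cprim_meas pf).1|exact: (cprim_meas pG).1].
have mwt : measurable_fun setT (fun x : R => wt x ^+ 2).
  by apply: measurable_funX; apply: continuous_measurable_fun; exact: continuous_wt.
have IU : intg setT (fun x => wt x ^+ 2 * `|U2 x - U1 x|).
  apply: (@intg_le _ _ _ (fun x => wt x ^+ 2 * `|U2 x| + wt x ^+ 2 * `|U1 x|)) => //.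
  - apply: measurable_funM => //; apply: measurableT_comp => //; exact: measurable_funB.
  - move=> x _; rewrite ger0_norm ?mulr_ge0 ?sqr_ge0 // -mulrDr ler_wpM2l ?sqr_ge0 //.
    exact: ler_normB.
  - exact: intgD.
have K0 : 0 <= jost_const N by apply: le_trans (bf 0).2.
have Dle x : n1 (D x) <= jost_const N ^+ 2 * (wt x ^+ 2 * `|U2 x - U1 x|).
  rewrite n1Mr mulrC (le_trans (ler_wpM2r _ (n1M _ _))) // mulrA ler_wpM2r //.
  have := (bf x).1; have := (bG x).1; have := n1_ge0 (f x); have := n1_ge0 (G x).
  by rewrite -exprMn expr2 => a b c d; rewrite ler_pM.
have [ID nD] := cint_bound measurableT mD (intgZ (jost_const N ^+ 2) measurableT IU) (fun x _ => Dle x).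
split=> //; last by move: nD; rewrite RintegralZl // mulrA.
pose M := Wr f f1 G G1.
have pM : cprim M D.
  by apply: eq_cprim (Wr_cprim pf pf1 pG pG1) => x //; rewrite /D rmorphB rmorphB /=; ring.
apply/eqP; rewrite -subr_eq0; apply/eqP.
have [e1 c1 h1] := Wr_lim N1 N2 rf rF bG.
have [e2 c2 h2] := Wr_lim (wL1_opp N1) (wL1_opp N2) lg lG (jost_right_bound_opp rf).
apply: (@n1_eq0_cvg _ _ (fun n => e1 n + n1 (cint `[- n%:R, n%:R] D - cint setT D) + e2 n)); last first.
  rewrite -[X in _ --> X](addr0 0) -[X in _ --> X + _](addr0 0).
  by apply: cvgD => //; apply: cvgD => //; exact: cint_sym_cvg.
move=> n.
have MnE : M n%:R - M (- n%:R) = cint `[- n%:R, n%:R] D.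
  have n0 : - n%:R <= n%:R :> R by rewrite (@le_trans _ _ 0) // oppr_le0.
  by apply: complex_ext; [rewrite cReB; exact: (pM.1.2 _ _ n0)|rewrite cImB; exact: (pM.2.2 _ _ n0)].
have -> : Wr F F1 G G1 0 - Wr f f1 g g1 0 - cint setT D =
   - (M n%:R - Wr F F1 G G1 n%:R) + (cint `[- n%:R, n%:R] D - cint setT D)
   - (Wr f f1 g g1 (- n%:R) - M (- n%:R)).
  rewrite -MnE (Wr_cst pF pF1 pG pG1 n%:R 0) (Wr_cst pf pf1 pg pg1 (- n%:R) 0); ring.
rewrite (le_trans (n1B _ _)) // lerD //; last by have := h2 n; rewrite !Wr_opp.
rewrite (le_trans (n1D _ _)) // lerD // n1N; exact: h1.
Qed.

Lemma half_i (z : C) : - z / (2 * Complex 0 1) = Complex 0 2^-1 * z.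
Proof.
have i2 : 2 * Complex 0 1 != 0 :> C.
  rewrite mulf_neq0 ?pnatr_eq0 //; apply/eqP => /(congr1 (@complex.Im R)) /=.
  by apply/eqP; rewrite oner_eq0.
apply: (mulIf i2); rewrite divfK // mulrAC.
have -> : Complex 0 2^-1 * (2 * Complex 0 1) = - 1 :> C.
  by apply: complex_ext; rewrite ?cReM ?cImM /= !(mul0r, mulr0, mulr1, subr0, add0r, addr0, sub0r,
      oppr0) //= mulVf // pnatr_eq0.
by rewrite mulN1r.
Qed.

Lemma k_over_tE U k N f1 g1 : jost_right U k N (jostp U k) f1 -> jost_left U k N (jostm U k) g1 ->
  k_over_t U k = Complex 0 2^-1 * Wr (jostp U k) f1 (jostm U k) g1 0.
Proof.
move=> [pf pf1 _ _ _] /jost_left_cprim [pg pg1 _].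
rewrite /k_over_t /wronskian (cprim_derive pf) ?(cprim_derive pg) ?half_i //.
- exact: prim_cont pg1.1.
- exact: prim_cont pg1.2.
- exact: prim_cont pf1.1.
- exact: prim_cont pf1.2.
Qed.

(** In real coordinates this is the identity |W[f, g]|^2 = 4 k^2 + |W[f, conj g]|^2: the two
    hypotheses are the fluxes of f and g, and the dropped square is the reflected part. *)
Lemma jost_modulus (a b c d p q r s k : R) : b * c - a * d = - k -> q * r - p * s = k ->
  (2 * k) ^+ 2 <= (a * r - b * s - (p * c - q * d)) ^+ 2 + (a * s + b * r - (p * d + q * c)) ^+ 2.
Proof.
move=> h1 h2.
have -> : (2 * k) ^+ 2 = - 4 * ((b * c - a * d) * (q * r - p * s)).
  by rewrite h1 h2; ring.
rewrite -subr_ge0.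
have -> : (a * r - b * s - (p * c - q * d)) ^+ 2 + (a * s + b * r - (p * d + q * c)) ^+ 2
   - - 4 * ((b * c - a * d) * (q * r - p * s)) =
   (a * r + b * s - (p * c + q * d)) ^+ 2 + (b * r - a * s - (p * d - q * c)) ^+ 2.
  by ring.
by rewrite addr_ge0 // sqr_ge0.
Qed.

(** W[f, conj f] is constant because [U] and k are real, and at +oo it equals that of the plane
    wave, -2ik. *)
Lemma jost_right_conj U k N f f1 : wL1 U N -> `|k| <= 1 -> jost_right U k N f f1 ->
  Im (f 0) * Re (f1 0) - Re (f 0) * Im (f1 0) = - k.
Proof.
move=> UN k1 rf; have N0 := wL1_ge0 UN.
have r0 := jost_right0 N0 k1.
have Z : wL1 (fun=> 0 : R) N.
  split; first exact: measurable_cst.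
  - by apply: eq_intg (@intg0 R setT _) => // x _; rewrite normr0 mulr0.
  - by under eq_Rintegral do rewrite normr0 mulr0; rewrite Rintegral_cst // mul0r.
set e := fun x => cexpi (k * x) in r0; set e1 := fun x => Complex 0 k * cexpi (k * x) in r0.
have [pf pf1 bf _ _] := rf; have [_ _ be _ _] := r0.
have cb (u : R -> C) (v : R -> C) : (forall x, n1 (u x) <= jost_const N * wt x /\ n1 (v x) <=
    jost_const N) ->
    forall x, n1 (conjc (u x)) <= jost_const N * wt x /\ n1 (conjc (v x)) <= jost_const N.
  by move=> H x; rewrite !n1_conj.
have [E1 c1 h1] := Wr_lim UN Z rf r0 (cb _ _ bf).
have [E2 c2 h2] := Wr_lim UN Z rf r0 (cb _ _ be).
have pcf := cprim_conj pf; have pcf1 := cprim_conj pf1.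
have cst n : Wr f f1 (fun x => conjc (f x)) (fun x => conjc (f1 x)) n%:R =
    Wr f f1 (fun x => conjc (f x)) (fun x => conjc (f1 x)) 0.
  apply: (Wr_cst pf pf1 pcf) => //.
  apply: eq_cprim pcf1 => x //; rewrite rmorphM; congr (_ * _).
  by apply: complex_ext => //=; rewrite oppr0.
have WE : Wr f f1 (fun x => conjc (f x)) (fun x => conjc (f1 x)) 0 = Complex 0 (- 2 * k).
  apply/eqP; rewrite -subr_eq0; apply/eqP.
  apply: (@n1_eq0_cvg _ _ (fun n => E1 n + E2 n)); last first.
    by rewrite -[X in _ --> X](addr0 0); exact: cvgD.
  move=> n; rewrite -(cst n).
  have -> : Complex 0 (- 2 * k) = Wr e e1 (fun x => conjc (e x)) (fun x => conjc (e1 x)) n%:R.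
    rewrite /Wr /e /e1; apply: complex_ext.
      by rewrite cReB !cReM !cRe_conj !cIm_conj !cReM !cImM /=; ring.
    rewrite cImB !cImM !cRe_conj !cIm_conj !cReM !cImM /=.
    transitivity (- 2 * k * (cos (k * n%:R) ^+ 2 + sin (k * n%:R) ^+ 2)); last by ring.
    by rewrite cos2Dsin2 mulr1.
  set x : R := n%:R.
  (* f is exchanged for the plane wave in one slot at a time; conjugation and antisymmetry reduce
     the second slot to the first. *)
  have -> : Wr f f1 (fun x => conjc (f x)) (fun x => conjc (f1 x)) x -
       Wr e e1 (fun x => conjc (e x)) (fun x => conjc (e1 x)) x =
    (Wr f f1 (fun x => conjc (f x)) (fun x => conjc (f1 x)) x -
     Wr e e1 (fun x => conjc (f x)) (fun x => conjc (f1 x)) x) -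
    conjc (Wr f f1 (fun x => conjc (e x)) (fun x => conjc (e1 x)) x -
     Wr e e1 (fun x => conjc (e x)) (fun x => conjc (e1 x)) x).
    rewrite /Wr; move: (f x) (f1 x) (e x) (e1 x) => [? ?] [? ?] [? ?] [? ?].
    by apply: complex_ext => /=; ring.
  by rewrite (le_trans (n1B _ _)) // n1_conj lerD // ?h1 ?h2.
move: WE => /(congr1 (@complex.Im R)); rewrite /Wr cImB !cImM !cRe_conj !cIm_conj /=; lra.
Qed.

Lemma k_over_t_ge U k N : wL1 U N -> `|k| <= 1 -> `|k| <= cmod (k_over_t U k).
Proof.
move=> UN k1.
have [f1 rf] := jostpP UN k1; have [g1 lg] := jostmP UN k1.
have h1 := jost_right_conj UN k1 rf; have := jost_right_conj (wL1_opp UN) k1 lg.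
rewrite oppr0 cReN cImN => h2.
rewrite (k_over_tE rf lg).
rewrite -(ler_sqr (normr_ge0 _) (cmod_ge0 _)) cmod_sqr real_normK ?num_real //.
rewrite cReM cImM /= /Wr !cReB !cImB !cReM !cImM.
set a := Re (jostp U k 0) in h1 *; set b := Im (jostp U k 0) in h1 *.
set p := Re (jostm U k 0) in h2 *; set q := Im (jostm U k 0) in h2 *.
set c := Re (f1 0) in h1 *; set d := Im (f1 0) in h1 *.
set r := Re (g1 0) in h2 *; set s := Im (g1 0) in h2 *.
have h2' : q * r - p * s = k by lra.
have := jost_modulus h1 h2'.
set X := _ - _ - _; set Y := _ + _ - _ => H.
have : k ^+ 2 <= (X ^+ 2 + Y ^+ 2) / 4 by move: H; rewrite exprMn; lra.
by move=> /le_trans; apply; apply: eq_ler; field.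
Qed.

End Transmission.

(** * Absolutely continuous representatives *)

Section DuBoisReymond.
Context {R : realType}.
Local Notation mu := (@lebesgue_measure R).
Implicit Types (f g h E phi : R -> R).

Lemma locally_intg g : locally_integrable setT g -> forall a b, intg `[a, b] g.
Proof.
move=> [mg _ Hg] a b; apply/integrableP; split.
  by apply/measurable_EFinP; exact: measurable_funTS.
by have := Hg `[a, b]%classic (fun _ _ => I) (@segment_compact _ a b).
Qed.

(** The integral from 0 to x for either sign of x: the common lower limit [Num.min 0 x] avoids
    oriented integrals. *)
Lemma prim_ex h : (forall a b, intg `[a, b] h) -> exists H, prim H h.
Proof.
move=> Ih.
exists (fun x => \int[mu]_(y in `[Num.min 0 x, x]) h y - \int[mu]_(y in `[Num.min 0 x, 0]) h y).
split=> // a b ab.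
pose c := Num.min 0 a.
have c0 : c <= 0 by rewrite ge_min lexx.
have ca : c <= a by rewrite ge_min lexx orbT.
have P x : c <= x -> \int[mu]_(y in `[Num.min 0 x, x]) h y - \int[mu]_(y in `[Num.min 0 x, 0]) h y
   = \int[mu]_(y in `[c, x]) h y - \int[mu]_(y in `[c, 0]) h y.
  move=> cx; have m1 : c <= Num.min 0 x by rewrite le_min c0.
  have m2 : Num.min 0 x <= 0 by rewrite ge_min lexx.
  have m3 : Num.min 0 x <= x by rewrite ge_min lexx orbT.
  by rewrite (Rint_itv_split m1 m2) // (Rint_itv_split m1 m3) //; ring.
rewrite (P b (le_trans ca ab)) (P a ca).
by rewrite (Rint_itv_split ca ab) //; ring.
Qed.

Lemma intg_supp f (a b : R) : a <= b -> intg `[a, b] f ->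
  (forall x, x \notin `[a, b] -> f x = 0) ->
  intg setT f /\ \int[mu]_x f x = \int[mu]_(x in `[a, b]) f x.
Proof.
move=> ab If f0.
have fE : f = f \_ `[a, b].
  apply/funext => x; rewrite patchE; case: ifPn => //.
  by rewrite mem_setE => /f0.
split; last by rewrite [RHS]Rintegral_mkcond -fE.
rewrite fE -restrict_EFin; apply/integrable_restrict => //; by rewrite setTI.
Qed.

Lemma cont_intg f a b : continuous f -> intg `[a, b] f.
Proof.
move=> cf; apply: continuous_compact_integrable; first exact: segment_compact.
exact: continuous_subspaceT.
Qed.

Lemma cst_intg c a b : intg `[a, b] (fun=> c : R).
Proof. by apply: cont_intg => x; exact: cvg_cst. Qed.

Lemma cont_intgM f h a b : continuous h -> intg `[a, b] f -> intg `[a, b] (fun x => h x * f x).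
Proof.
move=> ch If.
have : compact [set h x | x in `[a, b]%classic].
  apply: continuous_compact; last exact: segment_compact.
  exact: continuous_subspaceT.
move=> /compact_bounded [M [_ HM]].
apply: (@intg_bdd _ _ _ _ (M + 1)) => //; first exact: measurable_fun_cont.
by move=> x xab; apply: HM; [rewrite ltrDl|exists x].
Qed.

Definition ppart (t : R) := (t + `|t|) / 2.

Lemma ppart_ge0 t : 0 <= ppart t.
Proof. by rewrite /ppart; have := ler_norm (- t); rewrite normrN; lra. Qed.
Lemma ppart_pos t : 0 <= t -> ppart t = t.
Proof. by move=> t0; rewrite /ppart ger0_norm //; lra. Qed.
Lemma ppart_neg t : t <= 0 -> ppart t = 0.
Proof. by move=> t0; rewrite /ppart ler0_norm //; lra. Qed.
Lemma continuous_ppart f : continuous f -> continuous (fun x => ppart (f x)).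
Proof.
move=> cf x; apply: cvgM; last exact: cvg_cst.
apply: cvgD; first exact: cf.
by apply: cvg_norm; exact: cf.
Qed.

(** Continuous approximation of the indicator of [a, b], falling to 0 with slope n + 1 outside. *)
Definition trapezoid (a b : R) (n : nat) (x : R) :=
  ppart (1 - n.+1%:R * (ppart (a - x) + ppart (x - b))).

Lemma trapezoid_props a b n : a <= b ->
  [/\ continuous (trapezoid a b n), forall x, 0 <= trapezoid a b n x <= 1,
    forall x, x \in `[a, b] -> trapezoid a b n x = 1 &
    forall x, x \notin `[a - 1, b + 1] -> trapezoid a b n x = 0].
Proof.
move=> ab; split.
- apply: continuous_ppart => x; apply: cvgB; first exact: cvg_cst.
  apply: cvgM; first exact: cvg_cst.
  apply: cvgD.
    by apply: (@continuous_ppart (fun x => a - x)) => y; apply: cvgB; [exact: cvg_cst|exact: cvg_id].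
  by apply: (@continuous_ppart (fun x => x - b)) => y; apply: cvgB; [exact: cvg_id|exact: cvg_cst].
- move=> x; rewrite ppart_ge0 /=.
  have t0 : 0 <= n.+1%:R * (ppart (a - x) + ppart (x - b)) by rewrite mulr_ge0 // addr_ge0 // ppart_ge0.
  rewrite /trapezoid; have [t1|/ltW t1] := leP 0 (1 - n.+1%:R * (ppart (a - x) + ppart (x - b))).
    by rewrite ppart_pos //; lra.
  by rewrite ppart_neg.
- move=> x; rewrite in_itv /= => /andP [ax xb].
  by rewrite /trapezoid (@ppart_neg (a - x)) ?(@ppart_neg (x - b)) ?subr_le0 //
      addr0 mulr0 subr0 ppart_pos.
- move=> x; rewrite in_itv /= => H; rewrite /trapezoid [LHS]ppart_neg //.
  rewrite subr_le0; have d1 : 1 <= ppart (a - x) + ppart (x - b).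
    move: H; rewrite negb_and -!ltNge => /orP[H|H].
      by have := ppart_ge0 (x - b); rewrite (@ppart_pos (a - x)); lra.
    by have := ppart_ge0 (a - x); rewrite (@ppart_pos (x - b)); lra.
  by rewrite mulr_ege1 // ler1n.
Qed.

Lemma trapezoid_cvg a b x : a <= b ->
  (fun n => trapezoid a b n x) @ \oo --> ((x \in `[a, b])%:R : R).
Proof.
move=> ab; case: (boolP (x \in `[a, b])) => xab.
  rewrite (_ : (fun n => _) = fun=> 1); first exact: cvg_cst.
  by apply/funext => n; have [_ _ -> //] := trapezoid_props n ab.
have d0 : 0 < ppart (a - x) + ppart (x - b).
  move: xab; rewrite in_itv /= negb_and -!ltNge => /orP[H|H].
    by have := ppart_ge0 (x - b); rewrite (@ppart_pos (a - x)); lra.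
  by have := ppart_ge0 (a - x); rewrite (@ppart_pos (x - b)); lra.
apply: cvg_near_cst; near=> n; rewrite /trapezoid ppart_neg //.
rewrite subr_le0 -ler_pdivrMr // mul1r.
apply: (@le_trans _ _ (Num.truncn (ppart (a - x) + ppart (x - b))^-1).+1%:R).
  by rewrite ltW // truncnS_gt.
by rewrite ler_nat ltnS; near: n; exact: nbhs_infty_ge.
Unshelve. all: by end_near. Qed.

(** Du Bois-Reymond: a trapezoid minus a multiple of a fixed tent has zero integral, hence is the
    derivative of a test function. Letting the trapezoids tend to the indicator of [a, b] gives the
    integrals of [E]. *)
Lemma orthogonal_cst E : (forall a b, intg `[a, b] E) -> measurable_fun setT E ->
  (forall phi, C1_compact_support phi -> \int[mu]_x (E x * derive1 phi x) = 0) ->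
  exists c, forall a b, a <= b -> \int[mu]_(x in `[a, b]) (E x - c) = 0.
Proof.
move=> IE mE HE.
(* Zero total integral is exactly what makes the primitive of psi vanish on both sides of the
   support. *)
have Z psi M : 0 <= M -> continuous psi -> (forall x, M <= `|x| -> psi x = 0) ->
    \int[mu]_x psi x = 0 -> \int[mu]_x (E x * psi x) = 0.
  move=> M0 cpsi psi0 ipsi.
  have MM : - M <= M by lra.
  have [P pP] := prim_ex (fun a b => cont_intg a b cpsi).
  have zz a b : b <= - M \/ M <= a -> \int[mu]_(x in `[a, b]) psi x = 0.
    move=> ab; rewrite -[RHS](mul0r (fine (mu `[a, b]%classic))) -Rintegral_cst //.
    apply: eq_Rintegral => x; rewrite mem_setE in_itv /= => /andP [ax xb].
    by apply: psi0; rewrite ler_normr; case: ab => H; apply/orP; [right|left]; lra.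
  have psi0' x : x \notin `[- M, M] -> psi x = 0.
    rewrite in_itv /= -ler_norml -ltNge => /ltW; exact: psi0.
  have PM : P M = P (- M).
    apply/eqP; rewrite -subr_eq0 (pP.2 _ _ MM).
    by have [_ <-] := intg_supp MM (cont_intg _ _ cpsi) psi0'; rewrite ipsi.
  have dP (x : R) : is_derive x 1 (fun x => P x - P (- M)) (psi x).
    apply: prim_derive => //.
    by apply: eq_prim (primB pP (prim_cst (P (- M)))) => y //; rewrite subr0.
  have dE : derive1 (fun x => P x - P (- M)) = psi.
    by apply/funext => x; rewrite derive1E; have := dP x => H; rewrite derive_val.
  rewrite -[in LHS]dE; apply: HE; split.
  - by move=> x; have [] := dP x.
  - by rewrite dE.
  - exists M => x Mx; have [x0|/ltW x0] := leP 0 x.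
      rewrite ger0_norm // in Mx.
      by rewrite -PM (pP.2 _ _ (ltW Mx)) zz //; right.
    rewrite ler0_norm // in Mx.
    have xM : x <= - M by lra.
    by rewrite -opprB (pP.2 _ _ xM) zz ?oppr0 //; left.
(* The tent function max (0, 1 - |x|). *)
pose psi0 := trapezoid 0 0 0.
have [c0 b0 e0 s0] := @trapezoid_props 0 0 0 (lexx 0).
have supp (n : nat) a b x : a <= b -> `|a| + `|b| + 2 <= `|x| -> trapezoid a b n x = 0.
  move=> ab H; have [_ _ _ ->//] := trapezoid_props n ab.
  move: H; rewrite ler_normr in_itv /= negb_and -!ltNge => /orP H; apply/orP.
  have := ler_norm a; have := ler_norm b; have := ler_norm (- a); have := ler_norm (- b).
  by rewrite !normrN => *; case: H => H; [right|left]; lra.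
have Isupp (n : nat) a b : a <= b -> intg setT (trapezoid a b n).
  move=> ab; have [ct _ _ st] := trapezoid_props n ab.
  have ab1 : a - 1 <= b + 1 by lra.
  by have [] := intg_supp ab1 (cont_intg _ _ ct) st.
have IEsupp (n : nat) a b : a <= b -> intg setT (fun x => E x * trapezoid a b n x).
  move=> ab; have [ct _ _ st] := trapezoid_props n ab.
  have ab1 : a - 1 <= b + 1 by lra.
  have [||//] := @intg_supp (fun x => E x * trapezoid a b n x) _ _ ab1.
    by apply: eq_intg (cont_intgM ct (IE (a - 1) (b + 1))) => // x _; rewrite mulrC.
  by move=> x /st ->; rewrite mulr0.
pose I0 := \int[mu]_x psi0 x.
have I00 : 0 < I0.
  apply: (@lt_le_trans _ _ (\int[mu]_(x in `[0, 2^-1]) 2^-1)).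
    rewrite Rintegral_cst //= lebesgue_measure_itv /= lte_fin invr_gt0 ltr0n /=.
    by rewrite subr0 mulr_gt0 ?invr_gt0.
  apply: (@le_trans _ _ (\int[mu]_(x in `[0, 2^-1]) psi0 x)).
    apply: le_Rintegral => //.
    - exact: cst_intg.
    - exact: cont_intg.
    - move=> x /=; rewrite in_itv /= => /andP [x0 x2].
      rewrite /psi0 /trapezoid sub0r subr0 (@ppart_neg (- x)) ?oppr_le0 //.
      by rewrite add0r (@ppart_pos x) // mul1r ppart_pos; lra.
  rewrite Rintegral_mkcond; apply: le_Rintegral => //.
  - by apply: intg_patch => //; exact: Isupp.
  - exact: Isupp.
  - move=> x _; rewrite patchE; case: ifP => _; first exact: lexx.
    by have /andP[] := b0 x.
(* The only possible value: a constant c tested against the tent gives c I0. *)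
pose c := (\int[mu]_x (E x * psi0 x)) / I0.
exists c => a b ab.
have Et n : \int[mu]_x (E x * trapezoid a b n x) = c * \int[mu]_x trapezoid a b n x.
  pose t := \int[mu]_x trapezoid a b n x / I0.
  have [ct _ _ _] := trapezoid_props n ab.
  have ctt : continuous (fun x => trapezoid a b n x - t * psi0 x).
    by move=> x; apply: cvgB; [exact: ct|apply: cvgM; [exact: cvg_cst|exact: c0]].
  have M0 : 0 <= `|a| + `|b| + 2 by rewrite !addr_ge0.
  have := Z _ _ M0 ctt.
  have -> : \int[mu]_x (trapezoid a b n x - t * psi0 x) = 0.
    rewrite RintegralB ?RintegralZl //; try exact: Isupp; last by apply: intgZ => //; exact: Isupp.
    by rewrite /t divfK ?subrr // gt_eqF.
  move=> /(_ _ erefl).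
  have -> : \int[mu]_x (E x * (trapezoid a b n x - t * psi0 x)) =
     \int[mu]_x (E x * trapezoid a b n x) - t * \int[mu]_x (E x * psi0 x).
    rewrite -RintegralZl //; last exact: IEsupp.
    rewrite -RintegralB //; [|exact: IEsupp|by apply: intgZ => //; exact: IEsupp].
    by apply: eq_Rintegral => x _; ring.
  move=> H; have {H} : \int[mu]_x (E x * trapezoid a b n x) - t * \int[mu]_x (E x * psi0 x) = 0.
    apply: H => x Mx; rewrite supp // /psi0 supp ?mulr0 ?subrr // normr0 !add0r.
    by apply: le_trans Mx; rewrite lerDr addr_ge0.
  by move=> /eqP; rewrite subr_eq0 => /eqP ->; rewrite /t /c; ring.
have ab1 : a - 1 <= b + 1 by lra.
have lim f : (forall u v, intg `[u, v] f) -> measurable_fun setT f ->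
    (fun n => \int[mu]_x (f x * trapezoid a b n x)) @ \oo --> \int[mu]_(x in `[a, b]) f x.
  move=> If mf.
  pose hn n x := (f x * trapezoid a b n x)%:E.
  have mt n : measurable_fun setT (trapezoid a b n).
    by have [ct _ _ _] := trapezoid_props n ab; exact: continuous_measurable_fun.
  have [|||||_ _] := @dominated_convergence _ _ _ mu _ measurableT hn
     (EFin \o (f \_ `[a, b])) (EFin \o ((fun x => `|f x|) \_ `[a - 1, b + 1])).
  - by move=> n; apply/measurable_EFinP; exact: (measurable_funM mf (mt n)).
  - apply/measurable_EFinP; apply: (measurable_restrictT f (measurable_itv _)).1.
    exact: measurable_funTS.
  - apply: aeW => x _; apply: cvg_EFin; first exact: nearW.
    have -> : (f \_ `[a, b]) x = f x * (x \in `[a, b])%:R.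
      by rewrite patchE mem_setE; case: ifP; rewrite ?mulr1 ?mulr0.
    by apply: cvgM; [exact: cvg_cst|exact: trapezoid_cvg].
  - rewrite -restrict_EFin; apply/integrable_restrict => //; rewrite setTI.
    by apply: intg_norm.
  - apply: aeW => x n _; rewrite /hn /= patchE lee_fin mem_setE.
    have [_ bt _ st] := trapezoid_props n ab.
    case: ifPn => [_|/st ->]; last by rewrite mulr0 normr0.
    rewrite normrM ler_piMr //; have /andP[t0 t1] := bt x; by rewrite ger0_norm.
  rewrite /hn /= => H; rewrite [X in _ --> X]Rintegral_mkcond /Rintegral.
  apply: fine_cvg; rewrite fineK //.
  apply: (@integrable_fin_num _ _ _ mu _ measurableT (EFin \o (f \_ `[a, b]))).
  by rewrite -restrict_EFin; apply/integrable_restrict => //; rewrite setTI.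
have l1 := lim E IE mE.
have Ic u v : intg `[u, v] (fun=> 1 : R) by exact: cst_intg.
have l2 := lim (fun=> 1) Ic (measurable_cst _).
have l3 : (fun n => \int[mu]_x (E x * trapezoid a b n x)) @ \oo --> c * \int[mu]_(x in `[a, b]) 1.
  rewrite (_ : (fun n => _) = fun n => c * \int[mu]_x (1 * trapezoid a b n x)).
    by apply: cvgM => //; exact: cvg_cst.
  by apply/funext => n; rewrite Et; under [in RHS]eq_Rintegral do rewrite mul1r.
have := cvg_unique _ l1 l3 => /(_ (@Rhausdorff R)) El.
rewrite RintegralB //; last exact: cst_intg.
rewrite El -RintegralZl //; under [X in X - _]eq_Rintegral do rewrite mulr1.
by rewrite subrr.
Qed.

(** Lebesgue differentiation on each half-line ]-n, +oo[, where the primitive of [E] vanishes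
    identically. *)
Lemma zero_integrals_ae E : (forall a b, intg `[a, b] E) -> measurable_fun setT E ->
  (forall a b, a <= b -> \int[mu]_(x in `[a, b]) E x = 0) ->
  {ae mu, forall x, E x = 0}.
Proof.
move=> IE mE HE.
have locE : locally_integrable setT E.
  split=> //; first exact: openT.
  move=> K _ cK.
  have [M [_ HM]] := compact_bounded cK.
  have KM : K `<=` `[- (M + 1), M + 1].
    by move=> x Kx /=; rewrite in_itv /= -ler_norml; apply: HM => //; rewrite ltrDl.
  have /integrableP[_] := IE (- (M + 1)) (M + 1).
  apply: le_lt_trans; apply: ge0_subset_integral => //.
  - exact: compact_measurable.
  - by apply/measurable_EFinP; apply: measurableT_comp => //; exact: measurable_funTS.
have Fn (n : nat) : {ae mu, forall x, - n%:R < x -> E x = 0}.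
  have := @FTC1 R E (BLeft (- n%:R)) (IE _) locE.
  rewrite (_ : (fun x => \int[mu]_(t in _) E t) = fun=> 0); last first.
    apply/funext => x; have [nx|xn] := leP (- n%:R) x; first exact: HE.
    by rewrite set_itv_ge ?Rintegral_set0 // bnd_simp -ltNge.
  apply: ae_mono => x H nx; have [|_ <-] := H; first by rewrite (@lte_fin R).
  by rewrite derive1_cst.
apply: (ae_mono _ (ae_foralln Fn)) => x H.
apply: (H (Num.truncn `|x|).+1); rewrite ltrNl.
by rewrite (le_lt_trans _ (truncnS_gt _)) // -normrN ler_norm.
Qed.

(** If H is a primitive of [h], then g - H is orthogonal to the derivatives of all test functions,
    hence almost everywhere constant. *)
Lemma weak_derivative_prim g h : locally_integrable setT g -> locally_integrable setT h ->
  (forall phi, C1_compact_support phi ->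
    \int[mu]_x (g x * derive1 phi x) = - \int[mu]_x (h x * phi x)) ->
  exists2 G, prim G h & {ae mu, forall x, g x = G x}.
Proof.
move=> lg lh Hgh; have Ig := locally_intg lg; have Ih := locally_intg lh.
have mg : measurable_fun setT g by case: lg.
have mh : measurable_fun setT h by case: lh.
have [H pH] := prim_ex Ih; have cH := prim_cont pH.
have mH : measurable_fun setT H by exact: continuous_measurable_fun.
have IE a b : intg `[a, b] (fun x => g x - H x) by apply: intgB => //; exact: cont_intg.
have mE : measurable_fun setT (fun x => g x - H x) by exact: measurable_funB.
have [phi Hphi|c Hc] := orthogonal_cst IE mE.
  have [dphi cphi [M sphi]] := Hphi.
  have cph : continuous phi.
    by move=> x; apply: differentiable_continuous; apply/derivable1_diffP; exact: dphi.
  have pphi : prim phi (derive1 phi).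
    by apply: prim_C1 => // x; rewrite derive1E; exact: DeriveDef.
  pose L := `|M| + 1.
  have LL : - L <= L by rewrite /L; have := normr_ge0 M; lra.
  have out x : x \notin `[- L, L] -> M < `|x|.
    rewrite in_itv /= -ler_norml -ltNge /L; have := ler_norm M; lra.
  have p0 x : x \notin `[- L, L] -> phi x = 0 by move=> /out /sphi.
  have dp0 x : x \notin `[- L, L] -> derive1 phi x = 0.
    move=> /out Mx; rewrite derive1E.
    have : \forall y \near x, (fun=> 0) y = phi y.
      near=> y; rewrite sphi //; near: y.
      have : continuous (fun y : R => `|y|) by exact: norm_continuous.
      by move=> /(_ x) /cvgr_gt; apply.
    by move=> /near_eq_derive <-; rewrite derive_cst.
  have S f1 h1 : continuous h1 -> (forall a b, intg `[a, b] f1) ->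
      (forall x, x \notin `[- L, L] -> h1 x = 0) -> intg setT (fun x => f1 x * h1 x).
    move=> ch1 If1 h10.
    have [||//] := @intg_supp (fun x => f1 x * h1 x) _ _ LL.
      by apply: eq_intg (cont_intgM ch1 (If1 (- L) L)) => // x _; rewrite mulrC.
    by move=> x /h10 ->; rewrite mulr0.
  have I1 := S g _ cphi Ig dp0; have I2 := S h _ cph Ih p0.
  have I3 := S H _ cphi (fun a b => cont_intg a b cH) dp0.
  have I4 := S H _ cph (fun a b => cont_intg a b cH) p0.
  have := prim_int0 (primM pH pphi) I4 (intgD measurableT I2 I3).
  rewrite RintegralD // => E4.
  under eq_Rintegral do rewrite mulrBl.
  by rewrite RintegralB // (Hgh _ Hphi) -opprD; apply/eqP; rewrite oppr_eq0; apply/eqP; exact: E4.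
exists (fun x => H x + c).
  by apply: eq_prim (primD pH (prim_cst c)) => x //; rewrite addr0.
have Ic a b : intg `[a, b] (fun x => g x - H x - c).
  by apply: intgB => //; exact: cst_intg.
have mc : measurable_fun setT (fun x => g x - H x - c) by exact: measurable_funB.
by apply: ae_mono (zero_integrals_ae Ic mc Hc) => x /eqP; rewrite subr_eq0 subr_eq addrC => /eqP.
Unshelve. all: by end_near. Qed.

End DuBoisReymond.

(** * Cancellation of the second-order term *)

Section OscillatoryIntegrals.
Context {R : realType}.
Local Notation mu := (@lebesgue_measure R).
Local Notation C := R[i].
Local Notation Re := complex.Re.
Local Notation Im := complex.Im.
Implicit Types (a H : R -> C) (B c w : R).

Definition cwL1 a B := [/\ cmeas a, intg setT (fun x => wt x ^+ 2 * n1 (a x)) &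
  \int[mu]_x (wt x ^+ 2 * n1 (a x)) <= B].

(** Growth class of a product of two Jost solutions, each of which may grow linearly; it is dual to
    the weight in [cwL1]. *)
Definition wbounded H c := cmeas H /\ forall x, n1 (H x) <= c * wt x ^+ 2.

Definition osc_int a H w : C := cint setT (fun x => a x * H x * cexpi (w * x)).

Lemma wt2_ge1 (x : R) : 1 <= wt x ^+ 2.
Proof. by rewrite exprn_ege1. Qed.

Lemma measurable_wt2 : measurable_fun setT (fun x : R => wt x ^+ 2).
Proof. by apply: measurable_funX; apply: continuous_measurable_fun; exact: continuous_wt. Qed.

Lemma cwL1_ge0 a B : cwL1 a B -> 0 <= B.
Proof.
move=> [_ _]; apply: le_trans; apply: Rintegral_ge0 => x _.
by rewrite mulr_ge0 // sqr_ge0.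
Qed.

Lemma cwL1_le a b B c : cwL1 b B -> cmeas a -> 0 <= c -> (forall x, n1 (a x) <= c * n1 (b x)) ->
  cwL1 a (c * B).
Proof.
move=> [mb Ib Bb] ma c0 ab.
have le x : `|wt x ^+ 2 * n1 (a x)| <= c * (wt x ^+ 2 * n1 (b x)).
  by rewrite ger0_norm ?mulr_ge0 ?sqr_ge0 // mulrCA ler_wpM2l ?sqr_ge0.
have m1 : measurable_fun setT (fun x => wt x ^+ 2 * n1 (a x)).
  by apply: measurable_funM; [exact: measurable_wt2|exact: cmeas_n1].
split=> //; first by apply: (intg_le _ m1 (fun x _ => le x)) => //; exact: intgZ.
apply: (le_trans (ler_norm _)).
apply: (le_trans (Rint_le0 measurableT m1 (fun x _ => le x) (intgZ c measurableT Ib))).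
by rewrite RintegralZl // ler_wpM2l.
Qed.

Lemma cwL1M a B H m : cwL1 a B -> cmeas H -> 0 <= m -> (forall x, n1 (H x) <= m) ->
  cwL1 (fun x => a x * H x) (m * B).
Proof.
move=> wa mH m0 Hm; apply: cwL1_le (wa) _ m0 _; first by apply: cmeasM => //; case: wa.
by move=> x; rewrite (le_trans (n1M _ _)) // mulrC ler_wpM2r.
Qed.

Lemma cwL1D a B b c : cwL1 a B -> cwL1 b c -> cwL1 (fun x => a x + b x) (B + c).
Proof.
move=> [ma Ia Ba] [mb Ib Bb].
have le x : `|wt x ^+ 2 * n1 (a x + b x)| <= wt x ^+ 2 * n1 (a x) + wt x ^+ 2 * n1 (b x).
  by rewrite ger0_norm ?mulr_ge0 ?sqr_ge0 // -mulrDr ler_wpM2l ?sqr_ge0 // n1D.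
have mab := cmeasD ma mb.
have m1 : measurable_fun setT (fun x => wt x ^+ 2 * n1 (a x + b x)).
  by apply: measurable_funM; [exact: measurable_wt2|exact: (cmeas_n1 mab)].
split=> //; first by apply: (intg_le _ m1 (fun x _ => le x)) => //; exact: intgD.
apply: (le_trans (ler_norm _)).
apply: (le_trans (Rint_le0 measurableT m1 (fun x _ => le x) (intgD measurableT Ia Ib))).
by rewrite RintegralD // lerD.
Qed.

Lemma cwL1_ub a B c : cwL1 a B -> B <= c -> cwL1 a c.
Proof. by move=> [ma Ia Ba] Bc; split=> //; exact: le_trans Bc. Qed.

Lemma cwL1_intg a B : cwL1 a B -> cintegrable setT a.
Proof.
move=> [ma Ia _].
have le x : n1 (a x) <= wt x ^+ 2 * n1 (a x) by rewrite ler_peMl // wt2_ge1.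
by have [] := cint_bound measurableT ma Ia (fun x _ => le x).
Qed.

(** One-dimensional Sobolev embedding for the real and imaginary parts. It keeps products of
    coefficients in [cwL1]: one factor is measured in sup norm, the other in the weighted norm. *)
Lemma cwL1_sup a a' B B' x : cwL1 a B -> cwL1 a' B' -> cprim a a' -> n1 (a x) <= 2 * B'.
Proof.
move=> wa wa' [pr pi]; have [Ir Ii] := cwL1_intg wa; have [Ir' Ii'] := cwL1_intg wa'.
have [ma' Ia' Ba'] := wa'.
have le (h : R -> R) : intg setT h -> (forall y, `|h y| <= n1 (a' y)) -> \int[mu]_y `|h y| <= B'.
  move=> Ih hle; apply: le_trans Ba'; apply: le_Rintegral => //; first exact: intg_norm.
  by move=> y _; rewrite (le_trans (hle y)) // ler_peMl // wt2_ge1.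
rewrite mulr_natl mulr2n /n1 lerD //.
  apply: (le_trans (prim_sup x pr Ir Ir')); apply: le => // y; by rewrite lerDl.
apply: (le_trans (prim_sup x pi Ii Ii')); apply: le => // y; by rewrite lerDr.
Qed.

Lemma wbounded_ge0 H c : wbounded H c -> 0 <= c.
Proof.
move=> [_ /(_ 0)] h; have := le_trans (n1_ge0 _) h.
by rewrite pmulr_lge0 // exprn_gt0.
Qed.

Lemma wbounded_ub H c c' : wbounded H c -> c <= c' -> wbounded H c'.
Proof.
move=> [mH Hc] cc; split=> // x; rewrite (le_trans (Hc x)) // ler_wpM2r //.
exact: sqr_ge0.
Qed.

Lemma osc_int_bound a B H c w : cwL1 a B -> wbounded H c ->
  cintegrable setT (fun x => a x * H x * cexpi (w * x)) /\ n1 (osc_int a H w) <= 4 * (B * c).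
Proof.
move=> wa hH; have c0 := wbounded_ge0 hH; have [ma Ia Ba] := wa; have [mH Hc] := hH.
have m1 : cmeas (fun x => a x * H x * cexpi (w * x)).
  by apply: cmeasM; [exact: cmeasM|exact: cmeas_cexpi].
have le x : n1 (a x * H x * cexpi (w * x)) <= 2 * c * (wt x ^+ 2 * n1 (a x)).
  rewrite (le_trans (n1M _ _)) // (le_trans (ler_pM _ _ (n1M _ _) (n1_cexpi _))) //.
  have := ler_wpM2l (n1_ge0 (a x)) (Hc x); lra.
have [h1 h2] := cint_bound measurableT m1 (intgZ (2 * c) measurableT Ia) (fun x _ => le x).
split=> //; apply: (le_trans h2); rewrite RintegralZl //.
have := ler_wpM2l c0 Ba; lra.
Qed.

(** a H exp(iwx) and its derivative are integrable, so the integral of the derivative is 0 by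
    [prim_int0]. The factor [Complex 0 w^-1] is - 1 / (iw). *)
Lemma osc_int_ibp a a' B B' H H' c c' w : cwL1 a B -> cwL1 a' B' -> wbounded H c -> wbounded H' c' ->
  cprim a a' -> cprim H H' -> w != 0 ->
  osc_int a H w = Complex 0 w^-1 * (osc_int a' H w + osc_int a H' w).
Proof.
move=> wa wa' hH hH' pa pH w0.
have [I1 _] := osc_int_bound w wa hH; have [I2 _] := osc_int_bound w wa' hH.
have [I3 _] := osc_int_bound w wa hH'.
have [I4 E4] := cintD measurableT I2 I3.
have [I5 E5] := cintZ (Complex 0 w) measurableT I1.
have [I6 E6] := cintD measurableT I4 I5.
have p : cprim (fun x => a x * H x * cexpi (w * x))
   (fun x => a' x * H x * cexpi (w * x) + a x * H' x * cexpi (w * x) +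
     Complex 0 w * (a x * H x * cexpi (w * x))).
  by apply: eq_cprim (cprimM (cprimM pa pH) (cprim_cexpi w)) => x //; ring.
have Z : cint setT (fun x => a' x * H x * cexpi (w * x) + a x * H' x * cexpi (w * x) +
     Complex 0 w * (a x * H x * cexpi (w * x))) = 0.
  by rewrite /cint (prim_int0 p.1 I1.1 I6.1) (prim_int0 p.2 I1.2 I6.2).
move: Z; rewrite E6 E5 E4 -!/(osc_int _ _ w) => /eqP; rewrite addr_eq0 => /eqP ->.
rewrite mulrN mulrA (_ : Complex 0 w^-1 * Complex 0 w = -1) ?mulN1r ?opprK //.
by apply: complex_ext; rewrite ?cReM ?cImM /= ?mulVf // ?mul0r ?mulr0 ?addr0 ?sub0r ?oppr0.
Qed.

Lemma n1_iV (w d : R) (z : C) : 0 < d -> d^-1 <= `|w| -> n1 (Complex 0 w^-1 * z) <= d * n1 z.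
Proof.
move=> d0 dw; rewrite (le_trans (n1M _ _)) // ler_wpM2r // /n1 /= normr0 add0r normfV.
by rewrite -[leRHS]invrK lef_pV2 // posrE ?invr_gt0 // (lt_le_trans _ dw) // invr_gt0.
Qed.

Lemma osc_int_small a a' B B' H H' c w d : cwL1 a B -> cwL1 a' B' -> wbounded H c -> wbounded H' c ->
  cprim a a' -> cprim H H' -> 0 < d -> d^-1 <= `|w| ->
  n1 (osc_int a H w) <= d * (4 * ((B + B') * c)).
Proof.
move=> wa wa' hH hH' pa pH d0 dw.
have w0 : w != 0 by rewrite -normr_gt0 (lt_le_trans _ dw) // invr_gt0.
rewrite (osc_int_ibp wa wa' hH hH' pa pH w0) (le_trans (n1_iV _ d0 dw)) // (ler_wpM2l (ltW d0)) //.
have [_ b1] := osc_int_bound w wa' hH; have [_ b2] := osc_int_bound w wa hH'.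
apply: (le_trans (n1D _ _)); lra.
Qed.

End OscillatoryIntegrals.

Section HasIntegral.
Context {R : realType}.
Local Notation C := R[i].
Implicit Types (a b : R -> C) (z : C).

(** Integrability and value travel together, so that long sums of oscillatory integrals are
    assembled without separate side conditions. *)
Definition has_cint a z := cintegrable setT a /\ cint setT a = z.

Lemma has_cintD a b z w : has_cint a z -> has_cint b w -> has_cint (fun x => a x + b x) (z + w).
Proof. by move=> [Ia <-] [Ib <-]; exact: cintD. Qed.
Lemma has_cintB a b z w : has_cint a z -> has_cint b w -> has_cint (fun x => a x - b x) (z - w).
Proof. by move=> [Ia <-] [Ib <-]; exact: cintB. Qed.
Lemma has_cintZ c a z : has_cint a z -> has_cint (fun x => c * a x) (c * z).
Proof. by move=> [Ia <-]; exact: cintZ. Qed.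
Lemma has_cint_sum (I : Type) (s : seq I) (P : pred I) (a : I -> R -> C) (z : I -> C) :
  (forall i, has_cint (a i) (z i)) ->
  has_cint (fun x => \sum_(i <- s | P i) a i x) (\sum_(i <- s | P i) z i).
Proof.
move=> H; have [I1 E] := cint_sum s P measurableT (fun i => (H i).1).
by split=> //; rewrite E; apply: eq_bigr => i _; case: (H i).
Qed.

Lemma cexpiD (x y : R) : cexpi (x + y) = cexpi x * cexpi y.
Proof.
apply: complex_ext; rewrite ?cReM ?cImM /= ?cosD ?sinD //; ring.
Qed.

Lemma cexpi0 : cexpi 0 = 1 :> C.
Proof. by rewrite /cexpi cos0 sin0. Qed.

End HasIntegral.

(** * The cancellation for finitely many modes *)

Section CoreEstimate.
Context {R : realType} (I : finType) (inv : I -> I).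
Local Notation C := R[i].
Local Notation Re := complex.Re.
Local Notation Im := complex.Im.
Context (Q0 Q1 Q2 Q3 : I -> R -> C) (om b : I -> R) (V0 V1 f f1 g g1 : R -> C) (kap : C)
  (A S K d : R).
Context
  (pQ0 : forall i, cprim (Q0 i) (Q1 i)) (pQ1 : forall i, cprim (Q1 i) (Q2 i))
  (pQ2 : forall i, cprim (Q2 i) (Q3 i))
  (wQ0 : forall i, cwL1 (Q0 i) (b i)) (wQ1 : forall i, cwL1 (Q1 i) (b i))
  (wQ2 : forall i, cwL1 (Q2 i) (b i)) (wQ3 : forall i, cwL1 (Q3 i) (b i))
  (bS : \sum_i b i <= S) (pV : cprim V0 V1) (wV0 : cwL1 V0 A) (wV1 : cwL1 V1 A)
  (d0 : 0 < d) (d1 : d <= 1) (omN : forall i, om (inv i) = - om i)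
  (omd : forall i, d^-1 <= `|om i|)
  (omgap : forall i l, l != inv i -> d^-1 <= `|om i + om l|)
  (n1kap : n1 kap <= 1).

(** In the application [inv] is j -> -j, d = eps / theta and [kap] = k^2; these are then the
    truncated q_av + sigma and q_av + q_eps. Writing |q_j|^2 as q_j q_{-j} keeps the whole
    computation free of conjugates. *)
Let U1 x := V0 x - \sum_i ((om i ^+ 2)^-1)%:C%C * (Q0 i x * Q0 (inv i) x).
Let U2 x := V0 x + \sum_i Q0 i x * cexpi (om i * x).

Context
  (pf : cprim f f1) (pf1 : cprim f1 (fun x => (U1 x - kap) * f x))
  (pg : cprim g g1) (pg1 : cprim g1 (fun x => (U2 x - kap) * g x))
  (bf : forall x, n1 (f x) <= K * wt x) (bf1 : forall x, n1 (f1 x) <= K * wt x)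
  (bg : forall x, n1 (g x) <= K * wt x) (bg1 : forall x, n1 (g1 x) <= K * wt x).

(** Common sup bound of the two potentials: 2A from V0, 4S from the oscillating sum in [U2], 4S^2
    from the quadratic sum in [U1]. *)
Let M : R := 2 * A + 4 * S + 4 * S ^+ 2.
(** One constant for all the amplitudes below. The worst is [H2], with two terms of size (M + 1) K^2
    and two of size K^2. *)
Definition core_const : R := (2 * (2 * A + 4 * S + 4 * S ^+ 2) + 4) * K ^+ 2.

(** [H1] and [H2] are the first and second derivatives of f g. The equations remove f'' and g'' but
    not the term 2 f' g' of [H2], so [P] = f' g' is carried along with its derivative [P1]. *)
Let H x := f x * g x.
Let H1 x := f1 x * g x + f x * g1 x.
Let P x := f1 x * g1 x.
Let H2 x := (U1 x - kap) * f x * g x + f1 x * g1 x + (f1 x * g1 x + f x * ((U2 x - kap) * g x)).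
Let P1 x := (U1 x - kap) * f x * g1 x + f1 x * ((U2 x - kap) * g x).

Let pH : cprim H H1. Proof. exact: cprimM. Qed.
Let pH1 : cprim H1 H2. Proof. by apply: cprimD; exact: cprimM. Qed.
Let pP : cprim P P1. Proof. exact: cprimM. Qed.

Let b0 i : 0 <= b i. Proof. exact: cwL1_ge0 (wQ0 i). Qed.
Let bi_le i : b i <= S.
Proof. by apply: le_trans bS; rewrite (bigD1 i) //= lerDl sumr_ge0. Qed.
Let S0 : 0 <= S. Proof. by apply: le_trans bS; rewrite sumr_ge0. Qed.
Let A0 : 0 <= A. Proof. exact: cwL1_ge0 wV0. Qed.
Let K0 : 0 <= K.
Proof. by have := le_trans (n1_ge0 _) (bf 0); rewrite pmulr_lge0. Qed.
Let M0 : 0 <= M.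
Proof. by rewrite /M !addr_ge0 // mulr_ge0 // exprn_ge0. Qed.
Let Q0s i x : n1 (Q0 i x) <= 2 * b i. Proof. exact: cwL1_sup (wQ0 i) (wQ1 i) (pQ0 i). Qed.
Let V0s x : n1 (V0 x) <= 2 * A. Proof. exact: cwL1_sup wV0 wV1 pV. Qed.
Let mQ0 i : cmeas (Q0 i). Proof. by case: (wQ0 i). Qed.

Let om2 i : 0 <= (om i ^+ 2)^-1 <= d ^+ 2.
Proof.
rewrite invr_ge0 sqr_ge0 /= -[leRHS]invrK lef_pV2 ?posrE ?invr_gt0 ?(exprn_gt0 _ d0) //.
  by rewrite -exprVn -(real_normK (num_real (om i))) lerXn2r ?nnegrE ?invr_ge0 ?(ltW d0).
by rewrite -(real_normK (num_real (om i))) exprn_gt0 // (lt_le_trans _ (omd i)) // invr_gt0.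
Qed.

Let d21 : d ^+ 2 <= 1. Proof. by rewrite exprn_ile1 // ltW. Qed.

Let U1s x : n1 (U1 x) <= M.
Proof.
apply: (le_trans (n1B _ _)); rewrite /M -(addrA (2 * A)); apply: lerD; first exact: V0s.
apply: (le_trans (n1_sum _ _ _)).
apply: (@le_trans _ _ (\sum_i 4 * S * b i)).
  apply: ler_sum => i _; rewrite n1Mr; have /andP[w1 w2] := om2 i.
  rewrite ger0_norm //; apply: (@le_trans _ _ (1 * (2 * b i * (2 * S)))).
    apply: ler_pM => //; first exact: le_trans d21.
    rewrite (le_trans (n1M _ _)) // ler_pM //.
    by rewrite (le_trans (Q0s _ _)) // ler_wpM2l.
  by apply: eq_ler; ring.
rewrite -mulr_sumr; have := ler_wpM2l S0 bS; have := S0; rewrite expr2; lra.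
Qed.

Let U2s x : n1 (U2 x) <= M.
Proof.
apply: (le_trans (n1D _ _)); rewrite /M -(addrA (2 * A)); apply: lerD; first exact: V0s.
apply: (le_trans (n1_sum _ _ _)).
apply: (@le_trans _ _ (\sum_i 4 * b i)).
  apply: ler_sum => i _; rewrite (le_trans (n1M _ _)) //.
  have := ler_pM (n1_ge0 _) (n1_ge0 _) (Q0s i x) (n1_cexpi (om i * x)); lra.
rewrite -mulr_sumr; have := bS; have := S0; nra.
Qed.

Let hbM (u v : R -> C) (p q : R) : cmeas u -> cmeas v -> 0 <= p -> 0 <= q ->
  (forall x, n1 (u x) <= p * wt x) -> (forall x, n1 (v x) <= q * wt x) ->
  wbounded (fun x => u x * v x) (p * q).
Proof.
move=> mu_ mv p0 q0 up vq; split=> [|x]; first exact: cmeasM.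
rewrite (le_trans (n1M _ _)) // (le_trans (ler_pM _ _ (up x) (vq x))) //.
by apply: eq_ler; ring.
Qed.

Let hbD (u v : R -> C) (p q : R) : wbounded u p -> wbounded v q ->
    wbounded (fun x => u x + v x) (p + q).
Proof.
move=> [mu_ up] [mv vq]; split=> [|x]; first exact: cmeasD.
by rewrite (le_trans (n1D _ _)) // mulrDl lerD.
Qed.

Let mf : cmeas f. Proof. by have [] := cprim_meas pf. Qed.
Let mf1 : cmeas f1. Proof. by have [] := cprim_meas pf. Qed.
Let mg : cmeas g. Proof. by have [] := cprim_meas pg. Qed.
Let mg1 : cmeas g1. Proof. by have [] := cprim_meas pg. Qed.
Let mUf : cmeas (fun x => (U1 x - kap) * f x). Proof. by have [] := cprim_meas pf1. Qed.
Let mUg : cmeas (fun x => (U2 x - kap) * g x). Proof. by have [] := cprim_meas pg1. Qed.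

Let Mk0 : 0 <= (M + 1) * K. Proof. by rewrite mulr_ge0 // addr_ge0. Qed.

Let bUf x : n1 ((U1 x - kap) * f x) <= (M + 1) * K * wt x.
Proof.
rewrite (le_trans (n1M _ _)) // -mulrA ler_pM //.
by rewrite (le_trans (n1B _ _)) // lerD // U1s.
Qed.
Let bUg x : n1 ((U2 x - kap) * g x) <= (M + 1) * K * wt x.
Proof.
rewrite (le_trans (n1M _ _)) // -mulrA ler_pM //.
by rewrite (le_trans (n1B _ _)) // lerD // U2s.
Qed.

Let K2 : 0 <= K ^+ 2. Proof. exact: sqr_ge0. Qed.
Let MK2 : 0 <= M * K ^+ 2. Proof. exact: mulr_ge0. Qed.

Let hbH : wbounded H core_const.
Proof.
apply: wbounded_ub (hbM mf mg K0 K0 bf bg) _.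
by have := K2; have := MK2; rewrite /core_const -/M; lra.
Qed.
Let hbP : wbounded P core_const.
Proof.
apply: wbounded_ub (hbM mf1 mg1 K0 K0 bf1 bg1) _.
by have := K2; have := MK2; rewrite /core_const -/M; lra.
Qed.
Let hbH1 : wbounded H1 core_const.
Proof.
apply: wbounded_ub (hbD (hbM mf1 mg K0 K0 bf1 bg) (hbM mf mg1 K0 K0 bf bg1)) _.
by have := K2; have := MK2; rewrite /core_const -/M; lra.
Qed.
Let hbP1 : wbounded P1 core_const.
Proof.
apply: wbounded_ub (hbD (hbM mUf mg1 Mk0 K0 bUf bg1) (hbM mf1 mUg K0 Mk0 bf1 bUg)) _.
by have := K2; have := MK2; rewrite /core_const -/M; lra.
Qed.
Let hbH2 : wbounded H2 core_const.
Proof.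
apply: wbounded_ub (hbD (hbD (hbM mUf mg Mk0 K0 bUf bg) (hbM mf1 mg1 K0 K0 bf1 bg1))
  (hbD (hbM mf1 mg1 K0 K0 bf1 bg1) (hbM mf mUg K0 Mk0 bf bUg))) _.
by have := K2; have := MK2; rewrite /core_const -/M; lra.
Qed.

Let QQ i l x := Q0 i x * Q0 l x.
Let wQQ i l : cwL1 (QQ i l) (2 * b l * b i).
Proof. by apply: cwL1M => //; rewrite mulr_ge0. Qed.

Let has_cint_osc_int (a h : R -> C) (B c w : R) : cwL1 a B -> wbounded h c ->
  has_cint (fun x => a x * h x * cexpi (w * x)) (osc_int a h w).
Proof. by move=> wa hh; have [] := osc_int_bound w wa hh. Qed.

(** What two integrations by parts leave at the single frequency om i: Q'' H + 2 Q' H' and the part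
    of Q H'' without the modes of [U2]. Those modes shift the frequency to om i + om l and are
    collected in [J]. *)
Let N i := osc_int (Q2 i) H (om i) + osc_int (Q1 i) H1 (om i) + osc_int (Q1 i) H1 (om i)
  + (2 * osc_int (fun x => Q0 i x * V0 x) H (om i) - 2 * kap * osc_int (Q0 i) H (om i)
     + 2 * osc_int (Q0 i) P (om i)
     - \sum_l ((om l ^+ 2)^-1)%:C%C * osc_int (fun x => Q0 i x * QQ l (inv l) x) H (om i)).
Let J i l := osc_int (QQ i l) H (om i + om l).

Let wQV i : cwL1 (fun x => Q0 i x * V0 x) (2 * A * b i).
Proof. by apply: cwL1M => //; [case: wV0|rewrite mulr_ge0]. Qed.

Let QQs l x : n1 (QQ l (inv l) x) <= 2 * b l * (2 * S).
Proof.
rewrite (le_trans (n1M _ _)) // ler_pM //.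
by rewrite (le_trans (Q0s _ _)) // ler_wpM2l.
Qed.

Let wQQQ i l : cwL1 (fun x => Q0 i x * QQ l (inv l) x) (2 * b l * (2 * S) * b i).
Proof. by apply: cwL1M; [exact: wQ0|exact: cmeasM|rewrite !mulr_ge0|exact: QQs]. Qed.

Let osc_int_QH2 i : osc_int (Q0 i) H2 (om i) =
  (2 * osc_int (fun x => Q0 i x * V0 x) H (om i) - 2 * kap * osc_int (Q0 i) H (om i)
     + 2 * osc_int (Q0 i) P (om i)
     - \sum_l ((om l ^+ 2)^-1)%:C%C * osc_int (fun x => Q0 i x * QQ l (inv l) x) H (om i))
  + \sum_l J i l.
Proof.
have h1 := has_cintZ 2 (has_cint_osc_int (om i) (wQV i) hbH).
have h2 := has_cintZ (2 * kap) (has_cint_osc_int (om i) (wQ0 i) hbH).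
have h3 := has_cintZ 2 (has_cint_osc_int (om i) (wQ0 i) hbP).
have h4 := has_cint_sum (index_enum I) xpredT
  (fun l => has_cintZ ((om l ^+ 2)^-1)%:C%C (has_cint_osc_int (om i) (wQQQ i l) hbH)).
have h5 := has_cint_sum (index_enum I) xpredT (fun l => has_cint_osc_int (om i + om l) (wQQ i l) hbH).
have [_ <-] := has_cintD (has_cintB (has_cintD (has_cintB h1 h2) h3) h4) h5.
rewrite /osc_int; congr cint; apply/funext => x.
rewrite /H2 /U1 /U2 /H /P /QQ.
have -> : \sum_l Q0 i x * Q0 l x * (f x * g x) * cexpi ((om i + om l) * x) =
   Q0 i x * (f x * g x) * cexpi (om i * x) * \sum_l Q0 l x * cexpi (om l * x).
  by rewrite mulr_sumr; apply: eq_bigr => l _; rewrite mulrDl cexpiD; ring.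
have -> : \sum_l ((om l ^+ 2)^-1)%:C%C * (Q0 i x * (Q0 l x * Q0 (inv l) x) * (f x * g x) * cexpi (om i * x)) =
   Q0 i x * (f x * g x) * cexpi (om i * x) * \sum_l ((om l ^+ 2)^-1)%:C%C * (Q0 l x * Q0 (inv l) x).
  by rewrite mulr_sumr; apply: eq_bigr => l _; ring.
ring.
Qed.

Let om_neq0 i : om i != 0.
Proof. by rewrite -normr_gt0 (lt_le_trans _ (omd i)) // invr_gt0. Qed.

Let osc_int_Q i : osc_int (Q0 i) H (om i) = - ((om i ^+ 2)^-1)%:C%C * (N i + \sum_l J i l).
Proof.
rewrite (osc_int_ibp (wQ0 i) (wQ1 i) hbH hbH1 (pQ0 i) pH (om_neq0 i)).
rewrite (osc_int_ibp (wQ1 i) (wQ2 i) hbH hbH1 (pQ1 i) pH (om_neq0 i)).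
rewrite (osc_int_ibp (wQ0 i) (wQ1 i) hbH1 hbH2 (pQ0 i) pH1 (om_neq0 i)).
rewrite osc_int_QH2 -mulrDr mulrA.
have -> : Complex 0 (om i)^-1 * Complex 0 (om i)^-1 = - ((om i ^+ 2)^-1)%:C%C.
  by apply: complex_ext; rewrite ?cReM ?cImM ?cReN ?cImN /=
      ?mul0r ?mulr0 ?addr0 ?sub0r ?oppr0 // expr2 invfM.
congr (_ * _); rewrite /N; ring.
Qed.

(** [J i (inv i)] has frequency 0, and its coefficient - om i^-2 is the opposite of the one
    contributed by the quadratic sum in [U1]; only the off-resonant l survive. *)
Let total : cint setT (fun x => (U2 x - U1 x) * (f x * g x)) =
  - \sum_i ((om i ^+ 2)^-1)%:C%C * (N i + \sum_(l | l != inv i) J i l).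
Proof.
have h1 := has_cint_sum (index_enum I) xpredT (fun l => has_cint_osc_int (om l) (wQ0 l) hbH).
have h2 := has_cint_sum (index_enum I) xpredT
  (fun l => has_cintZ ((om l ^+ 2)^-1)%:C%C (has_cint_osc_int 0 (wQQ l (inv l)) hbH)).
have -> : (fun x => (U2 x - U1 x) * (f x * g x)) =
   (fun x => \sum_l Q0 l x * H x * cexpi (om l * x) +
     \sum_l ((om l ^+ 2)^-1)%:C%C * (QQ l (inv l) x * H x * cexpi (0 * x))).
  apply/funext => x; rewrite /U2 /U1.
  set s2 := \sum_i _ * cexpi _; set s1 := \sum_i _.
  have -> : (V0 x + s2 - (V0 x - s1)) * (f x * g x) = s2 * (f x * g x) + s1 * (f x * g x) by ring.
  by rewrite !mulr_suml; congr (_ + _); apply: eq_bigr => l _;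
    rewrite /QQ /H ?mul0r ?cexpi0; ring.
have [_ ->] := has_cintD h1 h2.
rewrite -big_split /= -sumrN; apply: eq_bigr => i _.
rewrite osc_int_Q [\sum_l J i l](bigD1 (inv i)) //= {1}/J omN subrr; ring.
Qed.

Let n1_2 : n1 (2 : C) = 2.
Proof. by rewrite -[2]/(2%:R) -(rmorph_nat (real_complex R)) n1_real ger0_norm. Qed.

Let c0 : 0 <= core_const. Proof. exact: wbounded_ge0 hbH. Qed.

Let x0 i : 0 <= d * b i * core_const.
Proof. exact: mulr_ge0 (mulr_ge0 (ltW d0) (b0 i)) c0. Qed.

(** In units of x = d b_i core_const, 56 is 8 for Q'' H, 16 for 2 Q' H', and 16 for each of the
    terms with kap and f' g'; 48 A is twice the bound 24 A for Q V0 H. *)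
Let N_le i : n1 (N i) <= d * b i * core_const * (56 + 48 * A + 16 * S ^+ 2).
Proof.
have t1 := osc_int_small (wQ2 i) (wQ3 i) hbH hbH1 (pQ2 i) pH d0 (omd i).
have hbH1' := hbH1.
have t2 := osc_int_small (wQ1 i) (wQ2 i) hbH1 hbH2 (pQ1 i) pH1 d0 (omd i).
have wQV1 : cwL1 (fun x => Q1 i x * V0 x + Q0 i x * V1 x) (2 * A * b i + 2 * b i * A).
  apply: cwL1D; first by apply: cwL1M; [exact: wQ1|case: wV0|rewrite mulr_ge0|exact: V0s].
  rewrite (_ : (fun x => Q0 i x * V1 x) = fun x => V1 x * Q0 i x).
    by apply: cwL1M => //; rewrite mulr_ge0.
  by apply/funext => x; rewrite mulrC.
have t3 := osc_int_small (wQV i) wQV1 hbH hbH1 (cprimM (pQ0 i) pV) pH d0 (omd i).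
have t4 := osc_int_small (wQ0 i) (wQ1 i) hbH hbH1 (pQ0 i) pH d0 (omd i).
have t5 := osc_int_small (wQ0 i) (wQ1 i) hbP hbP1 (pQ0 i) pP d0 (omd i).
(* No third integration by parts is made here: om_l^-2 <= d^2 <= d already supplies the missing
   power of d. *)
have t6 : n1 (\sum_l ((om l ^+ 2)^-1)%:C%C * osc_int (fun x => Q0 i x * QQ l (inv l) x) H (om i))
    <= d * b i * core_const * (16 * S ^+ 2).
  apply: (le_trans (n1_sum _ _ _)).
  apply: (@le_trans _ _ (\sum_l d * b i * core_const * 16 * S * b l)).
    apply: ler_sum => l _; rewrite n1Mr; have /andP[w1 w2] := om2 l.
    rewrite ger0_norm //.
    apply: (@le_trans _ _ (d * (4 * (2 * b l * (2 * S) * b i * core_const)))).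
      apply: ler_pM => //; last by have [] := osc_int_bound (om i) (wQQQ i l) hbH.
      by rewrite (le_trans w2) // expr2 ler_piMr // ltW.
    by apply: eq_ler; ring.
  rewrite -mulr_sumr (_ : d * b i * core_const * (16 * S ^+ 2) =
      d * b i * core_const * 16 * S * S); last by ring.
  by apply: ler_wpM2l bS; exact: mulr_ge0 (mulr_ge0 (x0 i) _) S0.
rewrite /N.
set s6 := \sum_l _ in t6 *.
set o1 := osc_int (Q2 i) _ _ in t1 *; set o2 := osc_int (Q1 i) _ _ in t2 *.
set o3 := osc_int _ _ _ in t3 *; set o4 := osc_int (Q0 i) H _ in t4 *;
    set o5 := osc_int (Q0 i) P _ in t5 *.
have k1 : n1 (2 * o3) <= 2 * n1 o3 by rewrite (le_trans (n1M _ _)) // n1_2.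
have k2 : n1 (2 * kap * o4) <= 2 * n1 o4.
  rewrite (le_trans (n1M _ _)) // ler_wpM2r // (le_trans (n1M _ _)) // n1_2.
  by have := n1kap; lra.
have k3 : n1 (2 * o5) <= 2 * n1 o5 by rewrite (le_trans (n1M _ _)) // n1_2.
have := n1D (o1 + o2 + o2) (2 * o3 - 2 * kap * o4 + 2 * o5 - s6).
have := n1D (o1 + o2) o2; have := n1D o1 o2.
have := n1B (2 * o3 - 2 * kap * o4 + 2 * o5) s6.
have := n1D (2 * o3 - 2 * kap * o4) (2 * o5).
have := n1B (2 * o3) (2 * kap * o4).
move: t1 t2 t3 t4 t5 t6 k1 k2 k3.
set x := d * b i * core_const.
have -> : d * (4 * ((b i + b i) * core_const)) = 8 * x by rewrite /x; ring.
have -> : d * (4 * ((2 * A * b i + (2 * A * b i + 2 * b i * A)) * core_const)) = 24 * (x * A).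
  by rewrite /x; ring.
have -> : x * (56 + 48 * A + 16 * S ^+ 2) = 56 * x + 48 * (x * A) + x * (16 * S ^+ 2) by ring.
lra.
Qed.

(** The product Q_i Q_l has norm 2 b_i b_l and its derivative 4 b_i b_l, hence 24 = 4 (2 + 4). *)
Let J_le i l : l != inv i -> n1 (J i l) <= d * b i * core_const * 24 * b l.
Proof.
move=> li.
have w1 : cwL1 (fun x => Q1 i x * Q0 l x + Q0 i x * Q1 l x) (2 * b l * b i + 2 * b i * b l).
  apply: cwL1D; first by apply: cwL1M => //; rewrite mulr_ge0.
  rewrite (_ : (fun x => Q0 i x * Q1 l x) = fun x => Q1 l x * Q0 i x).
    by apply: cwL1M => //; rewrite mulr_ge0.
  by apply/funext => x; rewrite mulrC.
have := osc_int_small (wQQ i l) w1 hbH hbH1 (cprimM (pQ0 i) (pQ0 l)) pH d0 (omgap li).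
by move/le_trans; apply; apply: eq_ler; ring.
Qed.

(** d^2 comes from om_i^-2, the third d from the remaining oscillation. Each summation over modes
    costs only S, so the bound does not see the number of modes. *)
Lemma core_estimate :
  n1 (cint setT (fun x => (U2 x - U1 x) * (f x * g x))) <=
  d ^+ 3 * (S * core_const * (56 + 48 * A + 24 * S + 16 * S ^+ 2)).
Proof.
rewrite total n1N (le_trans (n1_sum _ _ _)) //.
set T := 56 + _ + _ + _.
have T0 : 0 <= T by rewrite !addr_ge0 // mulr_ge0 // exprn_ge0.
apply: (@le_trans _ _ (\sum_i d ^+ 3 * core_const * T * b i)); last first.
  rewrite -mulr_sumr [leRHS](_ : _ = d ^+ 3 * core_const * T * S); last by ring.
  by apply: ler_wpM2l bS; exact: mulr_ge0 (mulr_ge0 (exprn_ge0 _ (ltW d0)) c0) T0.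
apply: ler_sum => i _; rewrite n1Mr; have /andP[w1 w2] := om2 i; rewrite ger0_norm //.
rewrite [leRHS](_ : _ = d ^+ 2 * (d * b i * core_const * T)); last by ring.
apply: ler_pM => //; rewrite (le_trans (n1D _ _)) //.
have : n1 (\sum_(l | l != inv i) J i l) <= d * b i * core_const * 24 * S.
  rewrite (le_trans (n1_sum _ _ _)) //.
  apply: (@le_trans _ _ (\sum_(l | l != inv i) d * b i * core_const * 24 * b l)).
    by apply: ler_sum => l; exact: J_le.
  rewrite -mulr_sumr; apply: ler_wpM2l; first exact: mulr_ge0 (x0 i) _.
  apply: le_trans bS; by rewrite [leRHS](bigD1 (inv i)) //= lerDr.
have := N_le i; rewrite /T; set x := d * b i * core_const.
rewrite (_ : x * (56 + 48 * A + 24 * S + 16 * S ^+ 2) =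
   x * (56 + 48 * A + 16 * S ^+ 2) + x * 24 * S); last by ring.
by move=> h1 h2; rewrite lerD.
Qed.

End CoreEstimate.

(** * Regular representatives of the coefficients *)

Section SobolevRepresentatives.
Context {R : realType}.
Local Notation mu := (@lebesgue_measure R).
Local Notation C := R[i].
Local Notation Re := complex.Re.
Local Notation Im := complex.Im.
Implicit Types (g h : R -> C).

Lemma cprim_ae g h (k : R -> C) : cprim g h -> cmeas k ->
  {ae mu, forall x, h x = k x} -> cprim g k.
Proof.
move=> [a b] [c d] hk; split.
  by apply: prim_ae a c _; apply: ae_mono hk => x ->.
by apply: prim_ae b d _; apply: ae_mono hk => x ->.
Qed.

Lemma weak_derivative_cprim g h : weak_derivative g h ->
  exists2 G, cprim G h & {ae mu, forall x, g x = G x}.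
Proof.
move=> [[gr gi] [hr hi] H].
have [|Gr pr er] := weak_derivative_prim gr hr.
  move=> phi /H /(congr1 (@complex.Re R)); rewrite cReN /=.
  under eq_Rintegral do rewrite cReM /= mulr0 subr0.
  by under [in X in _ = - X -> _]eq_Rintegral do rewrite cReM /= mulr0 subr0.
have [|Gi pi ei] := weak_derivative_prim gi hi.
  move=> phi /H /(congr1 (@complex.Im R)); rewrite cImN /=.
  under eq_Rintegral do rewrite cImM /= mulr0 add0r.
  by under [in X in _ = - X -> _]eq_Rintegral do rewrite cImM /= mulr0 add0r.
exists (fun x => Complex (Gr x) (Gi x)); first by split.
by apply: ae_and er ei => x h1 h2; apply: complex_ext.
Qed.

Lemma clocally_meas g : clocally_integrable g -> cmeas g.
Proof. by move=> [[a _ _] [b _ _]]. Qed.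

Lemma cmeas_cmod g : cmeas g -> measurable_fun setT (fun x => cmod (g x)).
Proof.
move=> [a b]; rewrite (_ : (fun x => _) = Num.sqrt \o (fun x => Re (g x) ^+ 2 + Im (g x) ^+ 2)).
  apply: measurableT_comp; first exact: continuous_measurable_fun (@sqrt_continuous R).
  by apply: measurable_funD; apply: measurable_funX.
by apply/funext => x; rewrite /= cmodE.
Qed.

Lemma cwL1_L1_norm gam g (B : R) : cmeas g -> (2 <= gam)%N -> (L1_norm gam g <= B%:E)%E ->
  cwL1 g (2 * B).
Proof.
move=> mg gam2 gB.
have mw : measurable_fun setT (fun x : R => wt x ^+ gam).
  by apply: measurable_funX; apply: continuous_measurable_fun; exact: continuous_wt.
have m1 : measurable_fun setT (fun x => cmod (g x) * wt x ^+ gam).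
  by apply: measurable_funM => //; exact: cmeas_cmod.
have g0 x : 0 <= cmod (g x) * wt x ^+ gam by rewrite mulr_ge0 ?exprn_ge0 // cmod_ge0.
have I1 : intg setT (fun x => cmod (g x) * wt x ^+ gam).
  apply/integrableP; split; first exact/measurable_EFinP.
  rewrite (le_lt_trans _ (ltry B)) // (le_trans _ gB) // le_eqVlt; apply/orP; left; apply/eqP.
  by apply: eq_integral => x _ /=; rewrite ger0_norm.
have E1 : \int[mu]_x (cmod (g x) * wt x ^+ gam) <= B.
  rewrite -lee_fin /Rintegral fineK; first exact: gB.
  exact: (integrable_fin_num measurableT I1).
have le x : `|wt x ^+ 2 * n1 (g x)| <= 2 * (cmod (g x) * wt x ^+ gam).
  rewrite ger0_norm ?mulr_ge0 ?sqr_ge0 // mulrA mulrC ler_pM ?sqr_ge0 ?n1_le_cmod //.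
  by rewrite ler_weXn2l.
have m2 : measurable_fun setT (fun x => wt x ^+ 2 * n1 (g x)).
  by apply: measurable_funM; [exact: measurable_wt2|exact: cmeas_n1].
have I2 := intgZ 2 measurableT I1.
split=> //; first exact: intg_le (fun x _ => le x) I2.
apply: (le_trans (ler_norm _)); apply: (le_trans (Rint_le0 measurableT m2 (fun x _ => le x) I2)).
by rewrite RintegralZl // ler_wpM2l.
Qed.

Lemma cwL1_ae a b (B : R) : cwL1 a B -> cmeas b -> {ae mu, forall x, a x = b x} -> cwL1 b B.
Proof.
move=> [ma Ia Ba] mb ab.
have m (u : R -> C) : cmeas u -> measurable_fun setT (fun x => wt x ^+ 2 * n1 (u x)).
  by move=> mu_; apply: measurable_funM; [exact: measurable_wt2|exact: cmeas_n1].
have e : {ae mu, forall x, setT x -> wt x ^+ 2 * n1 (a x) = wt x ^+ 2 * n1 (b x)}.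
  by apply: ae_mono ab => x ->.
split=> //; first exact: intg_ae (m b mb) e Ia.
by rewrite -(Rint_ae measurableT (m a ma) (m b mb) e).
Qed.

Lemma L1_norm_ge0 gam g : (0 <= L1_norm gam g)%E.
Proof.
by apply: integral_ge0 => x _; rewrite lee_fin mulr_ge0 ?cmod_ge0 ?exprn_ge0 // addr_ge0.
Qed.

Lemma W1_norm_ge0 n gam g : (0 <= W1_norm n gam g)%E.
Proof.
apply: le_ereal_inf_tmp => _ [h _ <-].
by apply: sume_ge0 => l _; exact: L1_norm_ge0.
Qed.

Lemma L1_norm_le_W1 n gam g : (L1_norm gam g <= W1_norm n gam g)%E.
Proof.
apply: le_ereal_inf_tmp => _ [h [h0 _] <-].
rewrite big_ord_recl /= h0 leeDl //.
by apply: sume_ge0 => l _; exact: L1_norm_ge0.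
Qed.

Lemma W1_norm_meas n gam g : (0 < n)%N -> (W1_norm n gam g < +oo)%E -> cmeas g.
Proof.
move=> n0 /ereal_inf_lt [_ [h [h0 hw] _] _].
by have [lg _ _] := hw 0%N n0; rewrite -h0; exact: clocally_meas.
Qed.

(** [W1_norm] is an infimum, so a chain of weak derivatives is chosen up to the slack e. Every
    member but the last is replaced by its absolutely continuous version; the last one is only a
    density and stays as it is. *)
Lemma W1_rep n gam g (e : R) : (2 <= gam)%N -> (W1_norm n gam g < +oo)%E -> 0 < e ->
  exists G : nat -> R -> C, [/\ {ae mu, forall x, g x = G 0%N x},
    forall l, (l < n)%N -> cprim (G l) (G l.+1) &
    forall l, (l <= n)%N -> (0 < n)%N -> cwL1 (G l) (2 * (fine (W1_norm n gam g) + e))].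
Proof.
move=> gam2 Wfin e0.
have Wf : W1_norm n gam g \is a fin_num by rewrite ge0_fin_numE // W1_norm_ge0.
have [_ [h [h0 hw] <-] hle] := lb_ereal_inf_adherent e0 Wf.
have hl l : (l <= n)%N -> (L1_norm gam (h l) <= (fine (W1_norm n gam g) + e)%:E)%E.
  move=> ln; rewrite EFinD fineK //; apply: le_trans (ltW hle).
  rewrite (bigD1 (Ordinal (ln : (l < n.+1)%N))) //= leeDl //.
  by apply: sume_ge0 => i _; exact: L1_norm_ge0.
have exG l : exists G : R -> C, if (l < n)%N then
    cprim G (h l.+1) /\ {ae mu, forall x, h l x = G x} else G = h l.
  case: (boolP (l < n)%N) => ln; last by exists (h l).
  by have [G pG eG] := weak_derivative_cprim (hw l ln); exists G.
have [G HG] := choice exG.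
have GE l : {ae mu, forall x, h l x = G l x}.
  have := HG l; case: ifP => _; first by case.
  by move=> ->; exact: aeW.
have mG l : (l <= n)%N -> (0 < n)%N -> cmeas (G l).
  move=> ln n0; have := HG l; case: ifPn => [ln' [pG _]|].
    by have [] := cprim_meas pG.
  rewrite -leqNgt => nl ->.
  have -> : l = n.-1.+1 by rewrite prednK //; apply/eqP; rewrite eqn_leq ln.
  have nn : (n.-1 < n)%N by rewrite prednK.
  by have [_ lh _] := hw _ nn; exact: clocally_meas.
have mh l : (l <= n)%N -> (0 < n)%N -> cmeas (h l).
  move=> ln n0; have [ln'|nl] := ltnP l n.
    by have [lh _ _] := hw _ ln'; exact: clocally_meas.
  have -> : l = n.-1.+1 by rewrite prednK //; apply/eqP; rewrite eqn_leq ln.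
  have nn : (n.-1 < n)%N by rewrite prednK.
  by have [_ lh _] := hw _ nn; exact: clocally_meas.
exists G; split.
- by rewrite -h0; exact: GE.
- move=> l ln; have := HG l; rewrite ln => -[pG _].
  apply: cprim_ae pG _ (GE l.+1); apply: mG => //; exact: leq_ltn_trans ln.
- move=> l ln n0; apply: cwL1_ae (GE l); last exact: mG.
  by apply: cwL1_L1_norm (hl l ln) => //; exact: mh.
Qed.

End SobolevRepresentatives.

(** * Potentials given by series *)

Section SeriesInL1.
Context {R : realType}.
Local Notation mu := (@lebesgue_measure R).

(** Cauchy criterion with countable quantifiers only, which makes the set of convergence visibly
    measurable. *)
Lemma cvg_cauchyP (u : nat -> R) : cvgn u <->
  forall k, exists m, forall n, `|u (m + n)%N - u m| <= k.+1%:R^-1.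
Proof.
split.
  move=> cu k; have e0 : 0 < (k.+1%:R : R)^-1 / 2 by rewrite divr_gt0 // invr_gt0.
  move/cvgrPdist_le : (cu) => /(_ _ e0) [m _ Hm]; exists m => n.
  have h1 := Hm m (leqnn m); have h2 := Hm (m + n)%N (leq_addr _ _).
  rewrite (splitr k.+1%:R^-1) (le_trans (ler_distD (limn u) _ _)) // lerD //.
  by rewrite distrC.
move=> H; apply/cauchy_cvgP/cauchy_exP => e e0.
have [k ke] : exists k : nat, k.+1%:R^-1 < e.
  exists (Num.truncn e^-1); rewrite invf_plt ?posrE // truncnS_gt //.
have [m Hm] := H k; exists (u m); exists m => // n /= mn.
rewrite /ball /= distrC (le_lt_trans _ ke) // -(subnKC mn); exact: Hm.
Qed.

Lemma dvg_lim0 (u : nat -> R) : ~ cvgn u -> limn u = 0.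
Proof. by move=> /dvgP ->. Qed.

(** The series for q_eps and Lambda_eff converge only almost everywhere, but their limits are taken
    at every x. Where the sequence diverges [lim] is 0, so the limit is that of the sequence times
    the indicator of the convergence set. *)
Lemma measurable_fun_limn (s : nat -> R -> R) : (forall n, measurable_fun setT (s n)) ->
  measurable_fun setT (fun x => limn (s ^~ x)).
Proof.
move=> ms.
pose A k m n := [set x | `|s (m + n)%N x - s m x| <= k.+1%:R^-1].
pose E := \bigcap_k \bigcup_m \bigcap_n A k m n.
have mE : measurable E.
  apply: bigcapT_measurable => k; apply: bigcupT_measurable => m.
  apply: bigcapT_measurable => n.
  have -> : A k m n = setT `&` (fun x => `|s (m + n)%N x - s m x| <= k.+1%:R^-1) @^-1` [set true].
    by rewrite setTI; apply/seteqP; split=> x.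
  apply: measurable_fun_ler => //
  ; apply: measurableT_comp => //; exact: measurable_funB.
have EP x : E x <-> cvgn (s ^~ x).
  rewrite cvg_cauchyP; split.
    by move=> H k; have [m _ Hm] := H k I; exists m => n; exact: Hm.
  by move=> H k _; have [m Hm] := H k; exists m => // n _; exact: Hm.
apply: (@measurable_fun_cvg _ _ _ _ (fun n x => s n x * \1_E x)).
  by move=> n; apply: measurable_funM => //; exact: measurable_indic.
move=> x _; rewrite indicE; case: (boolP (x \in E)) => xE.
  under eq_fun do rewrite mulr1.
  by apply/EP; rewrite -in_setE.
rewrite dvg_lim0; last by rewrite -EP; move=> /mem_set; apply/negP.
by under eq_fun do rewrite mulr0; exact: cvg_cst.
Qed.

(** The sum G of the weighted absolute values has finite integral by monotone convergence. It is
    therefore finite almost everywhere and dominates the weighted partial sums. *)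
Lemma series_L1 (a : nat -> R -> R) (B : R) :
  (forall k, measurable_fun setT (a k)) ->
  (forall k, intg setT (fun x => wt x ^+ 2 * `|a k x|)) ->
  (forall n, \sum_(0 <= k < n) \int[mu]_x (wt x ^+ 2 * `|a k x|) <= B) ->
  let s n x := \sum_(0 <= k < n) a k x in
  let t x := limn (s ^~ x) in
  [/\ wL1 t B, forall n, wL1 (s n) B,
   (fun n => \int[mu]_x (wt x ^+ 2 * `|s n x - t x|)) @ \oo --> 0,
   {ae mu, forall x, cvgn (s ^~ x)} &
   {ae mu, forall x, (\sum_(0 <= k <oo) (`|a k x|)%:E < +oo)%E}].
Proof.
move=> ma Ia aB s t.
have ms n : measurable_fun setT (s n).
  by apply: measurable_sum => k; exact: ma.
have mt : measurable_fun setT t by exact: measurable_fun_limn.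
have mw : measurable_fun setT (fun x : R => wt x ^+ 2) := measurable_wt2.
have m1 (u : R -> R) : measurable_fun setT u -> measurable_fun setT (fun x => wt x ^+ 2 * `|u x|).
  by move=> mu_; apply: measurable_funM => //; exact: measurableT_comp.
pose f k x := (wt x ^+ 2 * `|a k x|)%:E.
have f0 k x : (0 <= f k x)%E by rewrite lee_fin mulr_ge0 // sqr_ge0.
have mfk k : measurable_fun setT (f k) by apply/measurable_EFinP; exact: m1.
pose G x := (\sum_(0 <= k <oo) f k x)%E.
have mG : measurable_fun setT G by apply: ge0_emeasurable_sum => // k x _ _; exact: f0.
have G0 x : (0 <= G x)%E by apply: nneseries_ge0 => k _ _; exact: f0.
have fin k : (\int[mu]_x f k x)%E = (\int[mu]_x (wt x ^+ 2 * `|a k x|))%:E.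
  by rewrite /Rintegral fineK //; exact: (integrable_fin_num measurableT (Ia k)).
have IG : (\int[mu]_x G x <= B%:E)%E.
  rewrite /G integral_nneseries //.
  apply: lime_le; first by apply: is_cvg_nneseries => k _ _; apply: integral_ge0.
  apply: nearW => n; under eq_bigr do rewrite fin.
  by rewrite sumEFin lee_fin.
have iG : mu.-integrable setT G.
  apply/integrableP; split => //; under eq_integral do rewrite gee0_abs //.
  exact: (le_lt_trans IG (ltry B)).
have aeG : {ae mu, forall x, (G x < +oo)%E}.
  have := integrable_ae measurableT iG; apply: ae_mono => x /(_ I).
  by rewrite ge0_fin_numE.
have aeA : {ae mu, forall x, (\sum_(0 <= k <oo) (`|a k x|)%:E < +oo)%E}.
  apply: ae_mono aeG => x; apply: le_lt_trans; apply: lee_nneseries => [k _ _|k _].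
    by rewrite lee_fin.
  by rewrite lee_fin ler_peMl // wt2_ge1.
have aeC : {ae mu, forall x, cvgn (s ^~ x)}.
  apply: ae_mono aeA => x Ax; apply: normed_cvg.
  have b0 k : 0 <= `|a k x| by [].
  apply: nondecreasing_is_cvgn; first by apply: nondecreasing_series => k _ /=.
  have Af : (\sum_(0 <= k <oo) (`|a k x|)%:E)%E \is a fin_num.
    by rewrite ge0_fin_numE //; apply: nneseries_ge0 => k _ _; rewrite lee_fin.
  exists (fine (\sum_(0 <= k <oo) (`|a k x|)%:E)%E) => _ [n _ <-].
  rewrite -lee_fin fineK // /series /= -sumEFin.
  by apply: nneseries_lim_ge => k _ _; rewrite lee_fin.
have le n x : wt x ^+ 2 * `|s n x| <= \sum_(0 <= k < n) wt x ^+ 2 * `|a k x|.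
  by rewrite -mulr_sumr ler_wpM2l ?sqr_ge0 // ler_norm_sum.
have Is n : intg setT (fun x => wt x ^+ 2 * `|s n x|).
  apply: (@intg_le _ _ _ (fun x => \sum_(0 <= k < n) wt x ^+ 2 * `|a k x|)) => //.
  - exact: m1.
  - by move=> x _; rewrite ger0_norm // mulr_ge0 // sqr_ge0.
  - by apply: intg_sum => // k; exact: Ia.
have ws n : wL1 (s n) B.
  split=> //; apply: le_trans (aB n); rewrite -Rint_sum //.
  by apply: le_Rintegral => //; apply: intg_sum => // k; exact: Ia.
have mws n : measurable_fun setT (fun x => wt x ^+ 2 * s n x) by exact: measurable_funM.
have mwt' : measurable_fun setT (fun x => wt x ^+ 2 * t x) by exact: measurable_funM.
have [|||||It C1 _] := @dominated_convergence _ _ _ mu _ measurableT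
  (fun n x => (wt x ^+ 2 * s n x)%:E) (fun x => (wt x ^+ 2 * t x)%:E) G.
- by move=> n; apply/measurable_EFinP; exact: mws.
- by apply/measurable_EFinP; exact: mwt'.
- apply: ae_mono aeC => x cx _; apply: cvg_EFin; first exact: nearW.
  by apply: cvgM; [exact: cvg_cst|exact: cx].
- exact: iG.
- apply: aeW => x n _; rewrite /= normrM (ger0_norm (sqr_ge0 _)).
  apply: (@le_trans _ _ (\sum_(0 <= k < n) wt x ^+ 2 * `|a k x|)%:E); first by rewrite lee_fin.
  rewrite -sumEFin; apply: nneseries_lim_ge => k _ _; exact: f0.
have Itn : intg setT (fun x => wt x ^+ 2 * `|t x|).
  have : intg setT (fun x => `|wt x ^+ 2 * t x|) by apply: intg_norm.
  by apply: eq_intg => // x _; rewrite normrM ger0_norm // sqr_ge0.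
have C2 : (fun n => \int[mu]_x (wt x ^+ 2 * `|s n x - t x|)) @ \oo --> 0.
  have -> : (fun n => \int[mu]_x (wt x ^+ 2 * `|s n x - t x|)) =
     (fun n => fine (\int[mu]_x (`|(wt x ^+ 2 * s n x)%:E - (wt x ^+ 2 * t x)%:E|)%E)).
    apply/funext => n; congr fine; apply: eq_integral => x _.
    by rewrite -EFinB /= -mulrBr normrM (ger0_norm (sqr_ge0 _)).
  exact: (fine_cvg C1).
have Ist n : intg setT (fun x => wt x ^+ 2 * `|s n x - t x|).
  apply: (@intg_le _ _ _ (fun x => wt x ^+ 2 * `|s n x| + wt x ^+ 2 * `|t x|)) => //.
  - by apply: m1; exact: measurable_funB.
  - by move=> x _; rewrite ger0_norm ?mulr_ge0 ?sqr_ge0 // -mulrDr ler_wpM2l ?sqr_ge0 // ler_normB.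
  - exact: intgD.
split=> //; split=> //.
have C3 : (fun n => \int[mu]_x (wt x ^+ 2 * `|s n x - t x|) + B) @ \oo --> B.
  by rewrite -[X in _ --> X]add0r; apply: cvgD => //; exact: cvg_cst.
apply: (ler_cvg_to (cvg_cst _) C3); apply: nearW => n.
have [_ _ sB] := ws n; apply: (@le_trans _ _ (\int[mu]_x (wt x ^+ 2 * `|s n x - t x| + wt x ^+ 2 * `|s n x|))).
  apply: le_Rintegral => //; first exact: intgD.
  move=> x _; rewrite -mulrDr ler_wpM2l ?sqr_ge0 // addrC.
  by rewrite -{1}[t x](subKr (s n x)) (le_trans (ler_normB _ _)).
by rewrite RintegralD // lerD2l.
Qed.

Lemma sum1_nat (V : nmodType) (F : nat -> V) n :
  \sum_(1 <= j < n) F j = \sum_(0 <= k < n) (if k is 0%N then 0 else F k).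
Proof.
case: n => [|n]; first by rewrite !big_geq.
rewrite [RHS]big_ltn // add0r; apply: eq_big_nat => -[|k] //.
Qed.

(** Reconciles the unordered sums in [Nalg] and [Lambda_eff] with the symmetric partial sums in
    [osc]; index 0 carries a zero term so that the series starts at 0. *)
Lemma esum_nonzero (t : int -> \bar R) : (forall j, 0 <= t j)%E ->
  (\esum_(j in nonzero_int) t j =
   \sum_(0 <= k <oo) (if k is 0%N then 0 else t k%:Z + t (- k%:Z)%R))%E.
Proof.
move=> t0.
rewrite (esumID [set j : int | 0 < j]) //.
have -> : nonzero_int `&` [set j : int | 0 < j] = [set k.+1%:Z | k in [set: nat]].
  apply/seteqP; split=> [[[|k]|k] [] //= _ _|_ [k _ <-]]; last by [].
  by exists k.
have -> : nonzero_int `&` ~` [set j : int | 0 < j] = [set - k.+1%:Z | k in [set: nat]].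
  apply/seteqP; split=> [[[|k]|k] [] //= _ _|_ [k _ <-]]; last by [].
  by exists k.
have i1 : set_inj [set: nat] (fun k => k.+1%:Z) by move=> x y _ _ [].
have i2 : set_inj [set: nat] (fun k => - k.+1%:Z) by move=> x y _ _ /oppr_inj [].
rewrite !esum_image //.
rewrite -esumD // -nneseries_esumT; last by move=> k; rewrite adde_ge0.
rewrite [RHS](nneseries_split 0 1); last by case=> [|k] _ //; rewrite adde_ge0.
rewrite add0n big_nat1 add0e.
rewrite -(@nneseries_addn _ _ 1%N) //; last by case=> [|k] //; rewrite adde_ge0.
by apply: eq_eseriesr => k _; rewrite addn1.
Qed.

End SeriesInL1.

(** * Dependence of k/t on the potential *)

Section PotentialPerturbations.
Context {R : realType}.
Local Notation mu := (@lebesgue_measure R).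
Local Notation C := R[i].
Local Notation Re := complex.Re.
Local Notation Im := complex.Im.
Implicit Types (U V : R -> R).

(** The modes +-1, ..., +-n as a finite type: the Boolean is the sign, so that j -> -j is its
    negation. *)
Definition freq_idx n (i : 'I_n * bool) : int := if i.2 then i.1.+1%:Z else - i.1.+1%:Z.

Definition idx_opp n (i : 'I_n * bool) : 'I_n * bool := (i.1, ~~ i.2).

Lemma freq_idx_opp n (i : 'I_n * bool) : freq_idx (idx_opp i) = - freq_idx i.
Proof. by case: i => k [] //=; rewrite /freq_idx /= opprK. Qed.

Lemma freq_idx_neq0 n (i : 'I_n * bool) : freq_idx i != 0.
Proof. by case: i => k [] //=; rewrite /freq_idx /= oppr_eq0. Qed.

Lemma freq_idx_inj n : injective (@freq_idx n).
Proof.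
move=> [[k kn] [|]] [[l ln] [|]] //=; rewrite /freq_idx /=.
- by move=> [kl]; congr pair; exact: val_inj.
- by move=> /oppr_inj [kl]; congr pair; exact: val_inj.
Qed.

Lemma sum_freq_idx (V : nmodType) (F : int -> V) n :
  \sum_(i : 'I_n * bool) F (freq_idx i) =
  \sum_(0 <= k < n.+1) (if k is 0%N then 0 else F k%:Z + F (- k%:Z)).
Proof.
rewrite -(pair_bigA _ (fun (i : 'I_n) b => F (freq_idx (i, b)))) /=.
rewrite big_ltn // add0r big_add1 /= big_mkord; apply: eq_bigr => i _.
by rewrite big_bool.
Qed.

Lemma nondecreasing_series_cvg (c : nat -> R) : (forall k, 0 <= c k) ->
  (\sum_(0 <= k <oo) (c k)%:E < +oo)%E -> cvgn (fun n => \sum_(0 <= k < n) c k).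
Proof.
move=> c0 cfin; apply: nondecreasing_is_cvgn.
  by apply: (@nondecreasing_series _ c) => k _ _; exact: c0.
have cf : (\sum_(0 <= k <oo) (c k)%:E)%E \is a fin_num.
  by rewrite ge0_fin_numE //; apply: nneseries_ge0 => k _ _; rewrite lee_fin.
exists (fine (\sum_(0 <= k <oo) (c k)%:E)%E) => _ [n _ <-].
rewrite -lee_fin fineK // -sumEFin.
by apply: nneseries_lim_ge => k _ _; rewrite lee_fin.
Qed.

(** Convergence is not assumed: for a divergent series [fine] of +oo and [lim] both give 0. *)
Lemma fine_nneseries (c : nat -> R) : (forall k, 0 <= c k) ->
  fine (\sum_(0 <= k <oo) (c k)%:E)%E = limn (fun n => \sum_(0 <= k < n) c k).
Proof.
move=> c0; pose s n := \sum_(0 <= k < n) c k.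
have [sc|sd] := pselect (cvgn s).
  have -> : (\sum_(0 <= k <oo) (c k)%:E)%E = (limn s)%:E.
    rewrite -EFin_lim //; congr (limn _); apply/funext => n /=.
    by rewrite /s -sumEFin.
  by [].
rewrite (dvg_lim0 sd); have : ~ (\sum_(0 <= k <oo) (c k)%:E < +oo)%E.
  by move=> /(nondecreasing_series_cvg c0).
by move=> /negP; rewrite -leNgt leye_eq => /eqP ->.
Qed.

Lemma wL1_0 : wL1 (fun=> 0 : R) 0.
Proof.
split; first exact: measurable_cst.
- by apply: eq_intg (@intg0 R setT _) => // x _; rewrite normr0 mulr0.
- by under eq_Rintegral do rewrite normr0 mulr0; rewrite Rintegral_cst // mul0r.
Qed.

Lemma wL1D U V (N M : R) : wL1 U N -> wL1 V M -> wL1 (fun x => U x + V x) (N + M).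
Proof.
move=> [mU IU NU] [mV IV NV].
have mUV : measurable_fun setT (fun x => U x + V x) by exact: measurable_funD.
have m1 : measurable_fun setT (fun x => wt x ^+ 2 * `|U x + V x|).
  by apply: measurable_funM; [exact: measurable_wt2|exact: measurableT_comp].
have le x : `|wt x ^+ 2 * `|U x + V x| | <= wt x ^+ 2 * `|U x| + wt x ^+ 2 * `|V x|.
  by rewrite ger0_norm ?mulr_ge0 ?sqr_ge0 // -mulrDr ler_wpM2l ?sqr_ge0 // ler_normD.
have ID := intgD measurableT IU IV.
split=> //; first exact: intg_le (fun x _ => le x) ID.
apply: (le_trans (ler_norm _)); apply: (le_trans (Rint_le0 measurableT m1 (fun x _ => le x) ID)).
by rewrite RintegralD // lerD.
Qed.

Lemma wL1Z U (c N : R) : wL1 U N -> wL1 (fun x => c * U x) (`|c| * N).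
Proof.
move=> [mU IU NU].
have e x : `|c| * (wt x ^+ 2 * `|U x|) = wt x ^+ 2 * `|c * U x| by rewrite normrM; ring.
split.
- by apply: measurable_funM.
- by apply: eq_intg (intgZ `|c| measurableT IU) => // x _; exact: e.
- by under eq_Rintegral do rewrite -e; rewrite RintegralZl // ler_wpM2l.
Qed.

Lemma wL1_ub U (N M : R) : wL1 U N -> N <= M -> wL1 U M.
Proof. by move=> [mU IU NU] NM; split=> //; exact: le_trans NM. Qed.

Lemma cwL1_wL1 U (N : R) : cwL1 (fun x => (U x)%:C%C) N -> wL1 U N.
Proof.
move=> [[mU _] I1 N1]; split=> //.
  by apply: eq_intg I1 => // x _; rewrite n1_real.
by apply: le_trans N1; rewrite le_eqVlt; apply/orP; left; apply/eqP;
  apply: eq_Rintegral => x _; rewrite n1_real.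
Qed.

Lemma half_iE : Complex 0 1 / 2 = Complex 0 2^-1 :> C.
Proof.
have n2 : (2 : C) != 0 by rewrite pnatr_eq0.
apply: (mulIf n2); rewrite divfK // mulr_natr mulr2n.
by apply: complex_ext; rewrite ?cReD ?cImD /=; lra.
Qed.

Lemma n1_half_i (z : C) : n1 (Complex 0 2^-1 * z) <= n1 z.
Proof.
rewrite (le_trans (n1M _ _)) // /n1 /= normr0 add0r ler_piMl // ?addr_ge0 //.
by rewrite ger0_norm ?invr_ge0 // invf_le1 // ler1n.
Qed.

Lemma k_over_t_lip U V (N k : R) : wL1 U N -> wL1 V N -> `|k| <= 1 ->
  n1 (k_over_t U k - k_over_t V k) <= 2 * jost_const N ^+ 2 * \int[mu]_x (wt x ^+ 2 * `|U x - V x|).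
Proof.
move=> UN VN k1.
have [f1 rf] := jostpP UN k1; have [g1 lg] := jostmP UN k1.
have [F1 rF] := jostpP VN k1; have [G1 lG] := jostmP VN k1.
rewrite (k_over_tE rf lg) (k_over_tE rF lG) -mulrBr (le_trans (n1_half_i _)) //.
by have [_ -> ] := Wr_diff VN UN rF lG rf lg.
Qed.

Lemma cmodM (z w : C) : cmod (z * w) = cmod z * cmod w.
Proof.
apply/eqP; rewrite -(eqrXn2 (n := 2)) ?mulr_ge0 ?cmod_ge0 // exprMn !cmod_sqr cReM cImM.
by apply/eqP; ring.
Qed.

Lemma cmod0_eq0 (z : C) : cmod z = 0 -> z = 0.
Proof.
move=> z0; have := n1_le_cmod z; rewrite z0 mulr0 /n1 => h.
have := normr_ge0 (Re z); have := normr_ge0 (Im z) => h1 h2.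
by apply: complex_ext; apply: normr0_eq0; lra.
Qed.

Lemma cmod_real (a : R) : cmod a%:C%C = `|a|.
Proof. by rewrite cmodE /= expr0n addr0 sqrtr_sqr. Qed.

Lemma cmod_div (z w : C) : w != 0 -> cmod (z / w) = cmod z / cmod w.
Proof.
move=> w0; have cw : cmod w != 0 by apply/eqP => /cmod0_eq0 /eqP; apply/negP.
by apply: (mulIf cw); rewrite -cmodM !divfK.
Qed.

Lemma cmod_Re (z : C) : `|Re z| <= cmod z.
Proof.
rewrite -(ler_sqr (normr_ge0 _) (cmod_ge0 _)) cmod_sqr real_normK ?num_real //.
by rewrite lerDl sqr_ge0.
Qed.

Lemma cmod_Im (z : C) : `|Im z| <= cmod z.
Proof.
rewrite -(ler_sqr (normr_ge0 _) (cmod_ge0 _)) cmod_sqr real_normK ?num_real //.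
by rewrite lerDr sqr_ge0.
Qed.

(* lim is 0 when the limit does not exist, so no convergence is needed here *)
Lemma lim_sqr_le1 (u v : R -> R) (F : set_system R) {FF : ProperFilter F} :
  (\forall x \near F, u x ^+ 2 + v x ^+ 2 <= 1) ->
  (lim (u @ F)) ^+ 2 + (lim (v @ F)) ^+ 2 <= 1.
Proof.
move=> uv.
have u1 : \forall x \near F, u x ^+ 2 <= 1.
  by apply: filterS uv => x; apply: le_trans; rewrite lerDl sqr_ge0.
have v1 : \forall x \near F, v x ^+ 2 <= 1.
  by apply: filterS uv => x; apply: le_trans; rewrite lerDr sqr_ge0.
have sq (h : R -> R) : cvg (h @ F) -> h x ^+ 2 @[x --> F] --> lim (h @ F) ^+ 2.
  by move=> ch; rewrite expr2; apply: cvgM.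
have [cu|/dvgP du] := pselect (cvg (u @ F)); have [cv|/dvgP dv] := pselect (cvg (v @ F)).
- apply: (ler_cvg_to (cvgD (sq _ cu) (sq _ cv))); [exact: (cvg_cst (1 : R))|exact: uv].
- rewrite dv expr0n addr0; apply: (ler_cvg_to (sq _ cu)); [exact: (cvg_cst (1 : R))|exact: u1].
- rewrite du expr0n add0r; apply: (ler_cvg_to (sq _ cv)); [exact: (cvg_cst (1 : R))|exact: v1].
- by rewrite du dv expr0n addr0.
Qed.

Lemma transmission_le1 U (N k : R) : wL1 U N -> `|k| <= 1 -> cmod (transmission U k) <= 1.
Proof.
move=> UN.
have P (l : R) : l != 0 -> `|l| <= 1 -> cmod (l%:C%C / k_over_t U l) <= 1.
  move=> l0 l1; have ge := k_over_t_ge UN l1.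
  have kt0 : 0 < cmod (k_over_t U l) by apply: lt_le_trans ge; rewrite normr_gt0.
  rewrite cmod_div ?cmod_real ?ler_pdivrMr ?mul1r //.
  by apply/eqP => e; move: kt0; rewrite e cmod_real normr0 ltxx.
move=> k1; rewrite /transmission; case: ifPn => [_|k0]; last exact: P.
rewrite -(ler_sqr (cmod_ge0 _) ler01) cmod_sqr /= expr1n; apply: lim_sqr_le1.
near=> l; rewrite -cmod_sqr -(expr1n _ 2) ler_sqr ?nnegrE ?cmod_ge0 //.
apply: P; first by near: l; exact: nbhs_dnbhs_neq.
by near: l; apply: dnbhs0_le.
Unshelve. all: by end_near. Qed.

Lemma ae_forall_fin (I : countType) (P : I -> R -> Prop) :
  (forall i, {ae mu, forall x, P i x}) -> {ae mu, forall x, forall i, P i x}.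
Proof.
move=> H; have := @ae_foralln _ _ _ mu
  (fun n x => if unpickle n is Some i then P i x else True).
move=> K; apply: (ae_mono _ (K _)) => [x Hx i|n].
  by have := Hx (pickle i); rewrite pickleK.
by case: (unpickle n) => [i|]; [exact: H|exact: aeW].
Qed.

Lemma wL1_intg U (N : R) : wL1 U N -> intg setT U.
Proof.
move=> [mU IU _]; apply: (intg_le measurableT mU _ IU) => x _.
by rewrite ler_peMl // wt2_ge1.
Qed.

Lemma k_over_t_first_order U (M N k : R) : wL1 U M -> M <= N -> `|k| <= 1 ->
  n1 (k_over_t U k - (k%:C%C + Complex 0 2^-1 * (\int[mu]_x U x)%:C%C)) <=
  4 * jost_const N * M ^+ 2.
Proof.
move=> UM MN k1; have UN := wL1_ub UM MN; have N0 := wL1_ge0 UN; have M0 := wL1_ge0 UM.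
have K0 : 0 <= jost_const N by apply: le_trans (jost_const_ge N0).
have [F1 rF] := jostpP UN k1; have [G1 lG] := jostmP UN k1.
have r0 := jost_right0 N0 k1.
pose g x : C := cexpi (k * - x); pose g1 x : C := - (Complex 0 k * cexpi (k * - x)).
have l0 : jost_left (fun=> 0) k N g g1.
  rewrite /jost_left /g /g1.
  rewrite (_ : (fun x => cexpi (k * - - x)) = fun x => cexpi (k * x)).
    rewrite (_ : (fun x => - - (Complex 0 k * cexpi (k * - - x))) =
      fun x => Complex 0 k * cexpi (k * x)) //.
    by apply/funext => x; rewrite !opprK.
  by apply/funext => x; rewrite opprK.
have Z : wL1 (fun=> 0) N := wL1_ub wL1_0 N0.
have [ID WE _] := Wr_diff Z UN r0 l0 rF lG.
set G := jostm U k in ID WE lG *.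
have W0 : Wr (fun x => cexpi (k * x)) (fun x => Complex 0 k * cexpi (k * x)) g g1 0 =
    Complex 0 (- 2 * k).
  rewrite /Wr /g /g1 oppr0 mulr0 cexpi0.
  by apply: complex_ext; rewrite ?(cReB, cImB, cReN, cImN, cReM, cImM) /=; ring.
have IU := wL1_intg UM.
have hU : has_cint (fun x => (U x)%:C%C) (\int[mu]_x U x)%:C%C.
  split; first by split=> //; exact: intg0.
  by rewrite /cint; apply: complex_ext => //=; rewrite Rintegral_cst // mul0r.
have hD : has_cint (fun x => (U x - 0)%:C%C * (cexpi (k * x) * G x))
   (cint setT (fun x => (U x - 0)%:C%C * (cexpi (k * x) * G x))) by split.
have [_ hE] := has_cintB hD hU.
rewrite (k_over_tE rF lG) (canRL (subrK _) WE) W0.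
set z := cint setT (fun x => (U x - 0)%:C%C * (cexpi (k * x) * G x)) in hE *.
have -> : Complex 0 2^-1 * (z + Complex 0 (-2 * k)) -
    (k%:C%C + Complex 0 2^-1 * (\int[mu]_x U x)%:C%C) =
    Complex 0 2^-1 * (z - (\int[mu]_x U x)%:C%C).
  have -> : Complex 0 2^-1 * (z + Complex 0 (-2 * k)) =
     Complex 0 2^-1 * z + k%:C%C.
    rewrite mulrDr; congr (_ + _); apply: complex_ext; rewrite ?cReM ?cImM /=; by field.
  ring.
rewrite (le_trans (n1_half_i _)) // -hE.
have [pG _ _] := jost_left_cprim lG; have mG : cmeas G by have [] := cprim_meas pG.
have [mU Iw Bw] := UM.
have eg x : cexpi (k * x) * g x = 1.
  by rewrite /g mulrN -cexpiD subrr cexpi0.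
have dG x : n1 (G x - g x) <= jost_const N * wt x * M.
  have [_ _ _ dev _] := lG; have := dev (- x); rewrite opprK wtN => /le_trans; apply.
  apply: ler_wpM2l; last exact: wmass_le (wL1_opp UM).
  by apply: mulr_ge0; [exact: K0|].
have le x : n1 ((U x - 0)%:C%C * (cexpi (k * x) * G x) - (U x)%:C%C) <=
    2 * (jost_const N * M) * (wt x ^+ 2 * `|U x|).
  have -> : (U x - 0)%:C%C * (cexpi (k * x) * G x) - (U x)%:C%C =
     (U x)%:C%C * (cexpi (k * x) * (G x - g x)).
    by rewrite subr0 mulrBr eg mulrBr mulr1.
  rewrite n1Mr; have h1 := n1M (cexpi (k * x)) (G x - g x).
  have h2 : n1 (cexpi (k * x)) * n1 (G x - g x) <= 2 * (jost_const N * wt x ^+ 2 * M).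
    apply: ler_pM => //; first exact: n1_cexpi.
    apply: (le_trans (dG x)); rewrite ler_wpM2r // ler_wpM2l // expr2 ler_peMr //.
  have := ler_wpM2l (normr_ge0 (U x)) (le_trans h1 h2).
  by move/le_trans; apply; apply: eq_ler; ring.
have mD : cmeas (fun x => (U x - 0)%:C%C * (cexpi (k * x) * G x) - (U x)%:C%C).
  apply: cmeasB; last exact: cmeas_real.
  apply: cmeasM; first by apply: cmeas_real; exact: measurable_funB.
  by apply: cmeasM => //; exact: cmeas_cexpi.
have [_ h] := cint_bound measurableT mD (intgZ (2 * (jost_const N * M)) measurableT Iw) (fun x _ => le x).
apply: (le_trans h); rewrite RintegralZl //.
have KM : 0 <= jost_const N * M by rewrite mulr_ge0.
have := ler_wpM2l KM Bw; rewrite expr2; lra.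
Qed.

End PotentialPerturbations.

(** * The homogenized potential *)

(** A stands for N_alg. S = 2 (A + 1) bounds both the sum over the modes and the norms of q_av, 8 (A
    + 1)^2 bounds the potentials in [wL1], and the last factor is that of [core_estimate]. *)
Definition homog_const {R : realType} (A : R) : R :=
  let S := 2 * (A + 1) in
  S * core_const S S (jost_const (8 * (A + 1) ^+ 2)) * (56 + 48 * S + 24 * S + 16 * S ^+ 2).

Section Homogenization.
Context {R : realType} (theta : R) (theta_gt0 : 0 < theta)
  (qav : R -> R) (q : int -> R -> R[i]) (lam : int -> R) (HV : hypV theta qav q lam).
Local Notation mu := (@lebesgue_measure R).
Local Notation C := R[i].
Local Notation Re := complex.Re.
Local Notation Im := complex.Im.

Let Wn j := W1_norm 3 3 (q j).
Let W j : R := fine (Wn j).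
Let Na : R := fine (Nalg qav q).
Let Wv : R := fine (W1_norm 1 2 (fun x => (qav x)%:C%C)).

Let Nfin : Nalg qav q \is a fin_num.
Proof.
rewrite ge0_fin_numE ?(hypV_fin HV) // adde_ge0 ?W1_norm_ge0 //.
by apply: esum_ge0 => j _; exact: W1_norm_ge0.
Qed.

Let Wn_series :
  (\esum_(j in nonzero_int) Wn j =
   \sum_(0 <= k <oo) (if k is 0%N then 0 else Wn k%:Z + Wn (- k%:Z)%R))%E.
Proof. by apply: esum_nonzero => j; exact: W1_norm_ge0. Qed.

Let cWn k : \bar R := if k is 0%N then 0%E else (Wn k%:Z + Wn (- k%:Z)%R)%E.

Let cWn0 k : (0 <= cWn k)%E.
Proof. by case: k => [|k] //=; rewrite adde_ge0 ?W1_norm_ge0. Qed.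

Let NalgE : Nalg qav q = (W1_norm 1 2 (fun x => (qav x)%:C%C) + \sum_(0 <= k <oo) cWn k)%E.
Proof. by rewrite /Nalg Wn_series. Qed.

Let sum_cWn n : (W1_norm 1 2 (fun x => (qav x)%:C%C) + \sum_(0 <= k < n) cWn k <= Nalg qav q)%E.
Proof. by rewrite NalgE leeD2l // nneseries_lim_ge. Qed.

Let Wv_fin : (W1_norm 1 2 (fun x => (qav x)%:C%C) < +oo)%E.
Proof.
apply: le_lt_trans (hypV_fin HV); apply: le_trans (sum_cWn 0).
by rewrite big_geq // adde0.
Qed.

Let cWn_fin k : (cWn k < +oo)%E.
Proof.
apply: le_lt_trans (hypV_fin HV); apply: le_trans (sum_cWn k.+1).
rewrite big_nat_recr //= addeA leeDr // adde_ge0 ?W1_norm_ge0 //.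
by apply: sume_ge0.
Qed.

Let Wn_fin j : j != 0 -> (Wn j < +oo)%E.
Proof.
case: j => [[|k]|k] // _.
  apply: le_lt_trans (cWn_fin k.+1) => /=; by rewrite leeDl // W1_norm_ge0.
apply: le_lt_trans (cWn_fin k.+1) => /=; rewrite NegzE; by rewrite leeDr // W1_norm_ge0.
Qed.

Let W0 j : 0 <= W j. Proof. by rewrite fine_ge0 // W1_norm_ge0. Qed.
Let Wv0 : 0 <= Wv. Proof. by rewrite fine_ge0 // W1_norm_ge0. Qed.
Let WE j : j != 0 -> Wn j = (W j)%:E.
Proof. by move=> j0; rewrite fineK // ge0_fin_numE ?Wn_fin // W1_norm_ge0. Qed.

Definition cW k : R := if k is 0%N then 0 else W k%:Z + W (- k%:Z).

Let cW0 k : 0 <= cW k. Proof. by case: k => [|k] //=; rewrite addr_ge0. Qed.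

Let sum_cW n : Wv + \sum_(0 <= k < n) cW k <= Na.
Proof.
rewrite -lee_fin EFinD -sumEFin.
have -> : Wv%:E = W1_norm 1 2 (fun x => (qav x)%:C%C).
  by rewrite fineK // ge0_fin_numE // W1_norm_ge0.
rewrite /Na fineK //; apply: le_trans (sum_cWn n).
rewrite leeD2l // le_eqVlt; apply/orP; left; apply/eqP.
by apply: eq_bigr => -[|k] _ //=; rewrite EFinD !WE // oppr_eq0.
Qed.

Let Na0 : 0 <= Na.
Proof. by apply: le_trans (sum_cW 0); rewrite big_geq // addr0. Qed.
Let WvNa : Wv <= Na.
Proof. by apply: le_trans (sum_cW 0); rewrite big_geq // addr0. Qed.
Let sum_cW' n : \sum_(0 <= k < n) cW k <= Na.
Proof. by apply: le_trans (sum_cW n); rewrite lerDr. Qed.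

Let W_Na j : j != 0 -> W j <= Na.
Proof.
have P k : cW k <= Na.
  apply: le_trans (sum_cW' k.+1); rewrite big_nat_recr //= lerDr.
  exact: sumr_ge0.
case: j => [[|k]|k] // _; apply: le_trans (P k.+1) => /=; first by rewrite lerDl.
by rewrite NegzE lerDr.
Qed.

Let mq j : j != 0 -> cmeas (q j).
Proof. by move=> j0; exact: W1_norm_meas (Wn_fin j0). Qed.

Let wq j : j != 0 -> cwL1 (q j) (2 * W j).
Proof.
move=> j0; apply: (cwL1_L1_norm (gam := 3)) => //; first exact: mq.
by rewrite -WE //; exact: L1_norm_le_W1.
Qed.

Lemma qav_wL1 : wL1 qav (2 * Na).
Proof.
apply: wL1_ub (_ : 2 * Wv <= _); last by rewrite ler_wpM2l.
apply: cwL1_wL1; apply: (cwL1_L1_norm (gam := 2)) => //; first exact: W1_norm_meas Wv_fin.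
rewrite /Wv fineK ?ge0_fin_numE ?W1_norm_ge0 //; exact: L1_norm_le_W1.
Qed.

Lemma lam_gt0 j : j != 0 -> 0 < `|lam j|.
Proof. by move=> j0; apply: lt_le_trans (hypV_gap0 HV j0). Qed.

Section Eps.
Context (eps : R) (eps_gt0 : 0 < eps).

Definition om j : R := 2 * pi * lam j / eps.

Definition qe j x : C := q j x * cexpi (om j * x).

Definition aterm k x : R := if k is 0%N then 0 else Re (qe k%:Z x) + Re (qe (- k%:Z) x).

Lemma q_epsE x : q_eps q lam eps x = limn (fun n => \sum_(0 <= k < n) aterm k x).
Proof.
rewrite /q_eps /osc /sum_nonzero /clim /=; congr (limn _); apply/funext => n.
rewrite cRe_sum sum1_nat; apply: eq_big_nat => -[|k] _ //=.
have e j : 2 * pi * lam j * (x / eps) = om j * x by rewrite /om; ring.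
by rewrite cReD !e.
Qed.

Let mqe j : j != 0 -> cmeas (qe j).
Proof. by move=> j0; apply: cmeasM; [exact: mq|exact: cmeas_cexpi]. Qed.

Let wqe j : j != 0 -> cwL1 (qe j) (2 * (2 * W j)).
Proof.
move=> j0; apply: cwL1M => //; [exact: wq|exact: cmeas_cexpi|].
by move=> x; exact: n1_cexpi.
Qed.

Lemma aterm_wL1 k : wL1 (aterm k) (4 * cW k).
Proof.
have P j : j != 0 -> wL1 (fun x => Re (qe j x)) (2 * (2 * W j)).
  move=> j0; apply: cwL1_wL1; rewrite -[X in cwL1 _ X]mul1r.
  apply: cwL1_le (wqe j0) _ ler01 _; first by apply: cmeas_real; case: (mqe j0).
  by move=> x; rewrite mul1r n1_real /n1 lerDl.
case: k => [|k]; first by rewrite mulr0; exact: wL1_0.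
have -> : 4 * cW k.+1 = 2 * (2 * W k.+1%:Z) + 2 * (2 * W (- k.+1%:Z)) by rewrite /=; ring.
by apply: wL1D; apply: P => //; rewrite oppr_eq0.
Qed.

Definition cterm k x : R :=
  if k is 0%N then 0 else cmod (q k%:Z x) ^+ 2 / lam k%:Z ^+ 2
    + cmod (q (- k%:Z) x) ^+ 2 / lam (- k%:Z) ^+ 2.

Lemma cterm_ge0 k x : 0 <= cterm k x.
Proof. by case: k => [|k] //=; rewrite addr_ge0 // divr_ge0 // sqr_ge0. Qed.

Lemma Lambda_effE x : Lambda_eff q lam x =
  (4 * pi ^+ 2)^-1 * limn (fun n => \sum_(0 <= k < n) cterm k x).
Proof.
rewrite /Lambda_eff esum_nonzero; last by move=> j; rewrite lee_fin divr_ge0 // sqr_ge0.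
rewrite -fine_nneseries; last by move=> k; exact: cterm_ge0.
by congr (_ * fine _); apply: eq_eseriesr => -[|k] _ //=.
Qed.

(** |q_j|^2 is integrable because q_j has a bounded representative: its sup is at most 4 (Na + 1),
    the 1 being the slack in [W1_rep]. The remaining factor 2 compares [n1] with the modulus. *)
Let tterm_wL1 j : j != 0 ->
  wL1 (fun x => cmod (q j x) ^+ 2 / lam j ^+ 2) (theta ^- 2 * (8 * (Na + 1)) * W j).
Proof.
move=> j0; have [G [qG pG wG]] := W1_rep (isT : (2 <= 3)%N) (Wn_fin j0) ltr01.
have th : (lam j ^+ 2)^-1 <= theta ^- 2.
  have l2 : 0 < lam j ^+ 2.
    by rewrite -(real_normK (num_real (lam j))) exprn_gt0 // lam_gt0.
  rewrite lef_pV2 ?posrE ?l2 ?(exprn_gt0 _ theta_gt0) //.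
  by rewrite -(real_normK (num_real (lam j))) lerXn2r ?nnegrE ?(ltW theta_gt0) // (hypV_gap0 HV).
have G4 x : n1 (G 0%N x) <= 4 * (Na + 1).
  apply: (le_trans (cwL1_sup x (wG 0%N isT isT) (wG 1%N isT isT) (pG 0%N isT))).
  by have := W_Na j0; rewrite -/(Wn j) -/(W j); lra.
have mG : cmeas (G 0%N) by case: (wG 0%N isT isT).
have wG0 := cwL1_ae (wq j0) mG qG.
have w1 : cwL1 (fun x => (cmod (G 0%N x) ^+ 2 / lam j ^+ 2)%:C%C)
   (theta ^- 2 * (4 * (Na + 1)) * (2 * W j)).
  apply: cwL1_le wG0 _ _ _.
  - apply: cmeas_real; apply: measurable_funM => //; apply: measurable_funX.
    exact: cmeas_cmod.
  - by rewrite mulr_ge0 ?invr_ge0 ?sqr_ge0 // mulr_ge0 // addr_ge0.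
  - move=> x; rewrite n1_real ger0_norm ?divr_ge0 ?sqr_ge0 // mulrC -mulrA.
    apply: ler_pM => //; rewrite ?invr_ge0 ?sqr_ge0 // expr2.
    apply: ler_pM; rewrite ?cmod_ge0 ?cmod_le_n1 //.
    exact: le_trans (cmod_le_n1 _) (G4 x).
have w2 : cwL1 (fun x => (cmod (q j x) ^+ 2 / lam j ^+ 2)%:C%C)
   (theta ^- 2 * (4 * (Na + 1)) * (2 * W j)).
  apply: cwL1_ae w1 _ _.
    apply: cmeas_real; apply: measurable_funM => //; apply: measurable_funX.
    by apply: cmeas_cmod; exact: mq.
  by apply: ae_mono qG => x ->.
apply: wL1_ub (cwL1_wL1 w2) _.
by apply: eq_ler; ring.
Qed.

Let Ct : R := theta ^- 2 * (8 * (Na + 1)).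

Let Ct0 : 0 <= Ct.
Proof. by rewrite mulr_ge0 ?invr_ge0 ?sqr_ge0 // mulr_ge0 // addr_ge0. Qed.

Lemma cterm_wL1 k : wL1 (cterm k) (Ct * cW k).
Proof.
case: k => [|k]; first by rewrite mulr0; exact: wL1_0.
by rewrite mulrDr; apply: wL1D; apply: tterm_wL1 => //; rewrite oppr_eq0.
Qed.

Let apart n x : R := \sum_(0 <= k < n) aterm k x.
Let cpart n x : R := \sum_(0 <= k < n) cterm k x.
Let aser x : R := limn (apart ^~ x).
Let cser x : R := limn (cpart ^~ x).

Let a_series : [/\ wL1 aser (4 * Na), forall n, wL1 (apart n) (4 * Na) &
   (fun n => \int[mu]_x (wt x ^+ 2 * `|apart n x - aser x|)) @ \oo --> 0].
Proof.
have m k : measurable_fun setT (aterm k) by case: (aterm_wL1 k).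
have I k : intg setT (fun x => wt x ^+ 2 * `|aterm k x|) by case: (aterm_wL1 k).
have b n : \sum_(0 <= k < n) \int[mu]_x (wt x ^+ 2 * `|aterm k x|) <= 4 * Na.
  apply: (@le_trans _ _ (\sum_(0 <= k < n) 4 * cW k)).
    by apply: ler_sum => k _; case: (aterm_wL1 k).
  by rewrite -mulr_sumr ler_wpM2l.
by have [h1 h2 h3 _ _] := series_L1 m I b; split.
Qed.

Let c_series : [/\ wL1 cser (Ct * Na), forall n, wL1 (cpart n) (Ct * Na) &
   (fun n => \int[mu]_x (wt x ^+ 2 * `|cpart n x - cser x|)) @ \oo --> 0].
Proof.
have m k : measurable_fun setT (cterm k) by case: (cterm_wL1 k).
have I k : intg setT (fun x => wt x ^+ 2 * `|cterm k x|) by case: (cterm_wL1 k).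
have b n : \sum_(0 <= k < n) \int[mu]_x (wt x ^+ 2 * `|cterm k x|) <= Ct * Na.
  apply: (@le_trans _ _ (\sum_(0 <= k < n) Ct * cW k)).
    by apply: ler_sum => k _; case: (cterm_wL1 k).
  by rewrite -mulr_sumr ler_wpM2l.
by have [h1 h2 h3 _ _] := series_L1 m I b; split.
Qed.

Let kappa : R := - eps ^+ 2 * (4 * pi ^+ 2)^-1.

Lemma sigma_effE : sigma_eff q lam eps = fun x => kappa * cser x.
Proof. by apply/funext => x; rewrite /sigma_eff Lambda_effE mulrA. Qed.

Lemma q_epsE' : q_eps q lam eps = aser.
Proof. by apply/funext => x; rewrite q_epsE. Qed.

Let pi2 : 1 <= 2 * pi :> R.
Proof. by have := pi_ge2 R; lra. Qed.

Let kappa_le : `|kappa| <= eps ^+ 2.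
Proof.
have p1 : 1 <= 4 * pi ^+ 2 :> R by have := pi2; nra.
have p2 : 0 < 4 * pi ^+ 2 :> R := lt_le_trans ltr01 p1.
rewrite /kappa mulNr normrN normrM !ger0_norm ?sqr_ge0 ?invr_ge0 ?(ltW p2) //.
by rewrite ler_piMr ?sqr_ge0 // invf_le1.
Qed.

Lemma sigma_wL1 : wL1 (sigma_eff q lam eps) (eps ^+ 2 * (Ct * Na)).
Proof.
rewrite sigma_effE; have [h _ _] := c_series.
by apply: wL1_ub (wL1Z kappa h) _; rewrite ler_wpM2r // mulr_ge0.
Qed.

Context (eps_theta : eps < theta).

(** A common bound for all the potentials involved, truncated or not: 2 Na + 8 (Na + 1) Na for the
    effective ones and 6 Na for the oscillating ones. *)
Let NN : R := 8 * (Na + 1) ^+ 2.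

Let NN0 : 0 <= NN. Proof. by rewrite mulr_ge0 // sqr_ge0. Qed.

(** eps < theta makes eps^2 absorb the theta^-2 in [Ct], so the size of the effective potentials,
    and with it [jost_const NN], is controlled by N_alg alone. *)
Let kCt : `|kappa| * (Ct * Na) <= 8 * (Na + 1) * Na.
Proof.
rewrite mulrA ler_wpM2r //; apply: (@le_trans _ _ (theta ^+ 2 * Ct)).
  rewrite ler_wpM2r // (le_trans kappa_le) // lerXn2r ?nnegrE ?ltW //.
by rewrite /Ct mulrA divff ?mul1r // expf_neq0 // gt_eqF.
Qed.

Let U1 n x : R := qav x + kappa * cpart n x.
Let U2 n x : R := qav x + apart n x.

Let boundU1 : 2 * Na + `|kappa| * (Ct * Na) <= NN.
Proof. by have := kCt; have := Na0; rewrite /NN expr2; nra. Qed.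
Let boundU2 : 2 * Na + 4 * Na <= NN.
Proof. by have := Na0; rewrite /NN expr2; nra. Qed.

Lemma wL1_qav_sigma : wL1 (fun x => qav x + sigma_eff q lam eps x) NN.
Proof.
have [h _ _] := c_series.
by rewrite sigma_effE; apply: wL1_ub (wL1D qav_wL1 (wL1Z kappa h)) boundU1.
Qed.

Lemma wL1_qav_eps : wL1 (fun x => qav x + q_eps q lam eps x) NN.
Proof.
have [h _ _] := a_series.
by rewrite q_epsE'; apply: wL1_ub (wL1D qav_wL1 h) boundU2.
Qed.

Let wU1 n : wL1 (U1 n) NN.
Proof. by have [_ h _] := c_series; apply: wL1_ub (wL1D qav_wL1 (wL1Z kappa (h n))) boundU1. Qed.

Let wU2 n : wL1 (U2 n) NN.
Proof. by have [_ h _] := a_series; apply: wL1_ub (wL1D qav_wL1 (h n)) boundU2. Qed.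

Let qe_conj j x : j != 0 -> qe (- j) x = conjc (qe j x).
Proof.
move=> j0; rewrite /qe rmorphM /= (hypV_conj HV) //; congr (_ * _).
rewrite /om (hypV_odd HV) // mulrN !mulNr.
by apply: complex_ext; rewrite /= ?cosN ?sinN.
Qed.

Let sum_qe n x : \sum_(i : 'I_n * bool) qe (freq_idx i) x = (apart n.+1 x)%:C%C.
Proof.
apply: complex_ext; rewrite ?cRe_sum ?cIm_sum /=.
  by rewrite (sum_freq_idx (fun j => Re (qe j x))).
rewrite (sum_freq_idx (fun j => Im (qe j x))); rewrite big_nat big1 // => -[|k] // _.
by rewrite qe_conj // cIm_conj subrr.
Qed.

(** (2 pi lam_j / eps)^-2 is the origin of the factor eps^2 / (4 pi^2) in sigma. *)
Let sum_cq n x : \sum_(i : 'I_n * bool) ((om (freq_idx i) ^+ 2)^-1)%:C%C * (q (freq_idx i) x * q (- freq_idx i) x) =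
  (- (kappa * cpart n.+1 x))%:C%C.
Proof.
have P j : j != 0 -> ((om j ^+ 2)^-1)%:C%C * (q j x * q (- j) x) =
   (- kappa * (cmod (q j x) ^+ 2 / lam j ^+ 2))%:C%C.
  move=> j0; rewrite -(hypV_conj HV) //.
  have -> : q j x * conjc (q j x) = (cmod (q j x) ^+ 2)%:C%C.
    rewrite cmod_sqr; apply: complex_ext; rewrite ?cReM ?cImM cRe_conj cIm_conj /=; ring.
  rewrite -rmorphM /=; congr (_ %:C)%C.
  have l0 : lam j != 0 by rewrite -normr_gt0 lam_gt0.
  have p0 : pi != 0 :> R by rewrite gt_eqF // pi_gt0.
  have e0 : eps != 0 by rewrite gt_eqF.
  rewrite /om /kappa; move: (pi : R) p0 => p p0; field.
  by rewrite l0 p0 e0.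
under eq_bigr do rewrite P ?freq_idx_neq0 //.
rewrite -rmorph_sum /=; congr (_ %:C)%C.
rewrite (sum_freq_idx (fun j => - kappa * (cmod (q j x) ^+ 2 / lam j ^+ 2))).
rewrite -(mulNr kappa) /cpart mulr_sumr; apply: eq_big_nat => -[|k] _ /=; first by rewrite mulr0.
by rewrite mulrDr.
Qed.

Let S : R := 2 * (Na + 1).

Let CC : R := homog_const Na.

Let trunc_estimate n k : `|k| <= 1 ->
  n1 (k_over_t (U1 n.+1) k - k_over_t (U2 n.+1) k) <= (eps / theta) ^+ 3 * CC.
Proof.
move=> k1.
have [f1 rf] := jostpP (wU1 n.+1) k1; have [h1 lh] := jostmP (wU1 n.+1) k1.
have [F1 rF] := jostpP (wU2 n.+1) k1; have [g1 lg] := jostmP (wU2 n.+1) k1.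
rewrite (k_over_tE rf lh) (k_over_tE rF lg) -mulrBr (le_trans (n1_half_i _)) //.
rewrite -n1N opprB; have [_ -> _] := Wr_diff (wU1 n.+1) (wU2 n.+1) rf lh rF lg.
have [pf pf1 bf _ _] := rf; have [pg pg1 bg] := jost_left_cprim lg.
set f := jostp _ k in pf pf1 bf *; set g := jostm _ k in pg pg1 bg *.
(* Slack per mode, chosen so that the 2n modes together lose at most 1. *)
pose e : R := (n * 2).+1%:R^-1.
have e0 : 0 < e by rewrite invr_gt0.
have [Q HQ] := choice (fun i : 'I_n * bool =>
  W1_rep (isT : (2 <= 3)%N) (Wn_fin (freq_idx_neq0 i)) e0).
have [V [eV pV wV]] := W1_rep (isT : (2 <= 2)%N) Wv_fin ltr01.
pose b (i : 'I_n * bool) : R := 2 * (W (freq_idx i) + e).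
have wQ i l : (l <= 3)%N -> cwL1 (Q i l) (b i).
  by move=> l3; have [_ _ H] := HQ i; exact: H.
have pQ i l : (l < 3)%N -> cprim (Q i l) (Q i l.+1).
  by move=> l3; have [_ H _] := HQ i; exact: H.
have wVS l : (l <= 1)%N -> cwL1 (V l) S.
  by move=> l1; apply: cwL1_ub (wV l l1 isT) _; rewrite ler_wpM2l // lerD2r.
have bS : \sum_i b i <= S.
  rewrite -mulr_sumr ler_wpM2l // big_split /= lerD //.
    by rewrite (sum_freq_idx W) sum_cW'.
  rewrite sumr_const card_prod card_ord card_bool -mulr_natl /e.
  by rewrite ler_pdivrMr // mul1r ler_nat.
(* A single null set outside of which q_av and all the modes agree with their representatives, so
   that both potentials can be swapped in the equations and in the integral. *)
have E : {ae mu, forall x, (qav x)%:C%C = V 0%N x /\ forall i, q (freq_idx i) x = Q i 0%N x}.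
  have EQ : {ae mu, forall x, forall i, q (freq_idx i) x = Q i 0%N x}.
    by apply: ae_forall_fin => i; have [] := HQ i.
  by apply: ae_and eV EQ => x.
pose om' (i : 'I_n * bool) := om (freq_idx i).
pose Ut1 x := V 0%N x - \sum_i ((om' i ^+ 2)^-1)%:C%C * (Q i 0%N x * Q (idx_opp i) 0%N x).
pose Ut2 x := V 0%N x + \sum_i Q i 0%N x * cexpi (om' i * x).
have E1 x : ((qav x)%:C%C = V 0%N x /\ forall i, q (freq_idx i) x = Q i 0%N x) ->
    (U1 n.+1 x)%:C%C = Ut1 x.
  move=> [h hQ]; rewrite /U1 rmorphD /= h /Ut1; congr (_ + _).
  under eq_bigr do rewrite -!hQ freq_idx_opp; by rewrite sum_cq rmorphN /= opprK.
have E2 x : ((qav x)%:C%C = V 0%N x /\ forall i, q (freq_idx i) x = Q i 0%N x) ->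
    (U2 n.+1 x)%:C%C = Ut2 x.
  move=> [h hQ]; rewrite /U2 rmorphD /= h /Ut2; congr (_ + _).
  by rewrite -sum_qe; apply: eq_bigr => i _; rewrite -hQ.
pose kap : C := (k ^+ 2)%:C%C.
have mV : cmeas (V 0%N) by case: (wVS 0%N isT).
have mQ i : cmeas (Q i 0%N) by case: (wQ i 0%N isT).
have mUt1 : cmeas Ut1.
  by apply: cmeasB => //; apply: cmeas_sum => i; apply: cmeasZ; exact: cmeasM.
have mUt2 : cmeas Ut2.
  by apply: cmeasD => //; apply: cmeas_sum => i; apply: cmeasM => //; exact: cmeas_cexpi.
have mf : cmeas f by have [] := cprim_meas pf.
have mg : cmeas g by have [] := cprim_meas pg.
have pf1' : cprim f1 (fun x => (Ut1 x - kap) * f x).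
  apply: cprim_ae pf1 _ _; first by apply: cmeasM => //; apply: cmeasB => //; exact: cmeas_cst.
  by apply: ae_mono E => x /E1 <-; rewrite rmorphB.
have pg1' : cprim g1 (fun x => (Ut2 x - kap) * g x).
  apply: cprim_ae pg1 _ _; first by apply: cmeasM => //; apply: cmeasB => //; exact: cmeas_cst.
  by apply: ae_mono E => x /E2 <-; rewrite rmorphB.
have K0 : 0 <= jost_const NN by apply: le_trans (bf 0).2.
have Kw x : jost_const NN <= jost_const NN * wt x by rewrite ler_peMr.
rewrite (@cint_ae _ _ (fun x => (Ut2 x - Ut1 x) * (f x * g x))); last 3 first.
- apply: cmeasM; last exact: cmeasM.
  by apply: cmeas_real; apply: measurable_funB; [case: (wU2 n.+1)|case: (wU1 n.+1)].
- by apply: cmeasM; [exact: cmeasB|exact: cmeasM].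
- by apply: ae_mono E => x Ex; rewrite rmorphB /= (E1 x Ex) (E2 x Ex).
have d0 : 0 < eps / theta by rewrite divr_gt0.
have dV : (eps / theta)^-1 = theta / eps by rewrite invf_div.
have om_ge j l : theta <= `|lam j + lam l| -> (eps / theta)^-1 <= `|om j + om l|.
  move=> jl; rewrite dV /om -mulrDl -mulrDr normrM normfV (gtr0_norm eps_gt0).
  rewrite ler_wpM2r ?invr_ge0 ?(ltW eps_gt0) // normrM.
  rewrite (le_trans jl) // ler_peMl // ger0_norm //.
  by rewrite (le_trans ler01).
rewrite /CC /homog_const -/S -/NN.
apply: (@core_estimate _ _ (@idx_opp n) (fun i => Q i 0%N) (fun i => Q i 1%N) (fun i => Q i 2%N)
  (fun i => Q i 3%N) om' b (V 0%N) (V 1%N) f f1 g g1 kap S S (jost_const NN) (eps / theta)) => //.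
- by move=> i; exact: pQ.
- by move=> i; exact: pQ.
- by move=> i; exact: pQ.
- by move=> i; exact: wQ.
- by move=> i; exact: wQ.
- by move=> i; exact: wQ.
- by move=> i; exact: wQ.
- exact: pV.
- exact: wVS.
- exact: wVS.
- by rewrite ler_pdivrMr // mul1r ltW.
- by move=> i; rewrite /om' freq_idx_opp /om (hypV_odd HV) ?freq_idx_neq0 // mulrN mulNr.
- move=> i; rewrite dV /om' /om normrM normfV (gtr0_norm eps_gt0).
  rewrite ler_wpM2r ?invr_ge0 ?(ltW eps_gt0) // normrM.
  rewrite (le_trans (hypV_gap0 HV (freq_idx_neq0 i))) // ler_peMl // ger0_norm //.
  by rewrite (le_trans ler01).
(* lam_i + lam_l is lam_i - lam_{-l}, so the gap hypothesis is applied to i and -l, which differ off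
   resonance. *)
- move=> i l li; apply: om_ge.
  have := hypV_gap HV (j := freq_idx i) (k := freq_idx (idx_opp l)) (freq_idx_neq0 _) (freq_idx_neq0 _).
  rewrite freq_idx_opp (hypV_odd HV) ?freq_idx_neq0 // opprK; apply.
  apply: contra li => /eqP il; apply/eqP; apply: freq_idx_inj.
  by rewrite freq_idx_opp il opprK.
- rewrite n1_real normrX exprn_ile1 //.
- by move=> x; have [] := bf x.
- by move=> x; have [_ h] := bf x; exact: le_trans (Kw x).
- by move=> x; have [] := bg x.
- by move=> x; have [_ h] := bg x; exact: le_trans (Kw x).
Qed.

Lemma homogenization_estimate k : `|k| <= 1 ->
  n1 (k_over_t (fun x => qav x + sigma_eff q lam eps x) k
      - k_over_t (fun x => qav x + q_eps q lam eps x) k) <= (eps / theta) ^+ 3 * CC.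
Proof.
move=> k1; rewrite sigma_effE q_epsE'.
have w1 : wL1 (fun x => qav x + kappa * cser x) NN.
  by have := wL1_qav_sigma; rewrite sigma_effE.
have w2 : wL1 (fun x => qav x + aser x) NN by have := wL1_qav_eps; rewrite q_epsE'.
have [_ _ ca] := a_series; have [_ _ cc] := c_series.
pose L : R := 2 * jost_const NN ^+ 2.
have L0 : 0 <= L by rewrite mulr_ge0 // sqr_ge0.
(* eps stays fixed while n tends to infinity: the two outer terms vanish, and the middle one does
   not depend on n. *)
pose e n : R := L * (`|kappa| * \int[mu]_x (wt x ^+ 2 * `|cpart n.+1 x - cser x|)) +
  (eps / theta) ^+ 3 * CC + L * \int[mu]_x (wt x ^+ 2 * `|apart n.+1 x - aser x|).
have ce : e @ \oo --> (eps / theta) ^+ 3 * CC.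
  have cA : (fun n => L * (`|kappa| * \int[mu]_x (wt x ^+ 2 * `|cpart n.+1 x - cser x|)))
      @ \oo --> L * (`|kappa| * 0).
    apply: cvgM; first exact: cvg_cst.
    by apply: cvgM; [exact: cvg_cst|rewrite -cvg_shiftS in cc].
  have cB : (fun n => L * \int[mu]_x (wt x ^+ 2 * `|apart n.+1 x - aser x|)) @ \oo --> L * 0.
    by apply: cvgM; [exact: cvg_cst|rewrite -cvg_shiftS in ca].
  have := cvgD (cvgD cA (cvg_cst ((eps / theta) ^+ 3 * CC))) cB.
  by rewrite !mulr0 add0r addr0 => H; exact: H.
apply: (ler_cvg_to (cvg_cst _) ce); apply: nearW => n.
set z1 := k_over_t _ k; set z2 := k_over_t _ k.
have tele (a b c d : C) : a - d = (a - b) + (b - c) + (c - d) by ring.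
rewrite (tele z1 (k_over_t (U1 n.+1) k) (k_over_t (U2 n.+1) k) z2).
rewrite (le_trans (n1D _ _)) // lerD //; last first.
  rewrite (le_trans (k_over_t_lip (wU2 n.+1) w2 k1)) // ler_wpM2l // le_eqVlt; apply/orP; left.
  by apply/eqP; apply: eq_Rintegral => x _; rewrite /U2 opprD addrACA subrr add0r.
rewrite (le_trans (n1D _ _)) // lerD //; last exact: trunc_estimate.
rewrite (le_trans (k_over_t_lip w1 (wU1 n.+1) k1)) // ler_wpM2l //.
have [hs hpart _] := c_series.
have Ic : intg setT (fun x => wt x ^+ 2 * `|cpart n.+1 x - cser x|).
  have [_ I1 _] := wL1D (hpart n.+1) (wL1Z (-1) hs).
  by apply: eq_intg I1 => // x _; rewrite mulN1r.
rewrite -RintegralZl // le_eqVlt; apply/orP; left.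
by apply/eqP; apply: eq_Rintegral => x _; rewrite /U1 opprD addrACA subrr add0r
  -mulrBr normrM distrC mulrCA.
Qed.

Lemma sigma_first_order k : eps <= 1 -> `|k| <= 1 ->
  n1 (k_over_t (sigma_eff q lam eps) k -
     (k%:C%C - Complex 0 1 / 2 * (eps ^+ 2 * int_Lambda_eff q lam)%:C%C)) <=
  eps ^+ 3 * (4 * jost_const NN * (Ct * Na) ^+ 2).
Proof.
move=> eps1 k1.
have SN : eps ^+ 2 * (Ct * Na) <= NN.
  apply: (@le_trans _ _ (theta ^+ 2 * Ct * Na)).
    rewrite -(mulrA (theta ^+ 2)); apply: ler_wpM2r; first exact: (mulr_ge0 Ct0).
    by rewrite lerXn2r ?nnegrE ?ltW.
  rewrite /Ct mulrA divff ?mul1r ?expf_neq0 ?gt_eqF //.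
  by have := Na0; rewrite /NN expr2; nra.
have := k_over_t_first_order sigma_wL1 SN k1.
have IL : intg setT (Lambda_eff q lam).
  have -> : Lambda_eff q lam = fun x => (4 * pi ^+ 2)^-1 * cser x.
    by apply/funext => x; rewrite Lambda_effE.
  by apply: intgZ => //; have [h _ _] := c_series; exact: wL1_intg h.
have -> : \int[mu]_x sigma_eff q lam eps x = - eps ^+ 2 * int_Lambda_eff q lam.
  by rewrite /sigma_eff RintegralZl.
have -> : k%:C%C + Complex 0 2^-1 * (- eps ^+ 2 * int_Lambda_eff q lam)%:C%C =
  k%:C%C - Complex 0 1 / 2 * (eps ^+ 2 * int_Lambda_eff q lam)%:C%C.
  by rewrite mulNr rmorphN mulrN half_iE.
move=> /le_trans; apply.
have K0 : 0 <= jost_const NN by apply: le_trans (jost_const_ge NN0).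
(* The remainder is quadratic in sigma = O(eps^2), and eps^4 <= eps^3 as eps <= 1. *)
rewrite exprMn mulrCA ler_wpM2r //; last by rewrite -exprM ler_wiXn2l // ltW.
by rewrite mulr_ge0 ?sqr_ge0 // mulr_ge0.
Qed.

End Eps.
End Homogenization.

(** * Behavior near k = 0 and conclusion *)

Section LowEnergy.
Context {R : realType}.
Local Notation C := R[i].
Local Notation Re := complex.Re.
Local Notation Im := complex.Im.

(** The generic situation at zero energy: if k/t stays away from 0, then t vanishes at k = 0. *)
Lemma clim_quot_eq0 (K : R -> C) (c : R) : 0 < c ->
  (\forall l \near (0 : R)^', c <= cmod (K l)) ->
  clim (0 : R)^' (fun l : R => l%:C%C / K l) = 0.
Proof.
move=> c0 cK.
have bd : \forall l \near (0 : R)^', cmod (l%:C%C / K l) <= `|l| / c.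
  apply: filterS cK => l cl; have Kl := lt_le_trans c0 cl.
  have K0 : K l != 0 by apply/eqP => e; move: Kl; rewrite e cmod_real normr0 ltxx.
  by rewrite cmod_div // cmod_real ler_wpM2l // lef_pV2.
have lc : (fun l : R => `|l| / c) @ (0 : R)^' --> (0 : R).
  rewrite -[X in _ --> X](mul0r c^-1); apply: cvgM; last exact: cvg_cst.
  have : (fun l : R => `|l|) @ (0 : R)^' --> `|0 : R|.
    by apply: cvg_norm; exact: cvg_within.
  by rewrite normr0.
have P (h : C -> R) : (forall z, `|h z| <= cmod z) ->
    lim ((fun l : R => h (l%:C%C / K l)) @ (0 : R)^') = 0.
  move=> hz; apply/cvg_lim => //.
  apply: (squeeze_cvgr (f := fun l : R => - (`|l| / c)) (h := fun l : R => `|l| / c)) => //.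
    apply: filterS bd => l /(le_trans (hz _)); by rewrite ler_norml.
  by have := cvgN lc; rewrite oppr0; apply.
by rewrite /clim (P _ (@cmod_Re R)) (P _ (@cmod_Im R)).
Qed.

Lemma sup_low_le (F : R -> R) (b : \bar R) :
  (forall k, `|k| <= 1 -> ((F k)%:E <= b)%E) -> (sup_low F <= b)%E.
Proof. by move=> Fb; apply: ge_ereal_sup => _ [k k1 <-]; exact: Fb. Qed.

(** k is real, so the imaginary part of the leading term is - s / 2 whatever k is; this bounds |z|
    below uniformly in k. *)
Lemma cmod_ge_imag (z : C) (k s d : R) :
  n1 (z - (k%:C%C - Complex 0 1 / 2 * s%:C%C)) <= d -> `|s| / 2 - d <= cmod z.
Proof.
set w := k%:C%C - _ => zw; apply: le_trans (cmod_Im z).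
have hI : `|Im (z - w)| <= d by apply: le_trans zw; rewrite /n1 lerDr.
have e : Im w = - (s / 2).
  by rewrite /w half_iE cImB cImM /=; lra.
move: hI; rewrite cImB e opprK => hI.
have := ler_normB (Im z + s / 2) (Im z); rewrite (addrC (Im z)) addrK.
rewrite (addrC (s / 2)) normrM (ger0_norm (_ : 0 <= 2^-1)) // => h; lra.
Qed.

End LowEnergy.

Theorem theorem4p1 (R : realType) (theta : R) (theta_gt0 : 0 < theta) :
  (exists C : R -> R, (forall N : R, 0 < C N) /\
    forall (qav : R -> R) (q : int -> R -> R[i]) (lam : int -> R),
      hypV theta qav q lam ->
      exists2 eps0 : R, 0 < eps0 & forall eps : R, 0 < eps < eps0 ->
        let CN := C (fine (Nalg qav q)) in
        let sup_diff := sup_low (fun k =>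
          cmod (k_over_t (fun x => qav x + sigma_eff q lam eps x) k
                - k_over_t (fun x => qav x + q_eps q lam eps x) k)) in
        let sup_t := sup_low (fun k => cmod (transmission qav k)) in
        (sup_diff <= (eps ^+ 3 * CN)%:E * maxe 1 sup_t)%E /\
        ((eps ^+ 3 * CN)%:E * maxe 1 sup_t <= (eps ^+ 3 * CN)%:E)%E)
  /\
  (forall (qav : R -> R) (q : int -> R -> R[i]) (lam : int -> R),
    hypV theta qav q lam -> (forall x, qav x = 0) ->
    exists C : R, exists2 eps0 : R, 0 < eps0 &
      forall eps : R, 0 < eps < eps0 ->
      exists r : R -> R[i],
        (forall k : R, `|k| <= 1 -> cmod (r k) <= C * eps ^+ 3) /\
        (forall k : R, `|k| <= 1 ->
          transmission (q_eps q lam eps) k =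
          k_quotient (fun k' => k'%:C%C
            - Complex 0 1 / 2 * (eps ^+ 2 * int_Lambda_eff q lam)%:C%C
            + r k') k)).
Proof.
have hom (qav : R -> R) q lam (HV : hypV theta qav q lam) (eps k : R) :
    0 < eps < theta -> `|k| <= 1 ->
    n1 (k_over_t (fun x => qav x + sigma_eff q lam eps x) k
      - k_over_t (fun x => qav x + q_eps q lam eps x) k) <=
    eps ^+ 3 * (`|homog_const (fine (Nalg qav q))| / theta ^+ 3 + 1).
  case/andP=> e0 et k1.
  apply: (le_trans (homogenization_estimate theta_gt0 HV e0 et k1)).
  have t3 : 0 < theta ^+ 3 := exprn_gt0 _ theta_gt0.
  rewrite expr_div_n -mulrA ler_wpM2l ?exprn_ge0 ?(ltW e0) //.
  by rewrite mulrC -[leLHS]addr0 lerD // ler_wpM2r ?invr_ge0 ?(ltW t3) // ler_norm.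
split.
  (* The absolute value and the 1 make the constant positive for every real N. *)
  exists (fun N => `|homog_const N| / theta ^+ 3 + 1); split.
    by move=> N; rewrite ltr_wpDl // divr_ge0 // exprn_ge0 // ltW.
  move=> qav q lam HV; exists theta => // eps e.
  move=> CN sup_diff sup_t.
  have b0 : 0 <= eps ^+ 3 * CN.
    case/andP: e => e0 _.
    by rewrite mulr_ge0 ?exprn_ge0 ?(ltW e0) // addr_ge0 // divr_ge0 // exprn_ge0 // ltW.
  split; last first.
    apply: (@le_trans _ _ ((eps ^+ 3 * CN)%:E * 1)%E); last by rewrite mule1.
    apply: lee_wpmul2l; first by rewrite lee_fin.
    rewrite ge_max lexx /=; apply: sup_low_le => k k1; rewrite lee_fin;
        exact: transmission_le1 (qav_wL1 HV) k1.
  apply: sup_low_le => k k1; apply: (@le_trans _ _ ((eps ^+ 3 * CN)%:E * 1)%E).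
    by rewrite mule1 lee_fin (le_trans (cmod_le_n1 _)) //; exact: hom.
  by rewrite lee_wpmul2l ?lee_fin // le_max lexx.
move=> qav q lam HV qav0.
set L := int_Lambda_eff q lam.
set H := `|homog_const (fine (Nalg qav q))| / theta ^+ 3 + 1.
(* The witness comes from [sigma_first_order]; it is fixed before eps and k are introduced and hence
   does not depend on them. *)
have [B so] : exists B : R, forall eps k, 0 < eps -> eps < theta -> eps <= 1 -> `|k| <= 1 ->
    n1 (k_over_t (sigma_eff q lam eps) k -
      (k%:C%C - Complex 0 1 / 2 * (eps ^+ 2 * L)%:C%C)) <= eps ^+ 3 * B.
  by eexists => eps k e0 et e1 k1; exact: (sigma_first_order theta_gt0 HV e0 et e1 k1).
pose A := H + `|B|.
have A0 : 0 < A.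
  by rewrite /A ltr_pwDl // /H ltr_wpDl // divr_ge0 // exprn_ge0 // ltW.
(* When L is nonzero, eps < |L| / (2A) makes the error A eps^3 smaller than eps^2 |L| / 2, the
   imaginary part of the leading term. *)
exists A; exists (Num.min (Num.min 1 theta) (if L == 0 then 1 else `|L| / (2 * A))).
  rewrite !lt_min ltr01 theta_gt0 /=; case: ifPn => // L0.
  by rewrite divr_gt0 ?normr_gt0 // mulr_gt0.
move=> eps /andP[e0]; rewrite !lt_min => /andP[/andP[e1 et] eL].
set K := k_over_t (q_eps q lam eps).
pose D0 (k : R) : R[i] := k%:C%C - Complex 0 1 / 2 * (eps ^+ 2 * L)%:C%C.
have e3 : 0 <= eps ^+ 3 by rewrite exprn_ge0 // ltW.
have KD k : `|k| <= 1 -> n1 (K k - D0 k) <= A * eps ^+ 3.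
  move=> k1; have := hom _ _ _ HV eps k; rewrite e0 et => /(_ isT k1).
  have E h : (fun x => qav x + h x) = h by apply/funext => x; rewrite qav0 add0r.
  rewrite !E -/K => h1; have h2 := so eps k e0 et (ltW e1) k1.
  set z := k_over_t _ k in h1 h2.
  have tele (a b d : R[i]) : a - d = - (b - a) + (b - d) by ring.
  rewrite (tele (K k) z) (le_trans (n1D _ _)) // n1N /A mulrC mulrDr lerD //.
  by apply: (le_trans h2); rewrite ler_wpM2l // ler_norm.
have K_ge k : `|k| <= 1 -> eps ^+ 2 * `|L| / 2 - A * eps ^+ 3 <= cmod (K k).
  by move=> /KD /cmod_ge_imag; rewrite normrM (ger0_norm (sqr_ge0 eps)).
(* The exact remainder, except at k = 0 when L = 0: there the value 0 makes the denominator vanish,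
   so that [k_quotient] reads 0 / 0 as the same limit that defines the transmission coefficient. *)
pose r k : R[i] := if (k == 0) && (L == 0) then 0 else K k - D0 k.
exists r; split.
  move=> k k1; rewrite /r; case: ifP => _.
    by rewrite cmod_real normr0 mulr_ge0 // ltW.
  by rewrite (le_trans (cmod_le_n1 _)) // KD.
have rD k : k != 0 -> D0 k + r k = K k.
  by move=> k0; rewrite /r (negbTE k0) /= addrC subrK.
move=> k k1; rewrite /transmission /k_quotient -/K -/L.
case: (eqVneq k 0) => [k0|k0] /=; last by rewrite -[in RHS]/(D0 k) rD.
rewrite -[X in X == 0]/(D0 k + r k).
have [L0|L0] := eqVneq L 0.
  have -> : D0 k + r k = 0 by rewrite /r /D0 k0 L0 !eqxx mulr0 mulr0 subr0 addr0.
  rewrite eqxx; congr clim; apply/funext => l.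
  have [->|l0] := eqVneq l 0; first by rewrite !mul0r.
  by rewrite -[X in _ = _ / X]/(D0 l + r l) rD.
(* For L nonzero both sides vanish at k = 0: the left one as a limit, since k/t is bounded below
   near 0, and the right one as 0 over a nonzero number. *)
have c0 : 0 < eps ^+ 2 * `|L| / 2 - A * eps ^+ 3.
  move: eL; rewrite (negbTE L0) ltr_pdivlMr ?mulr_gt0 // => eL.
  have e2 : 0 < eps ^+ 2 := exprn_gt0 _ e0.
  rewrite exprSr; nra.
have -> : D0 k + r k = K k by rewrite /r (negbTE L0) andbF addrC subrK.
have Kk : K k != 0.
  apply/eqP => e; have := lt_le_trans c0 (K_ge k k1).
  by rewrite e cmod_real normr0 ltxx.
rewrite (negbTE Kk) k0 mul0r; apply: (clim_quot_eq0 c0).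
near=> l; apply: K_ge; near: l; exact: dnbhs0_le.
Unshelve. all: by end_near. Qed.
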